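(* Let $T>0$, $\beta\in(0,1)$, and let $L_hw_h=\partial_{tt}w_h-\Delta_hw_h$. There exist $s_0>0$, $\lambda>0$, $\varepsilon>0$, $h_0>0$ and a constant $M=M(s_0,\lambda,T,\varepsilon,\beta)>0$ independent of $h$ such that for all $h\in(0,h_0)$ (of the form $h=1/(N+1)$, $N\in\mathbb N$), all $s\in(s_0,\varepsilon/h)$ and all time-dependent discrete functions $w_h=(w_{j,h}(t))_{0\le j\le N+1}$, $t\in(-T,T)$, satisfying $$L_hw_h\in L^2(-T,T;L_h^2(0,1)),\qquad w_{0,h}(t)=w_{N+1,h}(t)=0\ \text{ on }(-T,T),\qquad w_h(\pm T)=\partial_tw_h(\pm T)=0,$$ one has $$s\int_{-T}^T\!\int_{(0,1)}e^{2s\varphi}|\partial_tw_h|^2dt+s\int_{-T}^T\!\int_{[0,1)}e^{2s\varphi}|\partial_h^+w_h|^2dt+s^3\int_{-T}^T\!\int_{(0,1)}e^{2s\varphi}|w_h|^2dt$$ $$\le M\int_{-T}^T\!\int_{(0,1)}e^{2s\varphi}|L_hw_h|^2dt+Ms\int_{-T}^Te^{2s\varphi(t,1)}\big|(\partial_h^-w_h)_{N+1}\big|^2dt+Ms\int_{-T}^T\!\int_{[0,1)}e^{2s\varphi}|h\,\partial_h^+\partial_tw_h|^2dt .$$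
   Context: For $N\in\mathbb N$ put $h=1/(N+1)$, $x_j=jh$. For discrete functions: $(\Delta_hv)_j=(v_{j+1}-2v_j+v_{j-1})/h^2$, $(\partial_h^+v)_j=(\partial_h^-v)_{j+1}=(v_{j+1}-v_j)/h$; $\int_{(0,1)}f=h\sum_{j=1}^Nf_j$, $\int_{[0,1)}f=h\sum_{j=0}^Nf_j$; $\|f\|^2_{L_h^2(0,1)}=\int_{(0,1)}|f|^2$. A continuous function of $x$ appearing in a discrete integral is evaluated at the points $x_j$. Weight functions: fix $x^0<0$ and $C_0>0$ such that $\psi(t,x)=|x-x^0|^2-\beta t^2+C_0$ satisfies $\psi\ge1$ on $[-T,T]\times[0,1]$; for the parameter $\lambda>0$, $\varphi(t,x)=e^{\lambda\psi(t,x)}$. The point $x^0$ and constant $C_0$ are fixed once and for all. *)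

(* Defs.v *)
From HB Require Import structures.
From mathcomp Require Import all_boot all_order all_algebra.
From mathcomp Require Import all_classical all_reals all_analysis.

Set Implicit Arguments.
Unset Strict Implicit.
Unset Printing Implicit Defensive.

Import Order.TTheory GRing.Theory Num.Theory.
Import numFieldNormedType.Exports.

Local Open Scope classical_set_scope.
Local Open Scope ring_scope.

Section Discrete.
Context {R : realType}.

Definition mesh (N : nat) : R := (N.+1%:R)^-1.

(* A discrete function (v_j)_(0 <= j <= N+1) is a function [v : nat -> R]; its
   values at indices j > N+1 are never used. *)
Implicit Types v f : nat -> R.

Definition Dplus (N : nat) v : nat -> R := fun j => (v j.+1 - v j) / mesh N.

(* [j.-1] truncates: meaningful only for j >= 1. *)
Definition Dminus (N : nat) v : nat -> R := fun j => (v j - v j.-1) / mesh N.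

(* [j.-1] truncates: meaningful only for 1 <= j <= N. *)
Definition Laph (N : nat) v : nat -> R :=
  fun j => (v j.+1 - 2 * v j + v j.-1) / mesh N ^+ 2.

(* h * sum over the interior nodes j = 1, ..., N *)
Definition dint_oo (N : nat) f : R := mesh N * \sum_(1 <= j < N.+1) f j.

(* h * sum over the nodes j = 0, ..., N *)
Definition dint_co (N : nat) f : R := mesh N * \sum_(0 <= j < N.+1) f j.

(* Time integrals take values in [\bar R], so that no integrability has to be
   presupposed for the nonnegative integrands they are applied to. *)
Definition time_int (T : R) (g : R -> R) : \bar R :=
  (\int[lebesgue_measure]_(t in `](- T)%R, T[) (g t)%:E)%E.

Definition psi (x0 C0 beta t x : R) : R :=
  `|x - x0| ^+ 2 - beta * t ^+ 2 + C0.

Definition phi (x0 C0 beta lambda t x : R) : R :=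
  expR (lambda * psi x0 C0 beta t x).

(* A time-dependent discrete function is [w : nat -> R -> R], with [w j t] for
   w_j(t). *)
Definition at_time (w : nat -> R -> R) (t : R) : nat -> R := fun j => w j t.

Definition dt (w : nat -> R -> R) : nat -> R -> R := fun j => derive1 (w j).

(* [u] is in W^{2,1}(-T,T), taken in its continuous representative, and [u2] is
   a representative of its weak second derivative: u is C^1 on (-T,T) and u' is
   absolutely continuous with density u2.  [u2] is only determined a.e. *)
Definition has_weak_dtt (T : R) (u u2 : R -> R) : Prop :=
  [/\ {within `[- T, T], continuous u},
      forall t : R, t \in `]- T, T[ -> derivable u t 1,
      (@lebesgue_measure R).-integrable `]- T, T[ (EFin \o u2) &
      forall a b : R, - T < a -> a <= b -> b < T ->
        derive1 u b - derive1 u a = \int[lebesgue_measure]_(t in `[a, b]) u2 t].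

(* L_h w = d_tt w - Delta_h w, where [wtt] is the second time derivative of w *)
Definition Lh (N : nat) (w wtt : nat -> R -> R) : nat -> R -> R :=
  fun j t => wtt j t - Laph N (at_time w t) j.

(* f is in L^2(-T,T; L^2_h(0,1)) *)
Definition in_L2L2h (T : R) (N : nat) (f : nat -> R -> R) : Prop :=
  (forall j, (1 <= j <= N)%N -> measurable_fun `]- T, T[ (f j)) /\
  (time_int T (fun t => dint_oo N (fun j => `|f j t| ^+ 2))%R < +oo)%E.

(* The first time derivative at the end points is understood as the one-sided
   limit of u' from inside (-T,T). *)
Definition vanishes_at_ends (T : R) (u : R -> R) : Prop :=
  [/\ u (- T) = 0, u T = 0,
      derive1 u t @[t --> (- T)^'+] --> 0 & derive1 u t @[t --> T^'-] --> 0].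

End Discrete.

(* Main.v *)
(** The weight separates, [phi(t,x) = phit(t) phix(x)].  Put [v = e^(s phi) w];
    then [e^(s phi) L_h w = P1 + P2] with [P1] symmetric and [P2] antisymmetric
    in space-time; on the edge [(j,j+1)] the discrete exponentials enter through
    the cosh and sinh of [s (phi_(j+1) - phi_j)].  For the multiplier
    [X = P2 - s kappa phi v - k s h^2 Delta_h v] one has
    [4 <P1,X> <= |P1 + X|^2], and summation by parts writes [<P1,X>] as an exact
    time derivative plus a quadratic form in [(v_t, d_h^+ v, s v)].  Up to errors
    of order [eta = s h + 1/s] this is the form of the continuous Carleman
    estimate, coercive for [lambda = 1/((1-beta) x0^2)], [kappa = 2(1+beta) lambda].
    The discretization leaves in addition [-(s/2) phi_xx h^2 |Delta_h v|^2], which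
    the last term of [X] compensates at the price of [s |h d_h^+ v_t|^2].
    All this holds at each fixed [t]; the time derivative integrates to 0 because
    [v] and [v_t] vanish at [-T] and [T]. *)
Require Import Defs.
From HB Require Import structures.
From mathcomp Require Import all_boot all_order all_algebra.
From mathcomp Require Import all_classical all_reals all_analysis.
From mathcomp Require Import measurable_realfun ring lra.
Import Order.TTheory GRing.Theory Num.Theory.
Import numFieldNormedType.Exports.
Local Open Scope classical_set_scope.
Local Open Scope ring_scope.

Set Implicit Arguments.
Unset Strict Implicit.
Unset Printing Implicit Defensive.

(** * The summation by parts identity *)

(** As [s] may be as large as [eps/h], the increments of [s phi] over a cell are only of order
    [s h], which does not tend to 0 with [h]. The identity is therefore kept exact, as polynomial
    algebra in the cosh and sinh of the edges, and only its coefficients are expanded, uniformly in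
    [(s, h, t, x)]. In the unknown [y = s v] every coefficient, once divided by [s], is bounded. The
    multiplier [P2] alone does not suffice: it gives [v_t^2] the coefficient [2 phi_tt], negative at
    [t = 0]. The term with [kappa] moves [kappa phi] from [v_x^2] to [v_t^2], and [beta < 1] leaves
    room for both coefficients to be positive. The coefficient of [v^2] is delicate where
    [phi_x^2 = phi_t^2]; there its positivity comes from [(x - x0)^2 >= x0^2 > 0], since [x0] lies
    to the left of [[0,1]]. On the way back to [w], the commutator of [e^(s phi)] with [h d_h^+ d_t]
    carries a factor [s h] and is absorbed by lowering [eps]. *)

Lemma sum_by_parts (R : zmodType) (N : nat) (F G U V K : nat -> R) :
  (forall i, F i = G i + (U i.+1 + V i)) -> (forall j, U j + V j = K j) ->
  \sum_(0 <= i < N) F i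
  = \sum_(0 <= i < N) G i + \sum_(0 <= j < N.+1) K j - U 0%N - V N.
Proof.
move=> FG UVK.
rewrite (eq_bigr _ (fun i _ => FG i)) big_split /=.
rewrite -(eq_bigr _ (fun j _ => UVK j)) !big_split /=.
rewrite (big_nat_recl _ _ U) // (big_nat_recr _ _ V) //=.
set a := \sum_(0 <= i < N) G i; set b := \sum_(0 <= i < N) U i.+1.
set c := \sum_(0 <= i < N) V i.
rewrite [U 0%N + b]addrC -!addrA; congr (_ + (_ + _)).
by rewrite [- U 0%N - _]addrC !addrA addrK [U 0%N + c]addrC addrK.
Qed.

Section Identity.
Variables (R : realFieldType) (s r k K A0 A1 A2 A3 : R).
Variables (E C S v p q : nat -> R).

(* [r] is [h^-2].  Node quantities with index [i] live at the node [i+1], which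
   avoids predecessors.  [C j.+1], [S j.+1] (cosh and sinh) belong to the edge
   [(j,j+1)]; [C 0], [S 0] belong to a ghost edge on the left of node 0. *)
Definition D2 (u : nat -> R) i := u i.+2 - 2 * u i.+1 + u i.
(** [r * (Sv - Av)] is the conjugated Laplacian [e^(s phi) Delta_h (e^(- s phi) v)]; writing the
    exponentials as cosh plus or minus sinh separates its symmetric part from its antisymmetric
    part. *)
Definition Av i := S i.+2 * v i.+2 - S i.+1 * v i.
Definition Sv i := C i.+2 * v i.+2 - 2 * v i.+1 + C i.+1 * v i.
Definition P1 i := q i.+1 + s ^+ 2 * (A1 * E i.+1) ^+ 2 * v i.+1 - r * Sv i.
Definition P2 i := - (2 * s * A1 * E i.+1 * p i.+1) - s * A2 * E i.+1 * v i.+1 + r * Av i.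
Definition Xm i := P2 i - s * K * A0 * E i.+1 * v i.+1 - k * s * D2 v i.
Definition dE j := E j.+1 - E j.
Definition mE j := (E j + E j.+1) / 2.
Definition dv j := v j.+1 - v j.
(** By the addition formulas, [rho] and [cc] are the sinh of the difference and the cosh of the sum
    of the exponents on the two edges that meet at node [j]. To leading order [rho] is
    [s h^2 phi_xx]. *)
Definition rho j := C j * S j.+1 - C j.+1 * S j.
Definition cc j := C j.+1 * C j + S j.+1 * S j.
(* The time derivatives of [C j.+1] and [S j.+1]. *)
Definition Ct j := S j.+1 * (s * A1 * dE j).
Definition St j := C j.+1 * (s * A1 * dE j).

(* If [v' = p] and [p' = q], then [bnode'] and [bedge'] below are the time
   derivatives of [bnode] and [bedge]. *)
Definition bnode i :=
  - (s * A1 * E i.+1 * p i.+1 ^+ 2) - s * A2 * E i.+1 * v i.+1 * p i.+1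
  - s * K * A0 * E i.+1 * v i.+1 * p i.+1
  - s ^+ 3 * (A1 * E i.+1) ^+ 3 * v i.+1 ^+ 2
  - k * s * p i.+1 * D2 v i + r * p i.+1 * Av i
  - 2 * s * r * A1 * E i.+1 * v i.+1 ^+ 2.
Definition bnode' i :=
  - (s * A2 * E i.+1 * p i.+1 ^+ 2) - 2 * s * A1 * E i.+1 * p i.+1 * q i.+1
  - s * A3 * E i.+1 * v i.+1 * p i.+1 - s * A2 * E i.+1 * (p i.+1 ^+ 2 + v i.+1 * q i.+1)
  - s * K * A1 * E i.+1 * v i.+1 * p i.+1
  - s * K * A0 * E i.+1 * (p i.+1 ^+ 2 + v i.+1 * q i.+1)
  - 3 * s ^+ 3 * (A1 * E i.+1) ^+ 2 * (A2 * E i.+1) * v i.+1 ^+ 2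
  - 2 * s ^+ 3 * (A1 * E i.+1) ^+ 3 * v i.+1 * p i.+1
  - k * s * (q i.+1 * D2 v i + p i.+1 * D2 p i)
  + r * (q i.+1 * Av i
         + p i.+1 * (St i.+1 * v i.+2 + S i.+2 * p i.+2 - St i * v i - S i.+1 * p i))
  - 2 * s * r * (A2 * E i.+1 * v i.+1 ^+ 2 + 2 * A1 * E i.+1 * v i.+1 * p i.+1).
Definition bedge j := s * r * C j.+1 * A1 *
  (dE j * (v j.+1 ^+ 2 - v j ^+ 2) + 2 * mE j * (v j * v j.+1)).
Definition bedge' j :=
  s * r * (Ct j * A1 + C j.+1 * A2) *
    (dE j * (v j.+1 ^+ 2 - v j ^+ 2) + 2 * mE j * (v j * v j.+1))
  + s * r * C j.+1 * A1 *
  (dE j * (2 * v j.+1 * p j.+1 - 2 * v j * p j) + 2 * mE j * (p j * v j.+1 + v j * p j.+1)).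

(** The term [- r^2 rho (D2 v)^2 / 2] has no continuous counterpart and has the wrong sign. It is
    countered by [k s r Sv D2 v], which comes with [- k s (p j.+1 - p j)^2] in [gedge]. *)
Definition gnode i :=
  s * (2 * A2 + K * A0) * E i.+1 * p i.+1 ^+ 2
  + s * (A3 + K * A1) * E i.+1 * v i.+1 * p i.+1
  + s ^+ 3 * (2 * A2 * E i.+1 - K * A0 * E i.+1) * (A1 * E i.+1) ^+ 2 * v i.+1 ^+ 2
  + r ^+ 2 * rho i.+1 * (cc i.+1 - 1) * v i.+1 ^+ 2
  - r ^+ 2 * rho i.+1 * (D2 v i) ^+ 2 / 2
  + s * K * A0 * r * v i.+1 ^+ 2 * (C i.+2 * mE i.+1 + C i.+1 * mE i - 2 * E i.+1)
  + k * s * r * Sv i * D2 v i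
  - k * s ^+ 3 * (A1 * E i.+1) ^+ 2 * v i.+1 * D2 v i.
Definition gedge j :=
  - (k * s * (p j.+1 - p j) ^+ 2)
  - 2 * s * r * C j.+1 * A1 * dE j * dv j * (p j + p j.+1)
  - s * r * (Ct j * A1 + C j.+1 * A2) * dE j * dv j * (v j + v j.+1)
  - 2 * s ^+ 2 * r * S j.+1 * A1 ^+ 2 * (E j.+1 ^+ 2 - E j ^+ 2) * v j * v j.+1
  - s * K * A0 * r * C j.+1 * mE j * dv j ^+ 2
  + r ^+ 2 * (rho j + rho j.+1) * dv j ^+ 2
  + r ^+ 2 * (rho j.+1 - rho j) * (v j + v j.+1) / 2 * dv j.

(** [U j] and [V j] are what edge [(j,j+1)] contributes to its left and right end nodes. Summed over
    the interior nodes, each edge receives [U j + V j], except that the shares of nodes 0 and N+1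
    are missing; those are the boundary terms. *)
Let U j :=
  k * s * p j * (p j.+1 - p j)
  - r * p j * St j * v j.+1 - r * S j.+1 * p j * p j.+1
  + r * C j.+1 * v j.+1 * (2 * s * A1 * E j * p j + s * A2 * E j * v j)
  + s ^+ 2 * r * A1 ^+ 2 * E j ^+ 2 * v j * S j.+1 * v j.+1
  + r * C j.+1 * s * K * A0 * (v j.+1 * E j * v j - mE j * v j ^+ 2)
  + r ^+ 2 * (- (rho j * v j * dv j) + rho j * dv j ^+ 2 / 2
     - C j.+1 * S j.+1 * (v j ^+ 2 + v j.+1 ^+ 2) + 2 * S j.+1 * v j * v j.+1).
Let V j :=
  - (k * s * p j.+1 * (p j.+1 - p j))
  + r * p j.+1 * St j * v j + r * S j.+1 * p j * p j.+1
  + r * C j.+1 * v j * (2 * s * A1 * E j.+1 * p j.+1 + s * A2 * E j.+1 * v j.+1)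
  - s ^+ 2 * r * A1 ^+ 2 * E j.+1 ^+ 2 * v j.+1 * S j.+1 * v j
  + r * C j.+1 * s * K * A0 * (v j.+1 * E j.+1 * v j - mE j * v j.+1 ^+ 2)
  + r ^+ 2 * (rho j.+1 * v j.+1 * dv j + rho j.+1 * dv j ^+ 2 / 2
     + C j.+1 * S j.+1 * (v j ^+ 2 + v j.+1 ^+ 2) - 2 * S j.+1 * v j * v j.+1).

Lemma carleman_identity N :
  (forall j, C j ^+ 2 - S j ^+ 2 = 1) ->
  v 0%N = 0 -> p 0%N = 0 -> v N.+1 = 0 -> p N.+1 = 0 ->
  \sum_(0 <= i < N) P1 i * Xm i
  = \sum_(0 <= i < N) (bnode' i + gnode i) + \sum_(0 <= j < N.+1) (bedge' j + gedge j)
    + r ^+ 2 * (C 1%N * S 1%N * dv 0 ^+ 2 - C N.+1 * S N.+1 * dv N ^+ 2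
                - rho 0 * dv 0 ^+ 2 / 2 - rho N.+1 * dv N ^+ 2 / 2).
Proof.
move=> CS v0 p0 vN pN.
rewrite (@sum_by_parts _ N _ (fun i => bnode' i + gnode i) U V (fun j => bedge' j + gedge j)).
- by rewrite /U /V /dv v0 p0 vN pN; field.
- move=> i.
  (* This is [(sinh 2a - sinh 2b)/2 = sinh (a-b) cosh (a+b)], and the only use of
     [cosh^2 - sinh^2 = 1]; the rest is a rational identity. *)
  have tau : rho i.+1 * (cc i.+1 - 1) = C i.+2 * S i.+2 - C i.+1 * S i.+1 - rho i.+1.
    rewrite /rho /cc.
    transitivity (C i.+2 * S i.+2 * (C i.+1 ^+ 2 - S i.+1 ^+ 2)
      - C i.+1 * S i.+1 * (C i.+2 ^+ 2 - S i.+2 ^+ 2)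
      - (C i.+1 * S i.+2 - C i.+2 * S i.+1)); first ring.
    by rewrite !CS !mulr1.
  rewrite /gnode -(mulrA (r ^+ 2) (rho _) (cc _ - 1)) tau.
  rewrite /P1 /Xm /P2 /bnode' /U /V /rho /Sv /Av /D2 /St /mE /dE /dv.
  by field.
- move=> j. 
  rewrite /bedge' /gedge /U /V /rho /Ct /St /mE /dE /dv.
  by field.
Qed.
End Identity.

Section Sums.
Context {R : numDomainType}.
Implicit Types F : nat -> R.

Lemma sum_edge_left N F : F 0%N = 0 ->
  \sum_(0 <= j < N.+1) F j = \sum_(0 <= i < N) F i.+1.
Proof. by move=> F0; rewrite big_nat_recl// F0 add0r. Qed.

Lemma sum_edge_right N F : F N.+1 = 0 ->
  \sum_(0 <= j < N.+1) F j.+1 = \sum_(0 <= i < N) F i.+1.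
Proof. by move=> FN; rewrite big_nat_recr//= FN addr0. Qed.

Lemma sum_shift_le N F : (forall i, 0 <= F i) -> F N.+1 = 0 ->
  \sum_(0 <= i < N) F i.+2 <= \sum_(0 <= i < N) F i.+1.
Proof.
move=> F0 FN.
rewrite -[leRHS](sum_edge_right FN) (big_nat_recl _ _ (fun j => F j.+1))//=.
by rewrite lerDr.
Qed.

Lemma sum_unshift_le N F : (forall i, 0 <= F i) -> F 0%N = 0 ->
  \sum_(0 <= i < N) F i <= \sum_(0 <= i < N) F i.+1.
Proof.
move=> F0 FN.
by rewrite -[leRHS](sum_edge_left N FN) big_nat_recr//= lerDl.
Qed.

Lemma sum_widen_left N F : (forall i, 0 <= F i) ->
  \sum_(0 <= i < N) F i <= \sum_(0 <= i < N.+1) F i.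
Proof. by move=> F0; rewrite [leRHS]big_nat_recr//= lerDl. Qed.

Lemma sum_widen_right N F : (forall i, 0 <= F i) ->
  \sum_(0 <= i < N) F i.+1 <= \sum_(0 <= i < N.+1) F i.
Proof. by move=> F0; rewrite [leRHS]big_nat_recl//= lerDr. Qed.
End Sums.

(** * Perturbation of a quadratic form on nodes and edges *)

Section LowerBound.
Variables (R : realFieldType) (N : nat) (c w : R).
Variables (P a g kap al ga o1 nu o2 o3 o4 o5 p y d : nat -> R).

(** Here [p], [y], [d] stand for [v_t], [s v], [d_h^+ v]. The coefficients [o1], ..., [o5] are pure
    errors, while [al], [ga] have the limits [a], [g]. *)
Definition edge_form j :=
  al j * d j * (p j + p j.+1) + o1 j * d j * (y j + y j.+1)
  + kap j * y j * y j.+1 + ga j * d j ^+ 2.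
Definition node_form i :=
  P i.+1 * p i.+1 ^+ 2 + o2 i * y i.+1 * p i.+1 + nu i * y i.+1 ^+ 2
  + (o3 i * y i.+2 + o4 i * y i + o5 i * y i.+1) * (d i.+1 - d i).
Definition energy := \sum_(0 <= i < N) y i.+1 ^+ 2 + \sum_(0 <= i < N) p i.+1 ^+ 2
   + \sum_(0 <= j < N.+1) d j ^+ 2.

Lemma ler_mul_small (x u v : R) : `|x| <= w -> - (w * ((u ^+ 2 + v ^+ 2) / 2)) <= x * u * v.
Proof.
move=> xw; have w0 : 0 <= w by exact: le_trans xw.
have : `|x * u * v| <= w * ((u ^+ 2 + v ^+ 2) / 2).
  rewrite -mulrA normrM; apply: ler_pM => //.
  have := sqr_ge0 (u + v); have := sqr_ge0 (u - v).
  by rewrite ler_norml => H1 H2; apply/andP; split; nra.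
by rewrite ler_norml => /andP[].
Qed.

Hypothesis w0 : 0 <= w.
Hypothesis al_a : forall j, (j <= N)%N -> `|al j - a j| <= w.
Hypothesis ga_g : forall j, (j <= N)%N -> `|ga j - g j| <= w.
Hypothesis P_P : forall j, (j <= N)%N -> `|P j.+1 - P j| <= w.
Hypothesis o1w : forall j, (j <= N)%N -> `|o1 j| <= w.
Hypothesis kap0 : forall j, (j <= N)%N -> kap j <= 0.
Hypothesis o2w : forall j, (j < N)%N -> `|o2 j| <= w.
Hypothesis o3w : forall j, (j < N)%N -> `|o3 j| <= w.
Hypothesis o4w : forall j, (j < N)%N -> `|o4 j| <= w.
Hypothesis o5w : forall j, (j < N)%N -> `|o5 j| <= w.
Hypothesis nuc : forall i, (i < N)%N -> c <= nu i + (kap i + kap i.+1) / 2.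
Hypothesis main : forall j, (j <= N)%N -> forall u u' z : R,
  c * ((u ^+ 2 + u' ^+ 2) / 2 + z ^+ 2)
  <= P j * ((u ^+ 2 + u' ^+ 2) / 2) + a j * z * (u + u') + g j * z ^+ 2.
Hypotheses (y0 : y 0%N = 0) (yN : y N.+1 = 0) (p0 : p 0%N = 0) (pN : p N.+1 = 0).

(** The form in [(p, d)] is coercive edge by edge, so each [P p^2] is shared equally between the two
    edges at its node, at cost [w] for evaluating [P] at the left end. As [kap <= 0], the product
    [y j * y j.+1] may be replaced by half the sum of squares; this is why [nuc] involves the mean
    of the two adjacent [kap]. *)
Let edge_bound j : (j <= N)%N ->
  kap j * ((y j ^+ 2 + y j.+1 ^+ 2) / 2) + c * ((p j ^+ 2 + p j.+1 ^+ 2) / 2 + d j ^+ 2)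
  - w * (3 * d j ^+ 2 + 3 / 2 * (p j ^+ 2 + p j.+1 ^+ 2) + (y j ^+ 2 + y j.+1 ^+ 2))
  <= edge_form j + (P j * p j ^+ 2 + P j.+1 * p j.+1 ^+ 2) / 2.
Proof.
move=> jN; rewrite /edge_form.
have M := main jN (p j) (p j.+1) (d j).
have A1 := ler_mul_small (d j) (p j) (al_a jN).
have A2 := ler_mul_small (d j) (p j.+1) (al_a jN).
have O1 := ler_mul_small (d j) (y j) (o1w jN).
have O2 := ler_mul_small (d j) (y j.+1) (o1w jN).
have G := ler_mul_small (d j) (d j) (ga_g jN).
have Q := ler_mul_small (p j.+1) (p j.+1) (P_P jN).
have K : 0 <= - kap j * (y j - y j.+1) ^+ 2.
  by rewrite mulr_ge0 ?sqr_ge0// oppr_ge0 kap0.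
have D0 : 0 <= w * p j ^+ 2 by rewrite mulr_ge0// sqr_ge0.
have D1 : 0 <= w * p j.+1 ^+ 2 by rewrite mulr_ge0// sqr_ge0.
have D2 : 0 <= w * y j ^+ 2 by rewrite mulr_ge0// sqr_ge0.
have D3 : 0 <= w * y j.+1 ^+ 2 by rewrite mulr_ge0// sqr_ge0.
lra.
Qed.

Let node_bound i : (i < N)%N ->
  P i.+1 * p i.+1 ^+ 2 + nu i * y i.+1 ^+ 2
  - w * ((y i.+1 ^+ 2 + p i.+1 ^+ 2) / 2 + (y i.+2 ^+ 2 + y i ^+ 2 + y i.+1 ^+ 2) / 2
         + 3 * (d i ^+ 2 + d i.+1 ^+ 2)) <= node_form i.
Proof.
move=> iN; rewrite /node_form.
have O2 := ler_mul_small (y i.+1) (p i.+1) (o2w iN).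
have O3 := ler_mul_small (y i.+2) (d i.+1 - d i) (o3w iN).
have O4 := ler_mul_small (y i) (d i.+1 - d i) (o4w iN).
have O5 := ler_mul_small (y i.+1) (d i.+1 - d i) (o5w iN).
have S : 0 <= w * (d i.+1 + d i) ^+ 2 by rewrite mulr_ge0// sqr_ge0.
lra.
Qed.

(** The errors of all edges and nodes add up to at most [w (4 Y + 7/2 Q + 9 D)], with [Y], [Q], [D]
    the three sums in [energy]; the factor 10 covers them. *)
Lemma form_lower_bound :
  (c - 10 * w) * energy
  <= \sum_(0 <= i < N) node_form i + \sum_(0 <= j < N.+1) edge_form j.
Proof.
pose sq (u : nat -> R) j := u j ^+ 2.
have sq0 u j : 0 <= sq u j by exact: sqr_ge0.
have y20 : sq y 0%N = 0 by rewrite /sq y0 expr0n.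
have y2N : sq y N.+1 = 0 by rewrite /sq yN expr0n.
have p20 : sq p 0%N = 0 by rewrite /sq p0 expr0n.
have p2N : sq p N.+1 = 0 by rewrite /sq pN expr0n.
have HE : \sum_(0 <= j < N.+1) (kap j * ((y j ^+ 2 + y j.+1 ^+ 2) / 2)
    + c * ((p j ^+ 2 + p j.+1 ^+ 2) / 2 + d j ^+ 2)
  - w * (3 * d j ^+ 2 + 3 / 2 * (p j ^+ 2 + p j.+1 ^+ 2) + (y j ^+ 2 + y j.+1 ^+ 2)))
  <= \sum_(0 <= j < N.+1) (edge_form j + (P j * p j ^+ 2 + P j.+1 * p j.+1 ^+ 2) / 2).
  by apply: ler_sum_nat => j /andP[_ jN]; exact: edge_bound.
have HN : \sum_(0 <= i < N) (P i.+1 * p i.+1 ^+ 2 + nu i * y i.+1 ^+ 2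
  - w * ((y i.+1 ^+ 2 + p i.+1 ^+ 2) / 2 + (y i.+2 ^+ 2 + y i ^+ 2 + y i.+1 ^+ 2) / 2
         + 3 * (d i ^+ 2 + d i.+1 ^+ 2))) <= \sum_(0 <= i < N) node_form i.
  by apply: ler_sum_nat => j /andP[_ jN]; exact: node_bound.
pose Y := \sum_(0 <= i < N) sq y i.+1.
pose Q := \sum_(0 <= i < N) sq p i.+1.
pose D := \sum_(0 <= j < N.+1) sq d j.
have Yl : \sum_(0 <= j < N.+1) y j ^+ 2 = Y by exact: (sum_edge_left N y20).
have Yr : \sum_(0 <= j < N.+1) y j.+1 ^+ 2 = Y by exact: (sum_edge_right y2N).
have Ql : \sum_(0 <= j < N.+1) p j ^+ 2 = Q by exact: (sum_edge_left N p20).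
have Qr : \sum_(0 <= j < N.+1) p j.+1 ^+ 2 = Q by exact: (sum_edge_right p2N).
have Y0 : \sum_(0 <= i < N) y i ^+ 2 <= Y by exact: (sum_unshift_le N (sq0 y) y20).
have Y2 : \sum_(0 <= i < N) y i.+2 ^+ 2 <= Y by exact: (sum_shift_le (sq0 y) y2N).
have D0 : \sum_(0 <= i < N) d i ^+ 2 <= D by exact: (sum_widen_left N (sq0 d)).
have D1 : \sum_(0 <= i < N) d i.+1 ^+ 2 <= D by exact: (sum_widen_right N (sq0 d)).
pose PQ := \sum_(0 <= i < N) P i.+1 * p i.+1 ^+ 2.
have PQl : \sum_(0 <= j < N.+1) P j * p j ^+ 2 = PQ.
  by apply: (@sum_edge_left _ N (fun j => P j * p j ^+ 2)); rewrite p0 expr0n mulr0.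
have PQr : \sum_(0 <= j < N.+1) P j.+1 * p j.+1 ^+ 2 = PQ.
  by apply: (@sum_edge_right _ N (fun j => P j * p j ^+ 2)); rewrite pN expr0n mulr0.
pose KA := \sum_(0 <= i < N) kap i * y i.+1 ^+ 2.
pose KB := \sum_(0 <= i < N) kap i.+1 * y i.+1 ^+ 2.
have KBE : \sum_(0 <= j < N.+1) kap j * y j ^+ 2 = KB.
  by apply: (@sum_edge_left _ N (fun j => kap j * y j ^+ 2)); rewrite y0 expr0n mulr0.
have KAE : \sum_(0 <= j < N.+1) kap j * y j.+1 ^+ 2 = KA.
  by rewrite big_nat_recr//= yN expr0n mulr0 addr0.
pose NU := \sum_(0 <= i < N) nu i * y i.+1 ^+ 2.
have NUc : c * Y <= NU + (KA + KB) / 2.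
  rewrite /Y mulr_sumr /KA /KB -big_split/= mulr_suml -big_split/=.
  apply: ler_sum_nat => i /andP[_ iN].
  have : 0 <= (nu i + (kap i + kap i.+1) / 2 - c) * y i.+1 ^+ 2.
    by rewrite mulr_ge0 ?sqr_ge0// subr_ge0 nuc.
  rewrite /sq; lra.
have Q0 : 0 <= Q by apply: sumr_ge0 => i _; exact: sq0.
have D00 : 0 <= D by apply: sumr_ge0 => i _; exact: sq0.
have Y00 : 0 <= Y by apply: sumr_ge0 => i _; exact: sq0.
have HEl : \sum_(0 <= j < N.+1) (kap j * ((y j ^+ 2 + y j.+1 ^+ 2) / 2)
    + c * ((p j ^+ 2 + p j.+1 ^+ 2) / 2 + d j ^+ 2)
  - w * (3 * d j ^+ 2 + 3 / 2 * (p j ^+ 2 + p j.+1 ^+ 2) + (y j ^+ 2 + y j.+1 ^+ 2)))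
  = (KA + KB) / 2 + c * (Q + D) - w * (3 * D + 3 * Q + 2 * Y).
  transitivity (\sum_(0 <= j < N.+1) (2^-1 * (kap j * y j ^+ 2) + 2^-1 * (kap j * y j.+1 ^+ 2)
    + (c / 2 - 3 / 2 * w) * p j ^+ 2 + (c / 2 - 3 / 2 * w) * p j.+1 ^+ 2
    + (c - 3 * w) * d j ^+ 2 - w * y j ^+ 2 - w * y j.+1 ^+ 2)).
    by apply: eq_bigr => j _; field.
  by rewrite !big_split/= !sumrN -!mulr_sumr Yl Yr Ql Qr KAE KBE -/D; field.
have HEr : \sum_(0 <= j < N.+1) (edge_form j + (P j * p j ^+ 2 + P j.+1 * p j.+1 ^+ 2) / 2)
  = \sum_(0 <= j < N.+1) edge_form j + PQ.
  by rewrite big_split/=; congr (_ + _); rewrite -mulr_suml big_split/= PQl PQr; field.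
have HNl : \sum_(0 <= i < N) (P i.+1 * p i.+1 ^+ 2 + nu i * y i.+1 ^+ 2
  - w * ((y i.+1 ^+ 2 + p i.+1 ^+ 2) / 2 + (y i.+2 ^+ 2 + y i ^+ 2 + y i.+1 ^+ 2) / 2
         + 3 * (d i ^+ 2 + d i.+1 ^+ 2)))
  = PQ + NU - w * (Y + Q / 2 + \sum_(0 <= i < N) y i.+2 ^+ 2 / 2
       + \sum_(0 <= i < N) y i ^+ 2 / 2 + 3 * \sum_(0 <= i < N) d i ^+ 2
       + 3 * \sum_(0 <= i < N) d i.+1 ^+ 2).
  transitivity (\sum_(0 <= i < N) (P i.+1 * p i.+1 ^+ 2 + nu i * y i.+1 ^+ 2
     - w * y i.+1 ^+ 2 - (w / 2) * p i.+1 ^+ 2 - w * (y i.+2 ^+ 2 / 2)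
     - w * (y i ^+ 2 / 2) - (w * 3) * d i ^+ 2 - (w * 3) * d i.+1 ^+ 2)).
    by apply: eq_bigr => j _; field.
  rewrite !big_split/= !sumrN -!mulr_sumr -/PQ -/NU -/Y -/Q -!mulr_suml.
  by field.
rewrite HEl HEr in HE; rewrite HNl in HN.
rewrite -!mulr_suml in HN.
have W1 : 0 <= w * (Y - \sum_(0 <= i < N) y i ^+ 2) by rewrite mulr_ge0// subr_ge0.
have W2 : 0 <= w * (Y - \sum_(0 <= i < N) y i.+2 ^+ 2) by rewrite mulr_ge0// subr_ge0.
have W3 : 0 <= w * (D - \sum_(0 <= i < N) d i ^+ 2) by rewrite mulr_ge0// subr_ge0.
have W4 : 0 <= w * (D - \sum_(0 <= i < N) d i.+1 ^+ 2) by rewrite mulr_ge0// subr_ge0.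
have W5 : 0 <= w * Y by rewrite mulr_ge0.
have W6 : 0 <= w * Q by rewrite mulr_ge0.
have W7 : 0 <= w * D by rewrite mulr_ge0.
rewrite /energy -/Y -/Q -/D.
lra.
Qed.
End LowerBound.

(** * Absolutely continuous functions *)

Section Primitive.
Context {R : realType}.
Notation mu := (@lebesgue_measure R).
Implicit Types (f g F G : R -> R) (a b x y : R).

(* [F] is absolutely continuous on [[a,b]] with density [f]. *)
Definition prim a b F f :=
  mu.-integrable `[a, b] (EFin \o f) /\
  forall x y, a <= x -> x <= y -> y <= b ->
    F y - F x = \int[mu]_(t in `[x, y]) f t.

Lemma integrable_sub_itv a b x y f : mu.-integrable `[a, b] (EFin \o f) ->
  a <= x -> y <= b -> mu.-integrable `[x, y] (EFin \o f).
Proof.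
move=> fi ax yb; apply: integrableS fi => //.
by apply: subset_itv; rewrite bnd_simp.
Qed.

Lemma Rintegral_itv_split a b x f : mu.-integrable `[a, b] (EFin \o f) ->
  a <= x -> x <= b ->
  \int[mu]_(t in `[a, b]) f t
  = \int[mu]_(t in `[a, x]) f t + \int[mu]_(t in `[x, b]) f t.
Proof.
move=> fi ax xb.
have := Rintegral_itvB fi (x := x); rewrite !bnd_simp => /(_ ax xb).
rewrite Rintegral_itv_obnd_cbnd; first by move=> <-; rewrite addrC subrK.
apply: integrableS fi => //.
by apply: subset_itv; rewrite bnd_simp.
Qed.

Lemma prim_continuous a b F f : a <= b -> prim a b F f ->
  {within `[a, b], continuous F}.
Proof.
move=> ab [fi FE].
apply: (@subspace_eq_continuous _ _ _ (fun t => F a + parameterized_integral mu a t f)).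
  move=> t; rewrite inE/= in_itv/= => /andP[at_ tb].
  by rewrite /parameterized_integral -FE// addrC subrK.
move=> t; apply: (@cvgD _ _ (subspace `[a, b])); first exact: cvg_cst.
exact: parameterized_integral_continuous.
Qed.

Lemma within_continuous_measurable a b f : {within `[a, b], continuous f} ->
  measurable_fun `[a, b] f.
Proof. by move=> cf; exact: subspace_continuous_measurable_fun. Qed.

Lemma integrable_mul_continuous a b f g : {within `[a, b], continuous g} ->
  mu.-integrable `[a, b] (EFin \o f) ->
  mu.-integrable `[a, b] (EFin \o (f \* g)).
Proof.
move=> cg fi.
have -> : EFin \o (f \* g) = ((EFin \o f) \* (EFin \o g))%E by apply/funext.
apply: integrableMl => //; first exact: within_continuous_measurable.
have [M [Mr HM]] : bounded_set (g @` `[a, b]).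
  by apply: compact_bounded; apply: continuous_compact => //; apply: segment_compact.
by exists M; split=> // r Mr' x /= xab; apply: (HM r).
Qed.

Lemma integrable_normr_comp a b f : mu.-integrable `[a, b] (EFin \o f) ->
  mu.-integrable `[a, b] (EFin \o (fun t => `|f t|)).
Proof. by move=> fi; exact: integrable_norm. Qed.

Lemma prim_sub a b x y F f : prim a b F f -> a <= x -> y <= b -> prim x y F f.
Proof.
move=> [fi FE] ax yb; split; first exact: integrable_sub_itv fi ax yb.
by move=> u v xu uv vy; apply: FE => //; [exact: le_trans xu|exact: le_trans yb].
Qed.

Lemma prim_mul_integrable a b F f G g : a <= b -> prim a b F f -> prim a b G g ->
  mu.-integrable `[a, b] (EFin \o (fun t => f t * G t + F t * g t)).
Proof.
move=> ab pF pG.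
have -> : EFin \o (fun t => f t * G t + F t * g t) =
   ((EFin \o (f \* G)%R) \+ (EFin \o (g \* F)%R))%E.
  by apply/funext => t /=; rewrite [F t * _]mulrC.
apply: integrableD => //; apply: integrable_mul_continuous.
- exact: prim_continuous pG.
- by case: pF.
- exact: prim_continuous pF.
- by case: pG.
Qed.

Let variation f g x y := \int[mu]_(t in `[x, y]) (`|f t| + `|g t|).

Let variation_integrable a b f g :
  mu.-integrable `[a, b] (EFin \o f) -> mu.-integrable `[a, b] (EFin \o g) ->
  mu.-integrable `[a, b] (EFin \o (fun t => `|f t| + `|g t|)).
Proof.
move=> fi gi.
have -> : EFin \o (fun t => `|f t| + `|g t|) =
  ((EFin \o (fun t => `|f t|%R)) \+ (EFin \o (fun t => `|g t|%R)))%E by apply/funext.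
by apply: integrableD => //; exact: integrable_normr_comp.
Qed.

Let variation_ge a b x y f g F :
  mu.-integrable `[a, b] (EFin \o f) -> mu.-integrable `[a, b] (EFin \o g) ->
  prim a b F f -> a <= x -> x <= y -> y <= b -> `|F y - F x| <= variation f g a b.
Proof.
move=> fi gi [_ FE] ax xy yb; rewrite FE//.
have fi' := integrable_sub_itv fi ax yb.
have gi' := integrable_sub_itv gi ax yb.
apply: (le_trans (le_normr_Rintegral _ fi')) => //.
have ab : a <= b by rewrite (le_trans ax)// (le_trans xy).
have vi := variation_integrable fi gi.
have vi' := variation_integrable fi' gi'.
rewrite /variation (Rintegral_itv_split vi ax) ?(le_trans xy)//.
have xb : x <= b by exact: le_trans yb.
rewrite (@Rintegral_itv_split x b y _ _ xy yb); last exact: integrable_sub_itv vi ax _.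
apply: (@le_trans _ _ (variation f g x y)).
  apply: le_Rintegral => //; first exact: integrable_normr_comp.
  by move=> t _; rewrite lerDl.
rewrite addrCA lerDl addr_ge0// Rintegral_ge0//.
Qed.

(* The defect of the product rule on [x, y] is additive in the interval and at
   most the square of the variation; halving the variation n times divides
   the bound by 2^n. *)
Let product_defect f g F G x y :=
  F y * G y - F x * G x - \int[mu]_(t in `[x, y]) (f t * G t + F t * g t).

Let product_defect_sq f g F G x y : x <= y -> prim x y F f -> prim x y G g ->
  `|product_defect f g F G x y| <= variation f g x y ^+ 2.
Proof.
move=> xy pF pG.
have [fi FE] := pF; have [gi GE] := pG.
pose V := variation f g x y.
have V0 : 0 <= V by apply: Rintegral_ge0 => t _; rewrite addr_ge0.
have Hi := prim_mul_integrable xy pF pG.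
have cst_i c : mu.-integrable `[x, y] (EFin \o (fun t => c * f t)).
  have -> : EFin \o (fun t => c * f t) = (fun t => c%:E * (EFin \o f) t)%E by [].
  exact: integrableZl.
have cst_i' c : mu.-integrable `[x, y] (EFin \o (fun t => c * g t)).
  have -> : EFin \o (fun t => c * g t) = (fun t => c%:E * (EFin \o g) t)%E by [].
  exact: integrableZl.
(* Freezing [G] at [y] and [F] at [x] makes the increment of the product an exact integral, so the
   defect involves only increments of [F] and [G], each bounded by the variation. *)
have E : F y * G y - F x * G x = \int[mu]_(t in `[x, y]) (G y * f t + F x * g t).
  rewrite RintegralD// !RintegralZl// -FE// -GE//; ring.
have Ei : mu.-integrable `[x, y] (EFin \o (fun t => G y * f t + F x * g t)).
  rewrite (_ : _ \o _ = ((EFin \o (fun t => G y * f t)%R) \+ (EFin \o (fun t => F x * g t)%R))%E).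
    exact: integrableD.
  exact/funext.
rewrite /product_defect E -RintegralB//.
have Di : mu.-integrable `[x, y]
    (EFin \o (fun t => G y * f t + F x * g t - (f t * G t + F t * g t))).
  rewrite (_ : _ \o _ = ((EFin \o (fun t => G y * f t + F x * g t)%R) \-
     (EFin \o (fun t => f t * G t + F t * g t)%R))%E).
    exact: integrableB.
  exact/funext.
apply: (le_trans (le_normr_Rintegral _ Di)) => //.
have vi := variation_integrable fi gi.
rewrite expr2.
rewrite -[leRHS]/(V * \int[mu]_(t in `[x, y]) (`|f t| + `|g t|)) -RintegralZl//.
apply: le_Rintegral => //.
- exact: integrable_normr_comp.
- rewrite (_ : _ \o _ = (fun t => V%:E * (EFin \o (fun u => `|f u| + `|g u|)%R) t)%E)//.
  exact: integrableZl.
- move=> t; rewrite /= in_itv/= => /andP[xt ty].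
  rewrite (_ : _ - _ = (G y - G t) * f t - (F t - F x) * g t); last by ring.
  rewrite (le_trans (ler_normB _ _))// !normrM mulrDr lerD// ler_wpM2r//.
    rewrite /V /variation; under eq_Rintegral do rewrite addrC.
    exact: (variation_ge gi fi pG).
  exact: (variation_ge fi gi pF).
Qed.

Let product_defect_split f g F G x y m : x <= m -> m <= y ->
  prim x y F f -> prim x y G g ->
  product_defect f g F G x y
  = product_defect f g F G x m + product_defect f g F G m y.
Proof.
move=> xm my pF pG; rewrite /product_defect.
have xy : x <= y by exact: le_trans my.
by rewrite (Rintegral_itv_split (prim_mul_integrable xy pF pG) xm my); ring.
Qed.

(** Cutting where the variation is halved, rather than at the midpoint, makes the two squared
    variations add up to exactly half of the original square. *)
Let variation_halve f g x y : x <= y ->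
  mu.-integrable `[x, y] (EFin \o f) -> mu.-integrable `[x, y] (EFin \o g) ->
  exists m, [/\ x <= m, m <= y, variation f g x m = variation f g x y / 2 &
                variation f g m y = variation f g x y / 2].
Proof.
move=> xy fi gi; have vi := variation_integrable fi gi.
have c : {within `[x, y], continuous (variation f g x)} :=
  parameterized_integral_continuous xy vi.
have V0 : 0 <= variation f g x y by apply: Rintegral_ge0 => t _; rewrite addr_ge0.
have Vx : variation f g x x = 0 by rewrite /variation set_itv1 Rintegral_set1.
have [] := @IVT _ _ _ _ (variation f g x y / 2) xy c.
  rewrite Vx min_l// max_r//.
  by rewrite divr_ge0//= ler_pdivrMr// ler_peMr// ler1n.
move=> m; rewrite in_itv/= => /andP[xm my] mE.
exists m; split=> //.
have E : variation f g x y = variation f g x m + variation f g m y :=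
  Rintegral_itv_split vi xm my.
have mE' : variation f g x m = variation f g x y / 2 by exact: mE.
by rewrite mE' in E; lra.
Qed.

Let product_defect_pow n : forall f g F G x y, x <= y ->
  prim x y F f -> prim x y G g ->
  `|product_defect f g F G x y| <= variation f g x y ^+ 2 / 2 ^+ n.
Proof.
elim: n => [|n IH] f g F G x y xy pF pG.
  by rewrite expr0 divr1; exact: product_defect_sq.
have [m [xm my Vl Vr]] := variation_halve xy pF.1 pG.1.
rewrite (product_defect_split xm my pF pG) (le_trans (ler_normD _ _))//.
have := IH _ _ _ _ _ _ xm (prim_sub pF (lexx _) my) (prim_sub pG (lexx _) my).
have := IH _ _ _ _ _ _ my (prim_sub pF xm (lexx _)) (prim_sub pG xm (lexx _)).
rewrite Vl Vr => H1 H2; rewrite (le_trans (lerD H2 H1))//.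
rewrite [2 ^+ n.+1]exprS le_eqVlt; apply/orP; left; apply/eqP; field.
by rewrite expf_neq0.
Qed.

Lemma primM a b F f G g : a <= b -> prim a b F f -> prim a b G g ->
  prim a b (F \* G) (fun t => f t * G t + F t * g t).
Proof.
move=> ab pF pG; split; first exact: prim_mul_integrable.
move=> x y ax xy yb /=; apply/eqP; rewrite -subr_eq0 -normr_le0; apply/eqP.
have pF' := prim_sub pF ax yb; have pG' := prim_sub pG ax yb.
apply/eqP; apply/ler_addgt0Pr => e e0; rewrite add0r.
pose V := variation f g x y ^+ 2.
have V0 : 0 <= V by exact: sqr_ge0.
have [n Vn] : exists n, V / 2 ^+ n <= e.
  have [n Hn] : exists n : nat, V / e <= n%:R.
    by exists (Num.truncn (V / e)).+1; rewrite ltW// truncnS_gt.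
  exists n; rewrite ler_pdivrMr ?exprn_gt0// -ler_pdivrMl//.
  rewrite mulrC (le_trans Hn)// -natrX ler_nat ltnW// ltn_expl//.
exact: le_trans (product_defect_pow n xy pF' pG') Vn.
Qed.

Lemma primD a b F f G g : prim a b F f -> prim a b G g ->
  prim a b (F \+ G) (f \+ g).
Proof.
move=> [fi FE] [gi GE]; split.
  rewrite (_ : _ \o _ = (EFin \o f) \+ (EFin \o g))%E; first exact: integrableD.
  exact/funext.
move=> x y ax xy yb /=; rewrite RintegralD//; last 2 first.
- exact: integrable_sub_itv fi ax yb.
- exact: integrable_sub_itv gi ax yb.
by rewrite -FE// -GE//; ring.
Qed.

Lemma prim_cst a b c : prim a b (cst c) (cst 0).
Proof.
split; first exact: integrable0.
by move=> x y _ _ _; rewrite subrr /= /Rintegral integral0_eq.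
Qed.

Lemma primZ a b c F f : prim a b F f -> prim a b (fun t => c * F t) (fun t => c * f t).
Proof.
move=> [fi FE]; split.
  rewrite (_ : _ \o _ = (fun t => c%:E * (EFin \o f) t)%E)//; exact: integrableZl.
move=> x y ax xy yb /=; rewrite RintegralZl//; first by rewrite -FE//; ring.
exact: integrable_sub_itv fi ax yb.
Qed.

Lemma primN a b F f : prim a b F f -> prim a b (fun t => - F t) (fun t => - f t).
Proof.
have E (G : R -> R) : (fun t => -1 * G t) = (fun t => - G t).
  by apply/funext => t; rewrite mulN1r.
by move=> pF; have := primZ (-1) pF; rewrite (E F) (E f).
Qed.

Lemma prim_sum a b m n (F f : nat -> R -> R) :
  (forall i, (m <= i < n)%N -> prim a b (F i) (f i)) ->
  prim a b (fun t => \sum_(m <= i < n) F i t) (fun t => \sum_(m <= i < n) f i t).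
Proof.
elim: n => [_|n IH H].
  under eq_fun do rewrite big_geq//.
  under [X in prim _ _ _ X]eq_fun do rewrite big_geq//.
  exact: prim_cst.
case: (leqP m n) => mn; last first.
  under eq_fun do rewrite big_geq//.
  under [X in prim _ _ _ X]eq_fun do rewrite big_geq//.
  exact: prim_cst.
under eq_fun do rewrite big_nat_recr//=.
under [X in prim _ _ _ X]eq_fun do rewrite big_nat_recr//=.
apply: (@primD a b (fun t => \sum_(m <= i < n) F i t) _ (F n)).
  by apply: IH => i /andP[mi ni]; apply: H; rewrite mi ltnW.
by apply: H; rewrite mn ltnSn.
Qed.

Lemma prim_C1 a b F f : a < b -> (forall t : R, is_derive t 1 F (f t)) -> continuous f ->
  prim a b F f.
Proof.
move=> ab dF cf; split.
  apply: continuous_compact_integrable; first exact: segment_compact.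
  exact: continuous_subspaceT.
move=> x y ax; rewrite le_eqVlt => /predU1P[->|xy] yb.
  by rewrite set_itv1 Rintegral_set1 subrr.
rewrite /Rintegral (@continuous_FTC2 _ f F)//.
- exact: continuous_subspaceT.
- split=> [t _||]; first exact: (@ex_derive _ _ _ _ _ _ _ (dF t)).
  + apply: cvg_at_right_filter; apply: differentiable_continuous; apply/derivable1_diffP.
    exact: (@ex_derive _ _ _ _ _ _ _ (dF x)).
  + apply: cvg_at_left_filter; apply: differentiable_continuous; apply/derivable1_diffP.
    exact: (@ex_derive _ _ _ _ _ _ _ (dF y)).
- by move=> t _; rewrite derive1E (@derive_val _ _ _ _ _ _ _ (dF t)).
Qed.

Lemma prim_eq a b F f F' f' : {in `[a, b], F =1 F'} -> {in `[a, b], f =1 f'} ->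
  prim a b F f -> prim a b F' f'.
Proof.
move=> FF ff [fi FE]; split.
  apply: eq_integrable fi => // t; rewrite inE => tab /=.
  by rewrite ff.
move=> x y ax xy yb; rewrite -!FF ?in_itv/= ?FE//; last 2 first.
- by rewrite ax (le_trans xy).
- by rewrite yb (le_trans ax).
apply: eq_Rintegral => t; rewrite inE/= in_itv/= => /andP[xt ty].
by rewrite ff// in_itv/= (le_trans ax)// (le_trans ty).
Qed.

End Primitive.

(** * Time derivatives that vanish at both ends *)

Section Weak.
Context {R : realType}.
Notation mu := (@lebesgue_measure R).
Implicit Types (T : R) (u : R -> R).

(** The hypotheses give only one-sided limits of [derive1 u] at [-T] and [T], not its values there.
    These limits are 0, so the extension by 0 is the continuous one. *)
Definition zext T u : R -> R := u \_ `](- T), T[.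

Lemma zext_in T u t : - T < t < T -> zext T u t = u t.
Proof. by move=> tT; rewrite /zext patchE mem_set//= in_itv. Qed.

Lemma zextN T u : zext T u (- T) = 0.
Proof. by rewrite /zext patchE memNset//= in_itv/= ltxx. Qed.

Lemma zextT T u : zext T u T = 0.
Proof. by rewrite /zext patchE memNset//= in_itv/= ltxx andbF. Qed.

Lemma weak_dtt_prim T u (u2 : R -> R) : 0 < T -> has_weak_dtt T u u2 -> vanishes_at_ends T u ->
  prim (- T) T (zext T (derive1 u)) (zext T u2).
Proof.
move=> T0 [cu du iu2 uE] [u0 uT d0 dT].
have NT : - T < T by rewrite gtrN.
have i2 : mu.-integrable `[- T, T] (EFin \o zext T u2).
  rewrite /zext -restrict_EFin; apply/integrable_restrict => //=.
  rewrite setIidr//; exact: subset_itv_oo_cc.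
pose P t := \int[mu]_(x in `[- T, t]) zext T u2 x.
have PE a b : - T < a -> a <= b -> b < T -> derive1 u b - derive1 u a = P b - P a.
  move=> Ta ab bT; rewrite uE// /P.
  rewrite (@Rintegral_itv_split _ (- T) b a)//; last 2 first.
  - by apply: integrable_sub_itv i2 _ _ => //; exact: ltW.
  - exact: ltW.
  rewrite [RHS]addrC addKr; apply: eq_Rintegral => t; rewrite inE/= in_itv/= => /andP[at_ tb].
  by rewrite zext_in// (lt_le_trans Ta)//= (le_lt_trans tb).
have P0 : P t @[t --> (- T)^'+] --> 0.
  by apply: cvg_at_right_filter; exact: parameterized_integral_cvg_left NT i2.
have PT : P t @[t --> T^'-] --> P T.
  exact: parameterized_integral_cvg_at_left NT i2.
(* The weak derivative relates interior times only, so [u'] and [P] agree up to a constant, measured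
   here at the interior time 0. The limit at [-T] forces [c = 0], then the limit at [T] forces
   [P T = 0]. *)
pose c := derive1 u 0 - P 0.
have cE t : - T < t < T -> derive1 u t = P t + c.
  move=> /andP[Tt tT]; rewrite /c.
  have [t0|t0] := leP 0 t.
    by have := @PE 0 t; rewrite oppr_lt0 => /(_ T0 t0 tT); lra.
  by have := @PE t 0 Tt (ltW t0) T0; lra.
have c0 : c = 0.
  have : P t + c @[t --> (- T)^'+] --> 0.
    apply: cvg_trans d0; apply: near_eq_cvg; near=> t.
    apply: cE; apply/andP; split; near: t; first exact: nbhs_right_gt.
    exact: nbhs_right_lt.
  have : P t + c @[t --> (- T)^'+] --> 0 + c by apply: cvgD => //; exact: cvg_cst.
  move=> /cvg_unique H /H; rewrite add0r; exact.
have PT0 : P T = 0.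
  have : P t @[t --> T^'-] --> 0.
    apply: cvg_trans dT; apply: near_eq_cvg; near=> t.
    rewrite cE ?c0 ?addr0//; apply/andP; split; near: t; first exact: nbhs_left_gt.
    exact: nbhs_left_lt.
  by move: PT => /cvg_unique H /H; exact.
have dE t : - T <= t <= T -> zext T (derive1 u) t = P t.
  rewrite le_eqVlt => /andP[/predU1P[<-|Tt]].
    by rewrite zextN /P set_itv1 Rintegral_set1.
  rewrite le_eqVlt => /predU1P[->|tT]; first by rewrite zextT PT0.
  by rewrite zext_in ?Tt// cE ?Tt// c0 addr0.
split=> // x y Tx xy yT.
have xT : x <= T by exact: le_trans yT.
have Ty : - T <= y by exact: le_trans xy.
rewrite !dE ?Tx ?Ty// /P (@Rintegral_itv_split _ (- T) y x)//; first by rewrite addrC addKr.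
exact: integrable_sub_itv i2 _ _.
Unshelve. all: by end_near. Qed.

Lemma weak_dt_prim T u (u2 : R -> R) : 0 < T -> has_weak_dtt T u u2 -> vanishes_at_ends T u ->
  prim (- T) T u (zext T (derive1 u)).
Proof.
move=> T0 wu vu.
have NT : - T < T by rewrite gtrN.
have p2 := weak_dtt_prim T0 wu vu.
have cd := prim_continuous (ltW NT) p2.
have [cu du _ _] := wu.
split.
  by apply: continuous_compact_integrable; first exact: segment_compact.
move=> x y Tx; rewrite le_eqVlt => /predU1P[->|xy] yT.
  by rewrite set_itv1 Rintegral_set1 subrr.
have sub : `[x, y] `<=` `[- T, T] by apply: subset_itv; rewrite bnd_simp.
rewrite /Rintegral (@continuous_FTC2 _ (zext T (derive1 u)) u)//.
- exact: continuous_subspaceW cd.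
- have /(continuous_within_itvP _ xy)[_ cx cy] := continuous_subspaceW sub cu.
  split=> // t; rewrite in_itv/= => /andP[xt ty].
  by apply: du; rewrite in_itv/= (le_lt_trans Tx)//= (lt_le_trans ty).
- move=> t; rewrite in_itv/= => /andP[xt ty].
  by rewrite zext_in// (le_lt_trans Tx)//= (lt_le_trans ty).
Qed.

(* No integrability of [g] or [r] is assumed: if the right-hand side is finite, [r] is integrable. *)
Lemma time_int_le T (g r b : R -> R) :
  measurable_fun `](- T), T[ g -> measurable_fun `](- T), T[ r ->
  mu.-integrable `](- T), T[ (EFin \o b) ->
  \int[mu]_(t in `](- T), T[) b t = 0 ->
  (forall t, - T < t < T -> 0 <= g t) -> (forall t, - T < t < T -> 0 <= r t) ->
  (forall t, - T < t < T -> g t + b t <= r t) ->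
  (time_int T g <= time_int T r)%E.
Proof.
move=> mg mr ib b0 g0 r0 gr.
have mb := measurable_int _ ib.
have mD : measurable `](- T), T[%classic by exact: measurable_itv.
rewrite /time_int.
have [->|rfin] := eqVneq (\int[mu]_(t in `](- T)%R, T[) (r t)%:E)%E +oo%E; first by rewrite leey.
have ir : mu.-integrable `](- T)%R, T[ (EFin \o r).
  apply/integrableP; split; first exact/measurable_EFinP.
  rewrite (_ : integral _ _ _ = \int[mu]_(t in `](- T)%R, T[) (r t)%:E)%E ?ltey//.
  by apply: eq_integral => t; rewrite inE/= in_itv/= => tT; rewrite ger0_norm// r0.
have irb : mu.-integrable `](- T)%R, T[ (EFin \o (fun t => r t - b t)%R).
  rewrite (_ : _ \o _ = (EFin \o r) \- (EFin \o b))%E; first exact: integrableB.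
  exact/funext.
have inD (t : R) : `](- T), T[%classic t -> - T < t < T by rewrite /= in_itv.
apply: (@le_trans _ _ (\int[mu]_(t in `](- T)%R, T[) (r t - b t)%R%:E)%E).
  apply: ge0_le_integral => //.
  - exact/measurable_EFinP.
  - exact: measurable_int irb.
  - by move=> t tD; have tT := inD t tD; rewrite lee_fin lerBrDr; exact: gr.
rewrite (_ : (fun t => (r t - b t)%R%:E) = (EFin \o r) \- (EFin \o b))%E; last exact/funext.
rewrite integralB//.
have -> : (\int[mu]_(t in `](- T)%R, T[) (EFin \o b) t = 0)%E.
  rewrite -(@fineK _ (\int[mu]_(t in `](- T)%R, T[) (EFin \o b) t)%E) ?integrable_fin_num//.
  by congr (_%:E).
by rewrite sube0.
Qed.

End Weak.

(** * Asymptotics of the coefficients *)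

Section ExpRemainder.
Context {R : realType}.
Implicit Types (B C u : R).

(** One step of a Taylor estimate: by the mean value theorem a bound of order [n] on the derivative
    gives order [n+1] with the same constant. Three steps, starting from a bound on [expR], give the
    cubic remainder. *)
Lemma mvt_bound (G g : R -> R) B C n u : 0 <= C ->
  (forall x : R, is_derive x 1 G (g x)) -> G 0 = 0 ->
  (forall x, `|x| <= B -> `|g x| <= C * `|x| ^+ n) -> `|u| <= B ->
  `|G u| <= C * `|u| ^+ n.+1.
Proof.
move=> C0 dG G0 gC uB.
have cG a b : {within `[a, b], continuous G}.
  apply: continuous_subspaceT => x; apply: differentiable_continuous.
  by apply/derivable1_diffP; exact: (@ex_derive _ _ _ _ _ _ _ (dG x)).
have key x : `|x| <= `|u| -> `|g x * u| <= C * `|u| ^+ n.+1.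
  move=> xu; rewrite normrM exprSr mulrA ler_wpM2r//.
  by rewrite (le_trans (gC x (le_trans xu uB)))// ler_wpM2l// lerXn2r// nnegrE.
have [u0|u0] := leP 0 u.
- have [x] := @MVT_segment _ G g 0 u u0 (fun x _ => dG x) (cG _ _).
  rewrite in_itv/= G0 !subr0 => /andP[x0 xu] ->.
  by apply: key; rewrite !ger0_norm.
- have [x] := @MVT_segment _ G g u 0 (ltW u0) (fun x _ => dG x) (cG _ _).
  rewrite in_itv/= G0 !sub0r => /andP[x0 xu] /eqP; rewrite mulrN eqr_opp => /eqP ->.
  by apply: key; rewrite !ler0_norm ?lerN2// ltW.
Qed.

Lemma expR_remainder B : exists2 K, 0 <= K & forall u, `|u| <= B ->
  `|expR u - 1 - u - u ^+ 2 / 2| <= K * `|u| ^+ 3.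
Proof.
exists (expR B); first exact: expR_ge0.
move=> u uB.
have E0 := expR_ge0 B.
apply: (@mvt_bound (fun x => expR x - 1 - x - x ^+ 2 / 2) (fun x => expR x - 1 - x) B (expR B) 2) => //.
- by move=> x; apply: is_derive_eq; rewrite /GRing.scale/=; field.
- by rewrite expR0; ring.
move=> x xB; apply: (@mvt_bound (fun x => expR x - 1 - x) (fun x => expR x - 1) B (expR B) 1) => //.
- move=> z; apply: is_derive_eq; ring.
- by rewrite expR0; ring.
move=> z zB; apply: (@mvt_bound (fun x => expR x - 1) expR B (expR B) 0) => //.
- move=> r; apply: is_derive_eq; ring.
- by rewrite expR0; ring.
move=> r rB; rewrite expr0 mulr1 ger0_norm ?expR_ge0// ler_expR.
exact: le_trans (ler_norm _) rB.
Qed.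
End ExpRemainder.

(** * Calculus of uniform bounds *)

Section Calculus.
Context {R : realType} {Q : Type} (dom : Q -> Prop) (eta : Q -> R).
Hypothesis eta_ge0 : forall q, dom q -> 0 <= eta q.
Hypothesis eta_le2 : forall q, dom q -> eta q <= 2.
Implicit Types F G : Q -> R.

(* [O(1)], [O(eta)], and equality up to [O(eta)] with a bounded limit, all
   uniformly on [dom]. *)
Definition BO F := exists2 C, 0 <= C & forall q, dom q -> `|F q| <= C.
Definition SO F := exists2 C, 0 <= C & forall q, dom q -> `|F q| <= C * eta q.
Definition ap F G := SO (fun q => F q - G q) /\ BO G.

Lemma BO_ext F G : BO G -> (forall q, dom q -> F q = G q) -> BO F.
Proof. by move=> [C C0 H] FG; exists C => // q dq; rewrite FG// H. Qed.

Lemma SO_ext F G : SO G -> (forall q, dom q -> F q = G q) -> SO F.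
Proof. by move=> [C C0 H] FG; exists C => // q dq; rewrite FG// H. Qed.

Lemma BO_cst c : BO (fun=> c).
Proof. by exists `|c|. Qed.

Lemma BOD F G : BO F -> BO G -> BO (fun q => F q + G q).
Proof.
move=> [C C0 HC] [D D0 HD]; exists (C + D); first exact: addr_ge0.
by move=> q dq; rewrite (le_trans (ler_normD _ _))// lerD// ?HC ?HD.
Qed.

Lemma BON F : BO F -> BO (fun q => - F q).
Proof. by move=> [C C0 HC]; exists C => // q dq; rewrite normrN HC. Qed.

Lemma BOM F G : BO F -> BO G -> BO (fun q => F q * G q).
Proof.
move=> [C C0 HC] [D D0 HD]; exists (C * D); first exact: mulr_ge0.
by move=> q dq; rewrite normrM ler_pM// ?HC ?HD.
Qed.

Lemma BOX F n : BO F -> BO (fun q => F q ^+ n).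
Proof.
move=> HF; elim: n => [|n IH]; first exact: BO_cst.
by apply: BO_ext (BOM HF IH) _ => q dq; rewrite exprS.
Qed.

Lemma BO_expR F : BO F -> BO (fun q => expR (F q)).
Proof.
move=> [C C0 HC]; exists (expR C); first exact: expR_ge0.
move=> q dq; rewrite ger0_norm ?expR_ge0// ler_expR.
exact: le_trans (ler_norm _) (HC q dq).
Qed.

Lemma SO_BO F : SO F -> BO F.
Proof.
move=> [C C0 HC]; exists (C * 2); first exact: mulr_ge0.
by move=> q dq; rewrite (le_trans (HC q dq))// ler_wpM2l// eta_le2.
Qed.

Lemma SOD F G : SO F -> SO G -> SO (fun q => F q + G q).
Proof.
move=> [C C0 HC] [D D0 HD]; exists (C + D); first exact: addr_ge0.
by move=> q dq; rewrite (le_trans (ler_normD _ _))// mulrDl lerD// ?HC ?HD.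
Qed.

Lemma SON F : SO F -> SO (fun q => - F q).
Proof. by move=> [C C0 HC]; exists C => // q dq; rewrite normrN HC. Qed.

Lemma SOMl F G : BO F -> SO G -> SO (fun q => F q * G q).
Proof.
move=> [C C0 HC] [D D0 HD]; exists (C * D); first exact: mulr_ge0.
by move=> q dq; rewrite normrM -mulrA ler_pM// ?HC ?HD.
Qed.

Lemma SOMr F G : SO F -> BO G -> SO (fun q => F q * G q).
Proof.
move=> HF HG; apply: SO_ext (SOMl HG HF) _ => q _; exact: mulrC.
Qed.

Lemma ap_BO F G : ap F G -> BO F.
Proof.
by move=> [H HG]; apply: BO_ext (BOD (SO_BO H) HG) _ => q _; rewrite subrK.
Qed.

Lemma ap_refl F : BO F -> ap F F.
Proof.
move=> HF; split=> //; exists 0 => // q dq; by rewrite subrr normr0 mul0r.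
Qed.

Lemma apD F F' G G' : ap F F' -> ap G G' -> ap (fun q => F q + G q) (fun q => F' q + G' q).
Proof.
move=> [HF BF] [HG BG]; split; last exact: BOD.
apply: SO_ext (SOD HF HG) _ => q _; ring.
Qed.

Lemma apM F F' G G' : ap F F' -> ap G G' -> ap (fun q => F q * G q) (fun q => F' q * G' q).
Proof.
move=> aF aG; have [HF BF] := aF; have [HG BG] := aG; split; last exact: BOM.
apply: SO_ext (SOD (SOMl (ap_BO aF) HG) (SOMr HF BG)) _ => q _; ring.
Qed.

Lemma apX F F' n : ap F F' -> ap (fun q => F q ^+ n) (fun q => F' q ^+ n).
Proof.
move=> aF; elim: n => [|n IH]; first exact/ap_refl/BO_cst.
have [H B] := apM aF IH.
by split; [apply: SO_ext H _|apply: BO_ext B _] => q dq; rewrite !exprS.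
Qed.

Lemma ap_ext F G F' G' : ap F G -> (forall q, dom q -> F' q = F q) ->
  (forall q, dom q -> G' q = G q) -> ap F' G'.
Proof.
move=> [H B] FF GG; split; last exact: BO_ext B GG.
by apply: SO_ext H _ => q dq; rewrite FF// GG.
Qed.

(** One constant for finitely many functions. The nested conjunction lets each bound be extracted by
    projections once a point is fixed. *)
Lemma SO_list (Fs : seq (Q -> R)) : foldr (fun F P => SO F /\ P) True Fs ->
  exists2 C, 0 <= C &
    forall q, dom q -> foldr (fun F P => `|F q| <= C * eta q /\ P) True Fs.
Proof.
elim: Fs => [_|F Fs IH /= [[C C0 HC] /IH[D D0 HD]]]; first by exists 0.
exists (C + D); first exact: addr_ge0.
move=> q dq; have e0 := eta_ge0 dq; split.
  by rewrite (le_trans (HC q dq))// ler_wpM2r// lerDl.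
have : foldr (fun F P => `|F q| <= D * eta q /\ P) True Fs := HD q dq.
elim: (Fs) => //= G Gs IHG [HG /IHG]; split=> //.
by rewrite (le_trans HG)// ler_wpM2r// lerDr.
Qed.

Lemma BO_list (Fs : seq (Q -> R)) : foldr (fun F P => BO F /\ P) True Fs ->
  exists2 C, 0 <= C &
    forall q, dom q -> foldr (fun F P => `|F q| <= C /\ P) True Fs.
Proof.
elim: Fs => [_|F Fs IH /= [[C C0 HC] /IH[D D0 HD]]]; first by exists 0.
exists (C + D); first exact: addr_ge0.
move=> q dq; split; first by rewrite (le_trans (HC q dq))// lerDl.
have : foldr (fun F P => `|F q| <= D /\ P) True Fs := HD q dq.
elim: (Fs) => //= G Gs IHG [HG /IHG]; split=> //.
by rewrite (le_trans HG)// lerDr.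
Qed.

End Calculus.

Ltac bo := repeat match goal with
  | H : ?P |- ?P => exact: H
  | |- BO _ (fun _ => ?c) => apply: BO_cst
  | |- BO _ (fun q => @?F q + @?G q) => apply: (@BOD _ _ _ F G)
  | |- BO _ (fun q => - @?F q) => apply: (@BON _ _ _ F)
  | |- BO _ (fun q => @?F q * @?G q) => apply: (@BOM _ _ _ F G)
  | |- BO _ (fun q => @?F q ^+ ?n) => apply: (@BOX _ _ _ F n)
  | |- BO _ (fun q => expR (@?F q)) => apply: (@BO_expR _ _ _ F)
  end.

Definition cosh {R : realType} (u : R) := (expR u + expR (- u)) / 2.
Definition sinh {R : realType} (u : R) := (expR u - expR (- u)) / 2.

(** * Expansion of the weight and of the coefficients *)

Section Coefficients.
Context {R : realType}.
Variables (T beta x0 C0 lam : R).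

(* [phi = phit * phix]; [phit1], [phit2], [phit3] are the derivatives of [phit]. *)
Definition phit t := expR (lam * (C0 - beta * t ^+ 2)).
Definition phit1 t := - 2 * beta * lam * t * phit t.
Definition phit2 t := (4 * beta ^+ 2 * lam ^+ 2 * t ^+ 2 - 2 * beta * lam) * phit t.
Definition phit3 t := (8 * beta ^+ 2 * lam ^+ 2 * t
  + (4 * beta ^+ 2 * lam ^+ 2 * t ^+ 2 - 2 * beta * lam) * (- 2 * beta * lam * t)) * phit t.
Definition phix x := expR (lam * (x - x0) ^+ 2).

(* The parameters [(s, h, t, x)] on which the coefficients depend. *)
Record pt := Pt { ps : R; ph : R; ptm : R; px : R }.
Definition dom q := [/\ 1 <= ps q, 0 < ph q, ps q * ph q <= 1, - T <= ptm q <= T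
  & 0 <= px q <= 1].
(** [s h] measures the discretization errors and [1/s] the terms of lower order in the large
    parameter. *)
Definition eta q := ps q * ph q + (ps q)^-1.

Lemma dom_s q : dom q -> 0 < ps q.
Proof. by case=> s1 *; exact: lt_le_trans s1. Qed.

Lemma dom_z q : dom q -> 0 < ps q * ph q.
Proof. by move=> dq; have s0 := dom_s dq; case: dq => *; exact: mulr_gt0. Qed.

Lemma eta_ge0 q : dom q -> 0 <= eta q.
Proof. by move=> dq; rewrite addr_ge0 ?invr_ge0// ltW// ?dom_z ?dom_s. Qed.

Lemma eta_le2 q : dom q -> eta q <= 2.
Proof.
move=> dq; have [s1 _ sh _ _] := dq; rewrite /eta -[2]/(1 + 1) lerD//.
by rewrite invf_le1// dom_s.
Qed.

Notation BO := (@BO R pt dom).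
Notation SO := (@SO R pt dom eta).
Notation ap := (@ap R pt dom eta).

Lemma SO_z : SO (fun q => ps q * ph q).
Proof.
exists 1 => // q dq; rewrite mul1r ger0_norm; last by rewrite ltW// dom_z.
rewrite /eta lerDl.
by rewrite invr_ge0 ltW// dom_s.
Qed.

Lemma SO_h : SO ph.
Proof.
exists 1 => // q dq; have [s1 h0 _ _ _] := dq.
rewrite mul1r ger0_norm; last exact: ltW.
apply: (@le_trans _ _ (ps q * ph q)); first by rewrite ler_peMl// ltW.
by rewrite /eta lerDl invr_ge0 ltW// dom_s.
Qed.

Lemma SO_si : SO (fun q => (ps q)^-1).
Proof.
exists 1 => // q dq; rewrite mul1r ger0_norm; last by rewrite invr_ge0 ltW// dom_s.
by rewrite /eta lerDr ltW// dom_z.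
Qed.

Lemma BO_z : BO (fun q => ps q * ph q).
Proof. exact: SO_BO eta_le2 _ SO_z. Qed.
Lemma BO_h : BO ph.
Proof. exact: SO_BO eta_le2 _ SO_h. Qed.
Lemma BO_si : BO (fun q => (ps q)^-1).
Proof. exact: SO_BO eta_le2 _ SO_si. Qed.

Lemma BO_t : BO ptm.
Proof.
exists `|T| => // q [_ _ _ /andP[t1 t2] _]; rewrite ler_norml.
have := ler_norm T; have := ler_norm (- T); rewrite normrN => H1 H2.
by apply/andP; split; lra.
Qed.

Lemma BO_x : BO px.
Proof.
exists 1 => // q [_ _ _ _ /andP[t1 t2]]; rewrite ler_norml.
by apply/andP; split; lra.
Qed.

Lemma BO_A : BO (fun q => phit (ptm q)).
Proof. rewrite /phit; have := BO_t; move=> Ht; bo. Qed.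
Lemma BO_A1 : BO (fun q => phit1 (ptm q)).
Proof. rewrite /phit1; have := BO_t; have := BO_A; move=> HA Ht; bo. Qed.
Lemma BO_A2 : BO (fun q => phit2 (ptm q)).
Proof. rewrite /phit2; have := BO_t; have := BO_A; move=> HA Ht; bo. Qed.
Lemma BO_A3 : BO (fun q => phit3 (ptm q)).
Proof. rewrite /phit3; have := BO_t; have := BO_A; move=> HA Ht; bo. Qed.
Lemma BO_E : BO (fun q => phix (px q)).
Proof. rewrite /phix; have := BO_x; move=> Hx; bo. Qed.

(** Once divided by [z^3] the remainder is itself an [O(1)] function, so later expansions become
    exact identities between bounded functions that [field] can check. *)
Lemma exp_rem (z a : pt -> R) : (forall q, dom q -> z q != 0) -> BO z -> BO a ->
  BO (fun q => (expR (z q * a q) - 1 - z q * a q - (z q * a q) ^+ 2 / 2) / z q ^+ 3).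
Proof.
move=> z0 Bz Ba; have [B B0 HB] := BOM Bz Ba; have [D D0 HD] := Ba.
have [K K0 HK] := expR_remainder B.
exists (K * D ^+ 3); first by rewrite mulr_ge0// exprn_ge0.
move=> q dq; rewrite normrM normfV normrX ler_pdivrMr ?exprn_gt0 ?normr_gt0 ?z0//.
rewrite (le_trans (HK _ (HB q dq)))// -mulrA ler_wpM2l// normrM exprMn mulrC.
by rewrite ler_wpM2r ?exprn_ge0// lerXn2r ?nnegrE// HD.
Qed.

Lemma sinh_rem z a : (forall q, dom q -> z q != 0) -> BO z -> BO a ->
  BO (fun q => (sinh (z q * a q) - z q * a q) / z q ^+ 3).
Proof.
move=> z0 Bz Ba; have H1 := exp_rem z0 Bz Ba; have H2 := exp_rem z0 Bz (BON Ba).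
have H := BOM (BO_cst dom (2^-1)) (BOD H1 (BON H2)).
apply: BO_ext H _ => q dq; have zq := z0 q dq; rewrite /sinh mulrN.
by field.
Qed.

Lemma cosh_rem z a : (forall q, dom q -> z q != 0) -> BO z -> BO a ->
  BO (fun q => (cosh (z q * a q) - 1 - (z q * a q) ^+ 2 / 2) / z q ^+ 3).
Proof.
move=> z0 Bz Ba; have H1 := exp_rem z0 Bz Ba; have H2 := exp_rem z0 Bz (BON Ba).
have H := BOM (BO_cst dom (2^-1)) (BOD H1 H2).
apply: BO_ext H _ => q dq; have zq := z0 q dq; rewrite /cosh mulrN.
by field.
Qed.

Let zeta q := ps q * ph q.
Let zeta0 q : dom q -> zeta q != 0.
Proof. by move=> dq; rewrite gt_eqF// dom_z. Qed.

Lemma ap_sinh a b : ap a b -> ap (fun q => sinh (ps q * ph q * a q) / (ps q * ph q)) b.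
Proof.
move=> ab; have Ba := ap_BO eta_le2 ab; have [S Bb] := ab; split=> //.
have H := SOMl (BOM (sinh_rem zeta0 BO_z Ba) BO_z) SO_z.
apply: SO_ext (SOD H S) _ => q dq; have := zeta0 dq; rewrite /zeta => zq.
by move: (ps q * ph q) zq => z zq; field.
Qed.

Lemma ap_cosh a b : ap a b ->
  ap (fun q => (cosh (ps q * ph q * a q) - 1) / (ps q * ph q) ^+ 2) (fun q => b q ^+ 2 / 2).
Proof.
move=> ab; have Ba := ap_BO eta_le2 ab.
have [S Bb] := apM eta_le2 (apX eta_le2 2 ab) (ap_refl _ (BO_cst dom (2^-1))); split=> //.
have H := SOMl (cosh_rem zeta0 BO_z Ba) SO_z.
apply: SO_ext (SOD H S) _ => q dq; have := zeta0 dq; rewrite /zeta => zq.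
by move: (ps q * ph q) zq => z zq; field.
Qed.

Lemma ap_cosh1 a b : ap a b -> ap (fun q => cosh (ps q * ph q * a q)) (fun=> 1).
Proof.
move=> ab; have [Bc _] := ap_cosh ab; split; last exact: BO_cst.
have B := ap_BO eta_le2 (ap_cosh ab).
apply: SO_ext (SOMl (BOM B BO_z) SO_z) _ => q dq; have := zeta0 dq; rewrite /zeta => zq.
by move: (ps q * ph q) zq => z zq; field.
Qed.

Let X q := px q - x0.
Let c2 q := lam + 2 * lam ^+ 2 * X q ^+ 2.
Let At q := phit (ptm q).
Let A1t q := phit1 (ptm q).
Let A2t q := phit2 (ptm q).
Let E q := phix (px q).
Definition Ep q := phix (px q + ph q).
Definition Em q := phix (px q - ph q).
Definition Epp q := phix (px q + 2 * ph q).
Definition ep q := (Ep q - E q) / ph q.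
Definition em q := (E q - Em q) / ph q.
Definition epp q := (Epp q - Ep q) / ph q.
Definition fd q := (ep q - em q) / ph q.
Definition fdp q := (epp q - ep q) / ph q.
Definition dphix q := 2 * lam * X q * E q.
Definition ddphix q := 2 * c2 q * E q.

Let h0 q : dom q -> ph q != 0.
Proof. by case=> _ h0 *; rewrite gt_eqF. Qed.

Let BO_X : BO X.
Proof. by rewrite /X; have := BO_x => Hx; bo. Qed.

Let BO_c2 : BO c2.
Proof. by rewrite /c2; have HX := BO_X; bo. Qed.

(** The normalized cubic remainder of [phix (x + c h) / phix x], whose exponent is
    [lam ((X + c h)^2 - X^2)]. It is used with [c] equal to 1, -1 and 2. *)
Let rem c q := (expR (lam * (2 * c * ph q * X q + c ^+ 2 * ph q ^+ 2)) - 1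
  - 2 * lam * c * ph q * X q - c2 q * c ^+ 2 * ph q ^+ 2) / ph q ^+ 3.

Let BO_rem c : BO (rem c).
Proof.
have HX := BO_X; have Hh := BO_h.
have Hb : BO (fun q => lam * (2 * c * X q + c ^+ 2 * ph q)) by bo.
have H := exp_rem h0 Hh Hb.
have H' : BO (fun q => 2^-1 * lam ^+ 2 * (4 * c ^+ 3 * X q + c ^+ 4 * ph q)) by bo.
apply: BO_ext (BOD H H') _ => q dq; have hq := h0 dq; rewrite /rem /c2.
rewrite (_ : ph q * (lam * _) = lam * (2 * c * ph q * X q + c ^+ 2 * ph q ^+ 2)); last by ring.
by field.
Qed.

Let Ex_shift c q : dom q -> phix (px q + c * ph q)
  = E q * (1 + 2 * lam * c * ph q * X q + c2 q * c ^+ 2 * ph q ^+ 2 + ph q ^+ 3 * rem c q).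
Proof.
move=> dq; rewrite [ph q ^+ 3 * rem c q]mulrC /rem divfK ?expf_neq0 ?h0//.
rewrite (_ : 1 + _ + _ + _ = expR (lam * (2 * c * ph q * X q + c ^+ 2 * ph q ^+ 2)));
  last by ring.
by rewrite /E /phix -expRD; congr expR; rewrite /X; ring.
Qed.

Let EpE q : dom q -> Ep q = E q * (1 + 2 * lam * 1 * ph q * X q
  + c2 q * 1 ^+ 2 * ph q ^+ 2 + ph q ^+ 3 * rem 1 q).
Proof. by move=> dq; rewrite -Ex_shift// mul1r. Qed.
Let EmE q : dom q -> Em q = E q * (1 + 2 * lam * (- 1) * ph q * X q
  + c2 q * (- 1) ^+ 2 * ph q ^+ 2 + ph q ^+ 3 * rem (-1) q).
Proof. by move=> dq; rewrite -Ex_shift// mulN1r. Qed.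
Let EppE q : dom q -> Epp q = E q * (1 + 2 * lam * 2 * ph q * X q
  + c2 q * 2 ^+ 2 * ph q ^+ 2 + ph q ^+ 3 * rem 2 q).
Proof. by move=> dq; rewrite -Ex_shift. Qed.

Lemma ap_ep : ap ep dphix.
Proof.
have HX := BO_X; have Hh := BO_h; have HE := BO_E; have Hr := BO_rem 1; have Hc := BO_c2.
split; last by rewrite /dphix; bo.
have H : BO (fun q => E q * (c2 q + ph q * rem 1 q)) by bo.
apply: SO_ext (SOMr SO_h H) _ => q dq; have hq := h0 dq.
by rewrite /ep /dphix EpE//; field.
Qed.

Lemma ap_em : ap em dphix.
Proof.
have HX := BO_X; have Hh := BO_h; have HE := BO_E; have Hr := BO_rem (-1); have Hc := BO_c2.
split; last by rewrite /dphix; bo.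
have H : BO (fun q => E q * (- c2 q + - (ph q * rem (-1) q))) by bo.
apply: SO_ext (SOMr SO_h H) _ => q dq; have hq := h0 dq.
by rewrite /em /dphix EmE//; field.
Qed.

Lemma ap_fd : ap fd ddphix.
Proof.
have HX := BO_X; have Hh := BO_h; have HE := BO_E; have Hr := BO_rem (-1); have Hc := BO_c2.
have Hr' := BO_rem 1.
split; last by rewrite /ddphix; bo.
have H : BO (fun q => E q * (rem 1 q + rem (-1) q)) by bo.
apply: SO_ext (SOMr SO_h H) _ => q dq; have hq := h0 dq.
by rewrite /fd /ep /em /ddphix EmE// EpE//; field.
Qed.

(** A third difference: in the combination of [Epp], [Ep], [E], [Em] all terms up to [h^2] cancel.
    This extra power of [h] is what bounds the coefficient [rho j.+1 - rho j] in [gedge]. *)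
Lemma BO_fdp_fd : BO (fun q => (fdp q - fd q) / ph q).
Proof.
have HE := BO_E; have Hr := BO_rem (-1); have Hr' := BO_rem 1; have Hr2 := BO_rem 2.
have H : BO (fun q => E q * (rem 2 q + - (3 * rem 1 q) + - rem (-1) q)) by bo.
apply: BO_ext H _ => q dq; have hq := h0 dq.
by rewrite /fdp /epp /fd /ep /em EmE// EpE// EppE//; field.
Qed.

Lemma ap_fdp : ap fdp ddphix.
Proof.
have [Hs Hb] := ap_fd; split=> //.
apply: SO_ext (SOD Hs (SOMr SO_h BO_fdp_fd)) _ => q dq; have hq := h0 dq.
by field.
Qed.

Lemma ap_Ep : ap Ep E.
Proof.
split; last exact: BO_E.
apply: SO_ext (SOMr SO_h (ap_BO eta_le2 ap_ep)) _ => q dq; have hq := h0 dq.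
by rewrite /ep; field.
Qed.

Lemma ap_Em : ap Em E.
Proof.
split; last exact: BO_E.
apply: SO_ext (SOMr SO_h (BON (ap_BO eta_le2 ap_em))) _ => q dq; have hq := h0 dq.
by rewrite /em; field.
Qed.

Definition thl q := ps q * At q * (E q - Em q).
Definition thr q := ps q * At q * (Ep q - E q).
Definition thp q := ps q * At q * (Epp q - Ep q).

Let thlE q : dom q -> thl q = ps q * ph q * (At q * em q).
Proof. by move=> dq; have hq := h0 dq; rewrite /thl /em; field. Qed.
Let thrE q : dom q -> thr q = ps q * ph q * (At q * ep q).
Proof. by move=> dq; have hq := h0 dq; rewrite /thr /ep; field. Qed.

Let ap_A : ap At At. Proof. exact/ap_refl/BO_A. Qed.
Let ap_A1 : ap A1t A1t. Proof. exact/ap_refl/BO_A1. Qed.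
Let ap_E : ap E E. Proof. exact/ap_refl/BO_E. Qed.
Let ap_c c : ap (fun=> c) (fun=> c). Proof. exact/ap_refl/BO_cst. Qed.

Let ap_thr_a := apM eta_le2 ap_A ap_ep.
Let ap_thl_a := apM eta_le2 ap_A ap_em.

Let ap_eq F G F' : ap F G -> (forall q, dom q -> F' q = F q) -> ap F' G.
Proof. by move=> FG FF; apply: ap_ext FG FF _. Qed.

Lemma ap_Sr : ap (fun q => sinh (thr q) / (ps q * ph q)) (fun q => At q * dphix q).
Proof. by apply: (ap_eq (ap_sinh ap_thr_a)) => q dq; rewrite thrE. Qed.
Lemma ap_Sl : ap (fun q => sinh (thl q) / (ps q * ph q)) (fun q => At q * dphix q).
Proof. by apply: (ap_eq (ap_sinh ap_thl_a)) => q dq; rewrite thlE. Qed.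
Lemma ap_Cr : ap (fun q => cosh (thr q)) (fun=> 1).
Proof. by apply: (ap_eq (ap_cosh1 ap_thr_a)) => q dq; rewrite thrE. Qed.
Lemma ap_Cl : ap (fun q => cosh (thl q)) (fun=> 1).
Proof. by apply: (ap_eq (ap_cosh1 ap_thl_a)) => q dq; rewrite thlE. Qed.
Lemma ap_Cr2 : ap (fun q => (cosh (thr q) - 1) / (ps q * ph q) ^+ 2)
  (fun q => (At q * dphix q) ^+ 2 / 2).
Proof. by apply: (ap_eq (ap_cosh ap_thr_a)) => q dq; rewrite thrE. Qed.
Lemma ap_Cl2 : ap (fun q => (cosh (thl q) - 1) / (ps q * ph q) ^+ 2)
  (fun q => (At q * dphix q) ^+ 2 / 2).
Proof. by apply: (ap_eq (ap_cosh ap_thl_a)) => q dq; rewrite thlE. Qed.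
Lemma ap_Clr2 : ap (fun q => (cosh (thl q + thr q) - 1) / (ps q * ph q) ^+ 2)
  (fun q => (At q * dphix q + At q * dphix q) ^+ 2 / 2).
Proof.
apply: (ap_eq (ap_cosh (apD ap_thl_a ap_thr_a))) => q dq; rewrite thrE// thlE//.
by rewrite mulrDr.
Qed.

(** These are [rho] at the left and right end of the edge [(x, x+h)], divided by [s h^2]. The
    exponents on two consecutive edges differ by [s h^2] times a second difference of [phi], so both
    tend to [phi_xx]. *)
Definition ml q := sinh (thr q - thl q) / (ps q * ph q ^+ 2).
Definition mr q := sinh (thp q - thr q) / (ps q * ph q ^+ 2).

Let z2 q := ps q * ph q * ph q.
Let z20 q : dom q -> z2 q != 0.
Proof. by move=> dq; rewrite mulf_neq0 ?h0// zeta0. Qed.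
Let BO_z2 : BO z2.
Proof. by have H := BO_z; have H' := BO_h; exact: BOM. Qed.

Let BO_mr1 F D : ap F ddphix -> (forall q, dom q -> D q = z2 q * (At q * F q)) ->
  BO (fun q => (sinh (D q) / (ps q * ph q ^+ 2) - At q * F q) / z2 q ^+ 2).
Proof.
move=> aF DE; have Ba := ap_BO eta_le2 (apM eta_le2 ap_A aF).
apply: BO_ext (sinh_rem z20 BO_z2 Ba) _ => q dq; rewrite DE//.
have := z20 dq; rewrite -(_ : z2 q = ps q * ph q ^+ 2); last by rewrite /z2; ring.
by move: (z2 q) => z zq; field.
Qed.

Let BO_ml1 : BO (fun q => (ml q - At q * fd q) / z2 q ^+ 2).
Proof.
apply: BO_mr1 ap_fd _ => q dq; have hq := h0 dq.
by rewrite /fd /ep /em /thr /thl /z2; field.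
Qed.
Let BO_mrr1 : BO (fun q => (mr q - At q * fdp q) / z2 q ^+ 2).
Proof.
apply: BO_mr1 ap_fdp _ => q dq; have hq := h0 dq.
by rewrite /fdp /epp /ep /em /thr /thp /z2; field.
Qed.

Lemma ap_ml : ap ml (fun q => At q * ddphix q).
Proof.
have [Hs Hb] := apM eta_le2 ap_A ap_fd; split=> //.
have Hh := BO_h; have Hz := BO_z.
have H := SOMl (BOM (BOM BO_ml1 BO_z2) Hz) SO_h.
apply: SO_ext (SOD H Hs) _ => q dq; have := z20 dq; rewrite /z2 => zq.
by field; have := zeta0 dq; rewrite /zeta mulf_eq0 => /norP[-> ->].
Qed.

Lemma BO_mr_ml : BO (fun q => (mr q - ml q) / ph q).
Proof.
have Hz := BO_z; have HA := BO_A; have Hf := BO_fdp_fd; have H1 := BO_ml1; have H2 := BO_mrr1.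
have Hh := BO_h.
have H : BO (fun q => phit (ptm q) * ((fdp q - fd q) / ph q)
   + (mr q - At q * fdp q) / z2 q ^+ 2 * (ps q * ph q * (ps q * ph q) * ph q)
   + - ((ml q - At q * fd q) / z2 q ^+ 2 * (ps q * ph q * (ps q * ph q) * ph q))) by bo.
apply: BO_ext H _ => q dq; have hq := h0 dq; have := zeta0 dq; rewrite /zeta mulf_eq0 => /norP[sq _].
rewrite -/(At q) /z2.
by field; rewrite sq hq.
Qed.

Lemma ap_mr : ap mr (fun q => At q * ddphix q).
Proof.
have [Hs Hb] := ap_ml; split=> //.
apply: SO_ext (SOD Hs (SOMr SO_h BO_mr_ml)) _ => q dq; have hq := h0 dq.
by field.
Qed.

Variable K : R.

(* Coefficients of [edge_form] and [node_form], divided by [s], at the node [x];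
   [l] and [r] refer to the edges on its left and right, and [_lim] to the limit
   [eta -> 0]. *)
Definition cal q := - 2 * cosh (thr q) * A1t q * ep q.
Definition cal_lim q := - 2 * A1t q * dphix q.
Definition co1 q := - ((ps q)^-1 * (sinh (thr q) * (ps q * ph q) * A1t q ^+ 2 * ep q
   + cosh (thr q) * A2t q) * ep q) + (mr q - ml q) / ph q * (2^-1 * (ps q)^-1).
Definition ckr q := - 2 * (sinh (thr q) / (ps q * ph q)) * A1t q ^+ 2 * ep q * (E q + Ep q).
Definition ckl q := - 2 * (sinh (thl q) / (ps q * ph q)) * A1t q ^+ 2 * em q * (Em q + E q).
Definition cnu q := (2 * A2t q * E q - K * At q * E q) * (A1t q * E q) ^+ 2
  + ml q * ((cosh (thl q + thr q) - 1) / (ps q * ph q) ^+ 2)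
  + K * At q * ((cosh (thr q) * ((E q + Ep q) / 2) + cosh (thl q) * ((Em q + E q) / 2) - 2 * E q)
                / (ps q * ph q) ^+ 2).
Definition cnu_lim q := (2 * A2t q * E q - K * At q * E q) * (A1t q * E q) ^+ 2
  + At q * ddphix q * ((At q * dphix q + At q * dphix q) ^+ 2 / 2)
  + K * At q * ((At q * dphix q) ^+ 2 * E q)
  - 4 * (At q * dphix q) * A1t q ^+ 2 * dphix q * E q.
Definition cga q := - K * At q * cosh (thr q) * ((E q + Ep q) / 2) + (ml q + mr q).
Definition cga_lim q := - K * At q * E q + 2 * At q * ddphix q.
Definition cP q := (2 * A2t q + K * At q) * (Ep q - E q).
Definition co2 q := (phit3 (ptm q) + K * A1t q) * E q * (ps q)^-1.
(** The coefficient of [(d_h^+ v)_0^2] in the left boundary term, with [s/h] factored out; its limit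
    is [phi_x]. *)
Definition cb q := cosh (thr q) * sinh (thr q) / (ps q * ph q) - ph q * ml q / 2.
Definition cb_lim q := At q * dphix q.

Lemma ap_cal : ap cal cal_lim.
Proof.
apply: ap_ext (apM eta_le2 (apM eta_le2 (apM eta_le2 (ap_c (-2)) ap_Cr) ap_A1) ap_ep) _ _ => //.
by move=> q _; rewrite /cal_lim mulr1.
Qed.

Lemma SO_co1 : SO co1.
Proof.
have Hz := BO_z; have HA1 := BO_A1; have HA2 := BO_A2; have He := ap_BO eta_le2 ap_ep.
have HC := ap_BO eta_le2 ap_Cr; have HS := ap_BO eta_le2 ap_Sr; have Hm := BO_mr_ml.
have H : BO (fun q => - ((sinh (thr q) / (ps q * ph q) * (ps q * ph q * (ps q * ph q))
   * phit1 (ptm q) ^+ 2 * ep q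
   + cosh (thr q) * phit2 (ptm q)) * ep q) + (mr q - ml q) / ph q * 2^-1) by bo.
apply: SO_ext (SOMr SO_si H) _ => q dq; have hq := h0 dq.
have := zeta0 dq; rewrite /zeta mulf_eq0 => /norP[sq _].
by rewrite /co1 -/(A1t q) -/(A2t q); field; rewrite sq hq.
Qed.

Lemma ap_cnu : ap (fun q => cnu q + (ckl q + ckr q) / 2) cnu_lim.
Proof.
have M := apM eta_le2.
have aE2 : ap (fun q => (E q + Ep q) / 2) E.
  apply: ap_ext (M _ _ _ _ (apD ap_E ap_Ep) (ap_c 2^-1)) _ _ => // q _; by field.
have aE2' : ap (fun q => (Em q + E q) / 2) E.
  apply: ap_ext (M _ _ _ _ (apD ap_Em ap_E) (ap_c 2^-1)) _ _ => // q _; by field.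
have akl : ap ckl (fun q => - 4 * (At q * dphix q) * A1t q ^+ 2 * dphix q * E q).
  apply: ap_ext (M _ _ _ _ (M _ _ _ _ (M _ _ _ _ (M _ _ _ _ (ap_c (-2)) ap_Sl)
    (apX eta_le2 2 ap_A1)) ap_em) (apD ap_Em ap_E)) _ _ => // q _; ring.
have akr : ap ckr (fun q => - 4 * (At q * dphix q) * A1t q ^+ 2 * dphix q * E q).
  apply: ap_ext (M _ _ _ _ (M _ _ _ _ (M _ _ _ _ (M _ _ _ _ (ap_c (-2)) ap_Sr)
    (apX eta_le2 2 ap_A1)) ap_ep) (apD ap_E ap_Ep)) _ _ => // q _; ring.
have aT : ap (fun q => (cosh (thr q) * ((E q + Ep q) / 2)
      + cosh (thl q) * ((Em q + E q) / 2) - 2 * E q) / (ps q * ph q) ^+ 2)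
    (fun q => (At q * dphix q) ^+ 2 * E q).
  (* Replacing each cosh by 1 leaves the second difference [h^2 fd / 2] of the weight; division by
     [(s h)^2] turns it into [fd / (2 s^2)], which is negligible. *)
  have H0 : ap (fun q => (ps q)^-1 * ((ps q)^-1 * (2^-1 * fd q))) (fun=> 0).
    split; last exact: BO_cst.
    have Hf := ap_BO eta_le2 ap_fd; have Hs := BO_si.
    have H : BO (fun q => (ps q)^-1 * (2^-1 * fd q)) by bo.
    by apply: SO_ext (SOMr SO_si H) _ => q _; rewrite subr0.
  apply: ap_ext (apD (apD (M _ _ _ _ ap_Cr2 aE2) (M _ _ _ _ ap_Cl2 aE2')) H0) _ _ => q dq.
    have hq := h0 dq; have := zeta0 dq; rewrite /zeta mulf_eq0 => /norP[sq _].
    by rewrite /fd /ep /em; field; rewrite sq hq.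
  by field.
have a1 : ap (fun q => (2 * A2t q * E q - K * At q * E q) * (A1t q * E q) ^+ 2)
   (fun q => (2 * A2t q * E q - K * At q * E q) * (A1t q * E q) ^+ 2).
  apply: ap_refl; have HA1 : BO A1t := BO_A1; have HA2 : BO A2t := BO_A2.
  have HA : BO At := BO_A; have HE : BO E := BO_E; bo.
apply: ap_ext (apD (apD (apD a1 (M _ _ _ _ ap_ml ap_Clr2))
  (M _ _ _ _ (M _ _ _ _ (ap_c K) ap_A) aT)) (M _ _ _ _ (apD akl akr) (ap_c 2^-1))) _ _ => //.
by move=> q dq; rewrite /cnu_lim; field.
Qed.

Lemma ap_cga : ap cga cga_lim.
Proof.
have M := apM eta_le2.
have aE2 : ap (fun q => (E q + Ep q) / 2) E.
  apply: ap_ext (M _ _ _ _ (apD ap_E ap_Ep) (ap_c 2^-1)) _ _ => // q _; by field.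
apply: ap_ext (apD (M _ _ _ _ (M _ _ _ _ (M _ _ _ _ (ap_c (- K)) ap_A) ap_Cr) aE2)
  (apD ap_ml ap_mr)) _ _ => // q dq; rewrite /cga_lim; ring.
Qed.

Lemma SO_cP : SO cP.
Proof.
have HA2 : BO A2t := BO_A2; have HA : BO At := BO_A.
have H : BO (fun q => 2 * A2t q + K * At q) by bo.
by have [HE _] := ap_Ep; exact: SOMl H HE.
Qed.

Lemma SO_co2 : SO co2.
Proof.
have HA3 := BO_A3; have HA1 : BO A1t := BO_A1; have HE : BO E := BO_E.
have H : BO (fun q => (phit3 (ptm q) + K * A1t q) * E q) by bo.
exact: SOMl H SO_si.
Qed.

Lemma SO_cosh1 k : SO (fun q => k * (cosh (thr q) - 1) / (ps q * ph q)) /\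
  SO (fun q => k * (cosh (thl q) - 1) / (ps q * ph q)).
Proof.
split.
  apply: SO_ext (SOMl (BOM (BO_cst dom k) (ap_BO eta_le2 ap_Cr2)) SO_z) _ => q dq.
  by have := zeta0 dq; rewrite /zeta mulf_eq0 => /norP[sq hq]; field; rewrite sq hq.
apply: SO_ext (SOMl (BOM (BO_cst dom k) (ap_BO eta_le2 ap_Cl2)) SO_z) _ => q dq.
by have := zeta0 dq; rewrite /zeta mulf_eq0 => /norP[sq hq]; field; rewrite sq hq.
Qed.

Lemma SO_co5 k : SO (fun q => - (k * (ps q * ph q) * (A1t q * E q) ^+ 2)).
Proof.
have HA1 : BO A1t := BO_A1; have HE : BO E := BO_E.
have H : BO (fun q => - (k * (A1t q * E q) ^+ 2)) by bo.
by apply: SO_ext (SOMl H SO_z) _ => q dq; ring.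
Qed.

Lemma ap_cb : ap cb cb_lim.
Proof.
have M := apM eta_le2.
have H0 : ap (fun q => ph q * ml q * - 2^-1) (fun=> 0).
  split; last exact: BO_cst.
  have H := BOM (ap_BO eta_le2 ap_ml) (BO_cst dom (- 2^-1)).
  by apply: SO_ext (SOMr SO_h H) _ => q _; rewrite subr0 mulrA.
apply: ap_ext (apD (M _ _ _ _ ap_Cr ap_Sr) H0) _ _ => q dq.
  by rewrite /cb mulrA mulrN.
by rewrite /cb_lim mul1r addr0.
Qed.

Lemma BO_cbr : BO (fun q => cosh (thl q) * sinh (thl q) / (ps q * ph q) + ph q * ml q / 2).
Proof.
have H1 := ap_BO eta_le2 ap_Cl; have H2 := ap_BO eta_le2 ap_Sl; have H3 := ap_BO eta_le2 ap_ml.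
have H4 := BO_h.
have H : BO (fun q => cosh (thl q) * (sinh (thl q) / (ps q * ph q)) + ph q * ml q / 2) by bo.
by apply: BO_ext H _ => q dq; rewrite mulrA.
Qed.

(** The squared coefficients, divided by [s], of the two terms by which [X] differs from [P2],
    written in [y] and in differences of [d]. Their smallness makes the completion of [P1 + X]
    affordable. *)
Lemma SO_sq k : SO (fun q => (K * At q * E q) ^+ 2 * (ps q)^-1) /\
  SO (fun q => k ^+ 2 * (ps q * ph q) * ph q).
Proof.
have HA : BO At := BO_A; have HE : BO E := BO_E; have Hh := BO_h.
have H : BO (fun q => (K * At q * E q) ^+ 2) by bo.
split; first exact: SOMl H SO_si.
have H' : BO (fun q => k ^+ 2 * ph q) by bo.
by apply: SO_ext (SOMl H' SO_z) _ => q dq; ring.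
Qed.

(** [expR (- thr q)] is the ratio of the values of [e^(s phi)] at the two ends of an edge; both
    bounds serve to undo the conjugation. *)
Lemma BO_exp : BO (fun q => expR (- thr q)) /\
  BO (fun q => (expR (- thr q) - 1) / (ps q * ph q)).
Proof.
have Ba := BON (ap_BO eta_le2 ap_thr_a); have Hz := BO_z.
split.
  have H : BO (fun q => expR (ps q * ph q * - (At q * ep q))) by bo.
  by apply: BO_ext H _ => q dq; rewrite thrE// mulrN.
have H1 := exp_rem zeta0 BO_z Ba.
have H : BO (fun q => (expR (zeta q * - (At q * ep q)) - 1 - zeta q * - (At q * ep q) -
  (zeta q * - (At q * ep q)) ^+ 2 / 2) / zeta q ^+ 3 * (ps q * ph q * (ps q * ph q))
  + - (At q * ep q) + (ps q * ph q) * - (At q * ep q) * - (At q * ep q) / 2) by bo.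
apply: BO_ext H _ => q dq; rewrite thrE// -mulrN.
have := zeta0 dq; rewrite /zeta; move: (ps q * ph q) => z zq.
by field.
Qed.

Lemma BO_conv : BO (fun q => A1t q * E q) /\ BO (fun q => A1t q * Ep q) /\
  BO (fun q => A1t q * ep q).
Proof.
have HA1 : BO A1t := BO_A1; have HE : BO E := BO_E.
have He := ap_BO eta_le2 ap_ep; have Hp := ap_BO eta_le2 ap_Ep.
by split; [bo|split; bo].
Qed.

End Coefficients.

Section Hyperbolic.
Context {R : realType}.
Implicit Types u v : R.

Lemma cosh2_sinh2 u : cosh u ^+ 2 - sinh u ^+ 2 = 1.
Proof.
rewrite /cosh /sinh expRN; have := expR_gt0 u; move: (expR u) => e e0.
by field; rewrite gt_eqF.
Qed.

Lemma sinhB u v : sinh (u - v) = cosh v * sinh u - cosh u * sinh v.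
Proof.
rewrite /cosh /sinh opprB !expRD !expRN; have := expR_gt0 u; have := expR_gt0 v.
move: (expR u) (expR v) => e f e0 f0.
by field; rewrite !gt_eqF.
Qed.

Lemma coshD u v : cosh (u + v) = cosh v * cosh u + sinh v * sinh u.
Proof.
rewrite /cosh /sinh opprD !expRD !expRN; have := expR_gt0 u; have := expR_gt0 v.
move: (expR u) (expR v) => e f e0 f0.
by field; rewrite !gt_eqF.
Qed.

Lemma sinh_ge0 u : 0 <= u -> 0 <= sinh u.
Proof.
by move=> u0; rewrite divr_ge0// subr_ge0 ler_expR; lra.
Qed.

End Hyperbolic.

(** * Coercivity of the limit form *)

Section Positivity.
Context {R : realType}.
Variables (T beta x0 C0 : R).
Hypotheses (beta_gt0 : 0 < beta) (beta_lt1 : beta < 1) (x0_lt0 : x0 < 0).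
Hypothesis psi_ge1 : forall t x : R, - T <= t <= T -> 0 <= x <= 1 -> 1 <= psi x0 C0 beta t x.

(* The limit form controls [v_t^2] if [kappa > 4 beta lambda] and [v_x^2] if
   [kappa < 4 lambda]; [lambda0] is large enough for the term in [v^2]. *)
Definition lambda0 := ((1 - beta) * x0 ^+ 2)^-1.
Definition kappa0 := 2 * (1 + beta) * lambda0.
Definition coer0 := Num.min (2 * lambda0 * (1 - beta)) (4 * lambda0 ^+ 2).

Let lam_gt0 : 0 < lambda0.
Proof.
rewrite /lambda0 invr_gt0; apply: mulr_gt0; first by rewrite subr_gt0.
by rewrite exprn_even_gt0//= lt_eqF.
Qed.

Lemma phiE t x : phi x0 C0 beta lambda0 t x = phit beta C0 lambda0 t * phix x0 lambda0 x.
Proof.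
by rewrite /phi /phit /phix -expRD /psi real_normK ?num_real//; congr expR; ring.
Qed.

Let phi_ge1 t x : - T <= t <= T -> 0 <= x <= 1 -> 1 <= phit beta C0 lambda0 t * phix x0 lambda0 x.
Proof.
move=> tT x1; rewrite -phiE /phi -expR0 ler_expR mulr_ge0 ?ltW//.
exact: lt_le_trans (psi_ge1 tT x1).
Qed.

Lemma coer0_gt0 : 0 < coer0.
Proof.
by rewrite /coer0 lt_min; apply/andP; split; apply: mulr_gt0;
  rewrite ?exprn_gt0 ?mulr_gt0 ?subr_gt0.
Qed.

(** [kappa0] is the midpoint of the interval from [4 beta lambda0] to [4 lambda0], so [v_t^2] and
    [v_x^2] keep the same margin [2 lambda0 (1 - beta)]. The cross term and the remaining parts of
    the diagonal form squares of [beta t u + X z]. *)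
Lemma first_order_coercive q : dom T q -> forall u u' z : R,
  coer0 * ((u ^+ 2 + u' ^+ 2) / 2 + z ^+ 2)
  <= (2 * phit2 beta C0 lambda0 (ptm q) + kappa0 * phit beta C0 lambda0 (ptm q)) * phix x0 lambda0 (px q)
       * ((u ^+ 2 + u' ^+ 2) / 2)
   + cal_lim beta x0 C0 lambda0 q * z * (u + u') + cga_lim beta x0 C0 lambda0 kappa0 q * z ^+ 2.
Proof.
move=> [_ _ _ tT x1] u u' z.
have := phi_ge1 tT x1.
rewrite /cal_lim /cga_lim /phit2 /phit1 /ddphix /dphix /kappa0.
set t := ptm q; set X := px q - x0; set a := phit _ _ _ _; set e := phix _ _ _ => p1.
have -> : (2 * ((4 * beta ^+ 2 * lambda0 ^+ 2 * t ^+ 2 - 2 * beta * lambda0) * a) +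
  2 * (1 + beta) * lambda0 * a) * e * ((u ^+ 2 + u' ^+ 2) / 2) +
  - 2 * (- 2 * beta * lambda0 * t * a) * (2 * lambda0 * X * e) * z * (u + u') +
  (- (2 * (1 + beta) * lambda0) * a * e +
    2 * a * (2 * (lambda0 + 2 * lambda0 ^+ 2 * X ^+ 2) * e)) * z ^+ 2
  = a * e * (2 * lambda0 * (1 - beta) * ((u ^+ 2 + u' ^+ 2) / 2 + z ^+ 2)
     + 4 * lambda0 ^+ 2 * ((beta * t * u + X * z) ^+ 2 + (beta * t * u' + X * z) ^+ 2)).
  by field.
set Y := (_ + z ^+ 2); have Y0 : 0 <= Y.
  by apply: addr_ge0; rewrite ?sqr_ge0// divr_ge0// addr_ge0// sqr_ge0.
have cY : coer0 * Y <= 2 * lambda0 * (1 - beta) * Y.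
  by rewrite ler_wpM2r// /coer0 ge_min lexx.
set W := 4 * lambda0 ^+ 2 * _; have W0 : 0 <= W.
  apply: mulr_ge0; first by rewrite mulr_ge0// sqr_ge0.
  by rewrite addr_ge0// sqr_ge0.
have V0 : 0 <= 2 * lambda0 * (1 - beta) * Y + W.
  by rewrite addr_ge0// mulr_ge0// mulr_ge0 ?subr_ge0 ?ltW// mulr_gt0.
apply: (le_trans cY); apply: (@le_trans _ _ (2 * lambda0 * (1 - beta) * Y + W)).
  by rewrite lerDl.
by rewrite ler_peMl.
Qed.

(** [D] has no sign, so the square in [D] is completed, at the cost of [(6 beta + 2)^2 / 8 <= 8]
    after factoring [lambda0^2]. By the choice of [lambda0], the term [16 (1 - beta) X^2]
    contributes at least 16, which leaves 8. *)
Lemma zero_order_coercive q : dom T q -> 2 * coer0 <= cnu_lim beta x0 C0 lambda0 kappa0 q.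
Proof.
move=> [_ _ _ tT x1].
have := phi_ge1 tT x1.
rewrite /cnu_lim /phit2 /phit1 /ddphix /dphix /kappa0.
set t := ptm q; set X := px q - x0; set a := phit _ _ _ _; set e := phix _ _ _ => p1.
(* [lambda0^2 phi^2 D] is [phi_x^2 - phi_t^2]. *)
pose D := 4 * X ^+ 2 - 4 * beta ^+ 2 * t ^+ 2.
rewrite [leRHS](_ : _ = (a * e) ^+ 3 * (lambda0 ^+ 3 *
  (16 * (1 - beta) * X ^+ 2 + (6 * beta + 2) * D + 2 * lambda0 * D ^+ 2))); last first.
  by rewrite /D; field.
have HX : x0 ^+ 2 <= X ^+ 2.
  have [px0 _] := andP x1.
  have H : 0 <= px q * (px q - 2 * x0).
    by rewrite mulr_ge0// subr_ge0 (le_trans _ px0)// mulr_ge0_le0// ltW.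
  rewrite /X; lra.
have L : lambda0 * ((1 - beta) * x0 ^+ 2) = 1.
  by rewrite /lambda0 mulVf// mulf_neq0 ?expf_neq0 ?(lt_eqF x0_lt0)// subr_eq0 gt_eqF.
have Q : 8 * lambda0 ^+ 2 <= lambda0 ^+ 3 *
  (16 * (1 - beta) * X ^+ 2 + (6 * beta + 2) * D + 2 * lambda0 * D ^+ 2).
  have H1 : 0 <= lambda0 ^+ 3 * (16 * (1 - beta) * (X ^+ 2 - x0 ^+ 2)).
    by rewrite mulr_ge0 ?exprn_ge0 ?(ltW lam_gt0)// mulr_ge0 ?subr_ge0// mulr_ge0// subr_ge0 ltW.
  have H2 : 0 <= lambda0 ^+ 2 * (2 * (lambda0 * D + (6 * beta + 2) / 4) ^+ 2).
    by rewrite mulr_ge0 ?exprn_ge0 ?(ltW lam_gt0)// mulr_ge0// sqr_ge0.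
  have H3 : 0 <= lambda0 ^+ 2 * (8 - (6 * beta + 2) ^+ 2 / 8).
    have b1 : 0 <= (1 - beta) * (6 * beta + 10).
      by rewrite mulr_ge0 ?subr_ge0 ?(ltW beta_lt1)// addr_ge0 ?mulr_ge0 ?(ltW beta_gt0).
    rewrite mulr_ge0 ?exprn_ge0 ?(ltW lam_gt0)//; lra.
  have H4 : lambda0 ^+ 3 * (16 * (1 - beta) * x0 ^+ 2) = 16 * lambda0 ^+ 2.
    transitivity (16 * lambda0 ^+ 2 * (lambda0 * ((1 - beta) * x0 ^+ 2))); first by ring.
    by rewrite L mulr1.
  lra.
have c8 : 2 * coer0 <= 8 * lambda0 ^+ 2.
  have : coer0 <= 4 * lambda0 ^+ 2 by rewrite /coer0 ge_min lexx orbT.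
  lra.
apply: (le_trans c8); apply: (le_trans Q).
rewrite ler_peMl//; last by rewrite expr_ge1// (le_trans _ p1).
by apply: le_trans Q; rewrite mulr_ge0 ?exprn_ge0// ltW.
Qed.

(** As [x0 < 0], the weight increases in [x] at the left end, so the boundary term there has the
    favourable sign and can be discarded. *)
Lemma left_boundary_coercive q : dom T q -> 2 * lambda0 * - x0 <= cb_lim beta x0 C0 lambda0 q.
Proof.
move=> [_ _ _ tT x1]; have := phi_ge1 tT x1.
rewrite /cb_lim /dphix; set a := phit _ _ _ _; set e := phix _ _ _ => p1.
rewrite (_ : a * _ = a * e * (2 * lambda0 * (px q - x0))); last by ring.
have H : 2 * lambda0 * - x0 <= 2 * lambda0 * (px q - x0).
  have [px0 _] := andP x1.
  by rewrite ler_wpM2l// ?lerDr// mulr_ge0// ltW.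
apply: (le_trans H); rewrite ler_peMl//.
by apply: le_trans H; rewrite mulr_ge0 ?oppr_ge0 ?(ltW x0_lt0)// mulr_ge0// ltW.
Qed.

End Positivity.

(** * The estimate at a fixed time *)

Section Grid.
Context {R : realType}.
Variables (T beta x0 C0 lam K : R).
Variables (N : nat) (s t k : R).
Let h : R := mesh N.
Let r := (h ^+ 2)^-1.

Definition grid (j : nat) := Pt s h t (j%:R * h).
Definition Eg (j : nat) := phix x0 lam (j%:R * h).
(** The exponent on the edge that ends at node [j]. Writing [x_j - h] for its left end gives a
    meaning to the ghost edge [j = 0]. *)
Definition thg (j : nat) := s * phit beta C0 lam t * (phix x0 lam (j%:R * h) - phix x0 lam (j%:R * h - h)).
Definition Cg (j : nat) := cosh (thg j).
Definition Sg (j : nat) := sinh (thg j).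

Lemma mesh_gt0 : 0 < h.
Proof. by rewrite /h /mesh invr_gt0. Qed.

Lemma grid_dom j : 1 <= s -> s * h <= 1 -> - T <= t <= T -> (j <= N.+1)%N -> dom T (grid j).
Proof.
move=> s1 sh tT jN; split=> //=; first exact: mesh_gt0.
rewrite mulr_ge0 ?(ltW mesh_gt0)//=.
by rewrite /h /mesh ler_pdivrMr// mul1r ler_nat.
Qed.

Let gridS j : j.+1%:R * h = j%:R * h + h.
Proof. by rewrite -natr1 mulrDl mul1r. Qed.

Lemma EgS j : Eg j.+1 = Ep x0 lam (grid j).
Proof. by rewrite /Eg gridS. Qed.

Lemma thg_l j : thg j = thl beta x0 C0 lam (grid j).
Proof. by []. Qed.

Lemma thg_r j : thg j.+1 = thr beta x0 C0 lam (grid j).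
Proof. by rewrite /thg gridS addrK. Qed.

Lemma thg_p j : thg j.+2 = thp beta x0 C0 lam (grid j).
Proof.
rewrite /thg !gridS addrK /thp /Epp /Ep/= -addrA.
by rewrite (_ : h + h = 2 * h); last by ring.
Qed.

Hypothesis s_gt0 : 0 < s.

Let h0 : h != 0. Proof. by rewrite gt_eqF ?mesh_gt0. Qed.
Let s0 : s != 0. Proof. by rewrite gt_eqF. Qed.

Lemma rho_ml j : rho Cg Sg j = ml beta x0 C0 lam (grid j) * (s * h ^+ 2).
Proof.
rewrite /rho /ml /= -/h divfK ?mulf_neq0 ?expf_neq0//.
by rewrite -thg_r -thg_l sinhB.
Qed.

Lemma rho_mr j : rho Cg Sg j.+1 = mr beta x0 C0 lam (grid j) * (s * h ^+ 2).
Proof.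
rewrite /rho /mr /= -/h divfK ?mulf_neq0 ?expf_neq0//.
by rewrite -thg_r -thg_p sinhB.
Qed.

Lemma cc_grid j : cc Cg Sg j = cosh (thl beta x0 C0 lam (grid j) + thr beta x0 C0 lam (grid j)).
Proof. by rewrite /cc -thg_r -thg_l coshD. Qed.

Variables v p : nat -> R.
Let y j := s * v j.
Let d j := (v j.+1 - v j) / h.
Let At := phit beta C0 lam t.
Let A1t := phit1 beta C0 lam t.
Let A2t := phit2 beta C0 lam t.
Let A3t := phit3 beta C0 lam t.
Let mlg j := ml beta x0 C0 lam (grid j).

Lemma gedge_grid j :
  gedge s r k K At A1t A2t Eg Cg Sg v p j
  = s * (edge_form (fun j => ckr beta x0 C0 lam (grid j))
     (fun j => cal beta x0 C0 lam (grid j)) (fun j => cga beta x0 C0 lam K (grid j))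
     (fun j => co1 beta x0 C0 lam (grid j)) p y d j - k * (p j.+1 - p j) ^+ 2).
Proof.
rewrite /gedge /edge_form rho_ml rho_mr /Ct /dE /mE /dv /Cg /Sg thg_r EgS.
rewrite /cal /cga /co1 /ckr /ep /= -/h -/At -/A1t -/A2t -/(Eg j) /r /y /d.
move: (ml _ _ _ _ _) (mr _ _ _ _ _) (cosh _) (sinh _) (Ep _ _ _) (Eg j) => m1 m2 c si e1 e.
by field; rewrite s0 h0.
Qed.

(** [Sv] equals [D2 v] plus terms with factor [cosh - 1]. The former yields the [k] in the last
    square, the latter the coefficients [o3] and [o4]; the last square is nonnegative once [k]
    dominates [ml]. *)
Lemma gnode_grid i :
  gnode s r k K At A1t A2t A3t Eg Cg Sg v p i
  = s * (node_form (fun j => (2 * A2t + K * At) * Eg j)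
     (fun i => cnu beta x0 C0 lam K (grid i.+1))
     (fun i => co2 beta x0 C0 lam K (grid i.+1))
     (fun i => k * (cosh (thr beta x0 C0 lam (grid i.+1)) - 1) / (s * h))
     (fun i => k * (cosh (thl beta x0 C0 lam (grid i.+1)) - 1) / (s * h))
     (fun i => - (k * (s * h) * (A1t * Eg i.+1) ^+ 2)) p y d i
     + (k - mlg i.+1 / 2) * (d i.+1 - d i) ^+ 2).
Proof.
rewrite /gnode /node_form rho_ml cc_grid /Sv /D2 /mE /Cg /Sg (thg_r i.+1) (thg_l i.+1) (EgS i.+1).
have -> : Eg i = Em x0 lam (grid i.+1) by rewrite /Em /= -/h gridS addrK.
rewrite /cnu /co2 /mlg /= -/h -/At -/A1t -/A2t -/A3t -/(Eg i.+1) /r /y /d.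
move: (ml _ _ _ _ _) (cosh (_ + _)) (cosh (thl _ _ _ _ _)) (cosh (thr _ _ _ _ _)) (Ep _ _ _) (Em _ _ _) (Eg i.+1) => m1 c c1 c2 e1 e2 e.
by field; rewrite s0 h0.
Qed.

End Grid.

Section Arith.
Context {R : realFieldType}.

Lemma ler_norm_subl (x b w : R) : `|x - b| <= w -> b - w <= x.
Proof. by rewrite ler_norml => /andP[H _]; lra. Qed.

Lemma sqr_split3 (a b c : R) : (a - b - c) ^+ 2 <= 3 * a ^+ 2 + 3 * b ^+ 2 + 3 * c ^+ 2.
Proof.
by have := sqr_ge0 (a + b); have := sqr_ge0 (a + c); have := sqr_ge0 (b - c); lra.
Qed.

(** The losses are [10 w] from the quadratic form and [3 w] from completing the square (a quarter of
    3 times 4, as [DD <= 4 D]). With [52 w <= c] these [13 w] are at most [c/4]. *)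
Lemma absorb_errors (Y Q D DP DD sp dN s w c k B PX BN GN BE SE SN bd : R) :
  0 <= Y -> 0 <= Q -> 0 <= D -> 0 <= DP -> 0 <= DD -> 0 <= sp -> 0 <= dN -> 0 < s ->
  0 <= w -> 0 <= c - 52 * w -> 0 < c -> 0 <= k -> 0 <= B ->
  PX = BN + GN + (BE + (s * SE - s * k * DP)) + bd ->
  4 * PX <= 3 * sp + 3 * (s * w) * Y + 3 * (s * w) * DD ->
  s * SN <= GN -> (c - 10 * w) * (Y + Q + D) <= SN + SE -> DD <= 4 * D ->
  - (s * B) * dN <= bd ->
  c / 2 * s * (Y + Q + D) + BN + BE <= sp + (k + B + 1) * s * (DP + dN).
Proof.
move=> Y0 Q0 D0 DP0 DD0 sp0 dN0 s0 w0 cw c_0 k0 B0 id UP SNE LB DDD BD.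
have L1 := ler_wpM2l (ltW s0) LB.
have Z0 : 0 <= Y + Q + D by rewrite !addr_ge0.
have s1 := ltW s0.
have L3 := mulr_ge0 (mulr_ge0 s1 cw) Z0.
have L4 := ler_wpM2l (mulr_ge0 s1 w0) DDD.
have L5 := mulr_ge0 (mulr_ge0 s1 B0) DP0.
have L6 := mulr_ge0 (mulr_ge0 s1 k0) dN0.
have L7 := mulr_ge0 s1 DP0.
have L8 := mulr_ge0 s1 dN0.
have L9 := mulr_ge0 (mulr_ge0 s1 (ltW c_0)) Z0.
have L10 := mulr_ge0 (mulr_ge0 s1 w0) Y0.
have L11 := mulr_ge0 (mulr_ge0 s1 w0) Q0.
have L12 := mulr_ge0 (mulr_ge0 s1 w0) D0.
clear - id UP SNE L1 L3 L4 L5 L6 L7 L8 L9 L10 L11 L12 BD sp0.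
lra.
Qed.

End Arith.

Section FixedTime.
Context {R : realType}.
Variables (T beta x0 C0 : R).
Hypotheses (beta_gt0 : 0 < beta) (beta_lt1 : beta < 1) (x0_lt0 : x0 < 0).
Hypothesis psi_ge1 : forall t x : R, - T <= t <= T -> 0 <= x <= 1 -> 1 <= psi x0 C0 beta t x.

Notation lam := (lambda0 beta x0).
Notation K := (kappa0 beta x0).
Notation c0 := (coer0 beta x0).

Let lam_gt0 : 0 < lam.
Proof.
rewrite /lambda0 invr_gt0; apply: mulr_gt0; first by rewrite subr_gt0.
by rewrite exprn_even_gt0//= lt_eqF.
Qed.

Lemma thr_ge0 (q : @pt R) : dom T q -> 0 <= thr beta x0 C0 lam q.
Proof.
move=> dq; have s0 := dom_s dq; case: dq => _ h0 _ _ /andP[px0 _].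
rewrite /thr mulr_ge0//; first by rewrite mulr_ge0 ?expR_ge0// ltW.
rewrite subr_ge0 /Ep /phix ler_expR ler_wpM2l ?(ltW lam_gt0)//.
have H1 := ltW h0; have H2 := ltW x0_lt0.
by rewrite ler_pXn2r// ?nnegrE; lra.
Qed.

Lemma ckr_le0 (q : @pt R) : dom T q -> ckr beta x0 C0 lam q <= 0.
Proof.
move=> dq; have t0 := thr_ge0 dq; have z0 := dom_z dq; have s0 := dom_s dq.
have [_ h0 _ _ _] := dq.
have e0 : 0 <= ep x0 lam q.
  have := t0; rewrite /thr pmulr_rge0; last by rewrite mulr_gt0 ?expR_gt0.
  by move=> H; rewrite /ep divr_ge0// ltW.
have H1 : 0 <= sinh (thr beta x0 C0 lam q) / (ps q * ph q).
  by rewrite divr_ge0 ?sinh_ge0// ltW.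
have H4 : 0 <= phix x0 lam (px q) + Ep x0 lam q by rewrite addr_ge0// expR_ge0.
have := mulr_ge0 (mulr_ge0 (mulr_ge0 H1 (sqr_ge0 (phit1 beta C0 lam (ptm q)))) e0) H4.
rewrite /ckr; lra.
Qed.

(** An edge seen from its right end is the same edge seen from its left end, so a single family
    [kap] serves both neighbours of a node. *)
Lemma ckl_grid N (s t : R) j :
  ckl beta x0 C0 lam (grid N s t j.+1) = ckr beta x0 C0 lam (grid N s t j).
Proof.
have E1 : j.+1%:R * mesh N - mesh N = j%:R * mesh N :> R.
  by rewrite -natr1 mulrDl mul1r addrK.
have E2 : j%:R * mesh N + mesh N = j.+1%:R * mesh N :> R.
  by rewrite -natr1 mulrDl mul1r.
rewrite /ckl /ckr /em /ep /Em /Ep -thg_r -thg_l /=.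
by rewrite E1 E2.
Qed.

Lemma carleman_fixed_time : exists k M c eta0 : R,
  [/\ 0 <= k, 0 < M, 0 < c & 0 < eta0] /\
  forall (N : nat) (s t : R), let h : R := mesh N in let r := (h ^+ 2)^-1 in
  1 <= s -> s * h <= 1 -> s * h + s^-1 <= eta0 -> - T <= t <= T ->
  forall v p q : nat -> R,
    v 0%N = 0 -> p 0%N = 0 -> v N.+1 = 0 -> p N.+1 = 0 ->
  let At := phit beta C0 lam t in let A1t := phit1 beta C0 lam t in
  let A2t := phit2 beta C0 lam t in let A3t := phit3 beta C0 lam t in
  let E := Eg x0 lam N in let C := Cg beta x0 C0 lam N s t in
  let S := Sg beta x0 C0 lam N s t in
  let y j := s * v j in let d j := (v j.+1 - v j) / h in
  is_true (c * s * energy N p y d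
  + \sum_(0 <= i < N) bnode' s r k K At A1t A2t A3t E C S v p q i
  + \sum_(0 <= j < N.+1) bedge' s r A1t A2t E C S v p j
  <= \sum_(0 <= i < N) (P1 s r A1t E C v q i + P2 s r A1t A2t E S v p i) ^+ 2
   + M * s * (\sum_(0 <= j < N.+1) (p j.+1 - p j) ^+ 2 + d N ^+ 2 / h)).
Proof.
(* [k] is a uniform bound for [ml]; it is fixed before [C], because some of the error terms contain
   [k]. *)
have [k k0 Hk] := ap_BO (@eta_le2 R T) (ap_ml T beta x0 C0 lam).
have [B B0 HB] := BO_cbr T beta x0 C0 lam.
have [C C_0 HC] := SO_list (Fs := [:: _; _; _; _; _; _; _; _; _; _; _; _]) (@eta_ge0 R T) (conj (ap_cal T beta x0 C0 lam).1
  (conj (SO_co1 T beta x0 C0 lam)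
  (conj (ap_cnu T beta x0 C0 lam K).1
  (conj (ap_cga T beta x0 C0 lam K).1
  (conj (SO_cP T beta x0 C0 lam K)
  (conj (SO_co2 T beta x0 C0 lam K)
  (conj (SO_cosh1 T beta x0 C0 lam k).1
  (conj (SO_cosh1 T beta x0 C0 lam k).2
  (conj (SO_co5 T beta x0 C0 lam k)
  (conj (ap_cb T beta x0 C0 lam).1
  (conj (SO_sq T beta x0 C0 lam K k).1
  (conj (SO_sq T beta x0 C0 lam K k).2 I)))))))))))).

pose b0 := 2 * lam * - x0.
have b0_gt0 : 0 < b0 by rewrite !mulr_gt0// oppr_gt0.
have c0_0 : 0 < c0 := coer0_gt0 beta_lt1 x0_lt0.
(* The first bound yields [52 w <= c0] for absorbing the errors, the second [w <= b0] for keeping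
   the sign at the left end; [C + 1] avoids a zero denominator. *)
pose eta0 := Num.min (c0 / (52 * (C + 1))) (b0 / (C + 1)).
have C1 : 0 < C + 1 by rewrite ltr_wpDl.
have eta0_gt0 : 0 < eta0 by rewrite lt_min !divr_gt0// mulr_gt0.
exists k, (k + B + 1), (c0 / 2), eta0; split.
  by split=> //; [rewrite ltr_wpDl// addr_ge0|rewrite divr_gt0].
move=> N s t h r s1 sh eta_s tT v p q v0 p0 vN pN At A1t A2t A3t E Cc Ss y d.
have s0 : 0 < s by exact: lt_le_trans s1.
have h0 : 0 < h := mesh_gt0 N.
have hn0 : h != 0 by rewrite gt_eqF.
have sn0 : s != 0 by rewrite gt_eqF.
have gd j : (j <= N.+1)%N -> dom T (grid N s t j) by exact: grid_dom.
pose et := s * h + s^-1.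
have et0 : 0 <= et by rewrite addr_ge0 ?mulr_ge0 ?invr_ge0 ?ltW.
pose w := C * et.
have w0 : 0 <= w by rewrite mulr_ge0.
have w52 : 52 * w <= c0.
  have : et * (52 * (C + 1)) <= c0.
    by rewrite -ler_pdivlMr ?mulr_gt0// (le_trans eta_s)// ge_min lexx.
  rewrite /w; lra.
have wb : w <= b0.
  have : et * (C + 1) <= b0.
    by rewrite -ler_pdivlMr// (le_trans eta_s)// ge_min lexx orbT.
  rewrite /w; lra.
have {}HC j (jN : (j <= N.+1)%N) := HC _ (gd j jN).
have CS j : Cc j ^+ 2 - Ss j ^+ 2 = 1 by exact: cosh2_sinh2.
have id := @carleman_identity R s r k K At A1t A2t A3t E Cc Ss v p q N CS v0 p0 vN pN.
have NF i : gnode s r k K At A1t A2t A3t E Cc Ss v p i = _ := @gnode_grid R beta x0 C0 lam K N s t k s0 v p i.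
have EF i : gedge s r k K At A1t A2t E Cc Ss v p i = _ := @gedge_grid R beta x0 C0 lam K N s t k s0 v p i.
have y0 : y 0%N = 0 by rewrite /y v0 mulr0.
have yN : y N.+1 = 0 by rewrite /y vN mulr0.
have HP j : (j <= N)%N -> `|(2 * A2t + K * At) * E j.+1 - (2 * A2t + K * At) * E j| <= w.
  by move=> jN; rewrite -mulrBr /E (EgS x0 lam N s t); exact: (HC j (leqW jN)).2.2.2.2.1.
have HNu j : (j < N)%N -> c0 <= cnu beta x0 C0 lam K (grid N s t j.+1) +
    (ckr beta x0 C0 lam (grid N s t j) + ckr beta x0 C0 lam (grid N s t j.+1)) / 2.
  move=> jN; have := ler_norm_subl (HC j.+1 (leqW jN)).2.2.1; rewrite ckl_grid -/w.
  have := zero_order_coercive beta_gt0 beta_lt1 x0_lt0 psi_ge1 (gd j.+1 (leqW jN)).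
  by move=> H1 H2; clear - T beta x0 C0 beta_gt0 beta_lt1 x0_lt0 psi_ge1 lam_gt0 H1 H2 w52 w0; lra.
have Hmain j : (j <= N)%N -> forall u u' z : R, c0 * ((u ^+ 2 + u' ^+ 2) / 2 + z ^+ 2) <=
    (2 * A2t + K * At) * E j * ((u ^+ 2 + u' ^+ 2) / 2)
    + cal_lim beta x0 C0 lam (grid N s t j) * z * (u + u')
    + cga_lim beta x0 C0 lam K (grid N s t j) * z ^+ 2.
  by move=> jN; exact: (first_order_coercive beta_lt1 x0_lt0 psi_ge1 (gd j (leqW jN))).
have LB : (c0 - 10 * w) * energy N p y d <= _ := @form_lower_bound R N c0 w
  (fun j => (2 * A2t + K * At) * E j) (fun j => cal_lim beta x0 C0 lam (grid N s t j))
  (fun j => cga_lim beta x0 C0 lam K (grid N s t j))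
  (fun j => ckr beta x0 C0 lam (grid N s t j))
     (fun j => cal beta x0 C0 lam (grid N s t j)) (fun j => cga beta x0 C0 lam K (grid N s t j))
     (fun j => co1 beta x0 C0 lam (grid N s t j))
     (fun i => cnu beta x0 C0 lam K (grid N s t i.+1))
     (fun i => co2 beta x0 C0 lam K (grid N s t i.+1))
     (fun i => k * (cosh (thr beta x0 C0 lam (grid N s t i.+1)) - 1) / (s * h))
     (fun i => k * (cosh (thl beta x0 C0 lam (grid N s t i.+1)) - 1) / (s * h))
     (fun i => - (k * (s * h) * (A1t * E i.+1) ^+ 2)) p y d w0
     (fun j jN => (HC j (leqW jN)).1)
     (fun j jN => (HC j (leqW jN)).2.2.2.1)
     HP
     (fun j jN => (HC j (leqW jN)).2.1)
     (fun j jN => ckr_le0 (gd j (leqW jN)))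
     (fun j jN => (HC j.+1 (leqW jN)).2.2.2.2.2.1)
     (fun j jN => (HC j.+1 (leqW jN)).2.2.2.2.2.2.1)
     (fun j jN => (HC j.+1 (leqW jN)).2.2.2.2.2.2.2.1)
     (fun j jN => (HC j.+1 (leqW jN)).2.2.2.2.2.2.2.2.1)
     HNu Hmain y0 yN p0 pN.

move: LB; set SN := \sum_(0 <= i < N) node_form _ _ _ _ _ _ _ _ _ _.
set SE := \sum_(0 <= j < N.+1) edge_form _ _ _ _ _ _ _ _ => LB.
pose dd i := d i.+1 - d i.
pose Y := \sum_(0 <= i < N) y i.+1 ^+ 2.
pose Q := \sum_(0 <= i < N) p i.+1 ^+ 2.
pose D := \sum_(0 <= j < N.+1) d j ^+ 2.
pose DP := \sum_(0 <= j < N.+1) (p j.+1 - p j) ^+ 2.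
pose DD := \sum_(0 <= i < N) dd i ^+ 2.
have Y0 : 0 <= Y by apply: sumr_ge0 => i _; exact: sqr_ge0.
have Q0 : 0 <= Q by apply: sumr_ge0 => i _; exact: sqr_ge0.
have D0 : 0 <= D by apply: sumr_ge0 => i _; exact: sqr_ge0.
have DP0 : 0 <= DP by apply: sumr_ge0 => i _; exact: sqr_ge0.
have DD0 : 0 <= DD by apply: sumr_ge0 => i _; exact: sqr_ge0.
have DDD : DD <= 4 * D.
  have H1 : \sum_(0 <= i < N) d i ^+ 2 <= D by apply: sum_widen_left => i; exact: sqr_ge0.
  have H2 : \sum_(0 <= i < N) d i.+1 ^+ 2 <= D.
    by apply: (@sum_widen_right _ N (fun i => d i ^+ 2)) => i; exact: sqr_ge0.
  have : DD <= \sum_(0 <= i < N) (2 * d i ^+ 2 + 2 * d i.+1 ^+ 2).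
    apply: ler_sum_nat => i _; rewrite /dd.
    by have H := sqr_ge0 (d i.+1 + d i); clear - T beta x0 C0 beta_gt0 beta_lt1 x0_lt0 psi_ge1 lam_gt0 H; lra.
  rewrite big_split/= -!mulr_sumr => H3; clear - T beta x0 C0 beta_gt0 beta_lt1 x0_lt0 psi_ge1 lam_gt0 H1 H2 H3; lra.
have SNE : s * SN <= \sum_(0 <= i < N) gnode s r k K At A1t A2t A3t E Cc Ss v p i.
  rewrite mulr_sumr; apply: ler_sum_nat => i /andP[_ iN].
  rewrite NF ler_wpM2l ?(ltW s0)// lerDl mulr_ge0 ?sqr_ge0// subr_ge0.
  have := Hk _ (gd i.+1 (leqW iN)); rewrite ler_norml => /andP[_ H].
  rewrite ler_pdivrMr//; clear - T beta x0 C0 beta_gt0 beta_lt1 x0_lt0 psi_ge1 lam_gt0 H k0; lra.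
have SEE : \sum_(0 <= j < N.+1) gedge s r k K At A1t A2t E Cc Ss v p j = s * SE - s * k * DP.
  rewrite (eq_bigr _ (fun j _ => EF j)) -mulr_sumr big_split/= sumrN -mulr_sumr.
  by rewrite mulrBr mulrA.
set SP := \sum_(0 <= i < N) (P1 s r A1t E Cc v q i + P2 s r A1t A2t E Ss v p i) ^+ 2.
(* [4 a b <= (a + b)^2] with [a = P1], [b = X]; then [P1 + X] is [P1 + P2] minus two corrections,
   whose squared coefficients are at most [s w]. *)
have UP : 4 * \sum_(0 <= i < N) P1 s r A1t E Cc v q i * Xm s r k K At A1t A2t E Ss v p i
   <= 3 * SP + 3 * (s * w) * Y + 3 * (s * w) * DD.
  rewrite !mulr_sumr -!big_split/=; apply: ler_sum_nat => i /andP[_ iN].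
  set p1 := P1 _ _ _ _ _ _ _ _; set p2 := P2 _ _ _ _ _ _ _ _ _.
  have -> : Xm s r k K At A1t A2t E Ss v p i = p2 - K * At * E i.+1 * y i.+1 - k * s * h * dd i.
    rewrite /Xm -/p2 /D2 /dd /d /y; field; exact: hn0.
  have H1 := (HC i.+1 (leqW iN)).2.2.2.2.2.2.2.2.2.2.1.
  have H2 := (HC i.+1 (leqW iN)).2.2.2.2.2.2.2.2.2.2.2.1.
  rewrite -[_ * eta _]/w in H1; rewrite -[_ * eta _]/w in H2.
  have K1 : (K * At * E i.+1) ^+ 2 <= s * w.
    have := le_trans (ler_norm _) H1.
    by rewrite /= ler_pdivrMr// [w * _]mulrC.
  have K2 : (k * s * h) ^+ 2 <= s * w.
    have := le_trans (ler_norm _) H2; rewrite /= -/h => H.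
    have -> : (k * s * h) ^+ 2 = s * (k ^+ 2 * (s * h) * h) by ring.
    by rewrite ler_wpM2l// ltW.
  have M1 := ler_wpM2r (sqr_ge0 (y i.+1)) K1.
  have M2 := ler_wpM2r (sqr_ge0 (dd i)) K2.
  have S3 := sqr_split3 (p1 + p2) (K * At * E i.+1 * y i.+1) (k * s * h * dd i).
  have S4 := sqr_ge0 (p1 - (p2 - K * At * E i.+1 * y i.+1 - k * s * h * dd i)).
  clear - T beta x0 C0 beta_gt0 beta_lt1 x0_lt0 psi_ge1 lam_gt0 M1 M2 S3 S4; lra.
(* The left end is dropped by its sign; at the right end only the size of the coefficient is used,
   which produces the observation term. *)
have BD : - (s * B) * (d N ^+ 2 / h) <= r ^+ 2 * (Cc 1%N * Ss 1%N * dv v 0 ^+ 2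
    - Cc N.+1 * Ss N.+1 * dv v N ^+ 2
    - rho Cc Ss 0 * dv v 0 ^+ 2 / 2 - rho Cc Ss N.+1 * dv v N ^+ 2 / 2).
  have cb0 := HC 0%N (leq0n _).
  have {cb0} cb0 : 0 <= cb beta x0 C0 lam (grid N s t 0).
    have := ler_norm_subl cb0.2.2.2.2.2.2.2.2.2.1; rewrite -/w.
    have := left_boundary_coercive beta_lt1 x0_lt0 psi_ge1 (gd 0%N (leq0n _)); rewrite -/b0.
    by move=> H1 H2; clear - T beta x0 C0 beta_gt0 beta_lt1 x0_lt0 psi_ge1 lam_gt0 H1 H2 wb; lra.
  have cbN := le_trans (ler_norm _) (HB _ (gd N.+1 (leqnn _))).
  rewrite [leRHS](_ : _ = s / h * (cb beta x0 C0 lam (grid N s t 0) * d 0%N ^+ 2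
     - (cosh (thl beta x0 C0 lam (grid N s t N.+1)) * sinh (thl beta x0 C0 lam (grid N s t N.+1)) / (s * h)
        + h * ml beta x0 C0 lam (grid N s t N.+1) / 2) * d N ^+ 2)); last first.
    rewrite (rho_ml beta x0 C0 lam N t s0 0) (rho_ml beta x0 C0 lam N t s0 N.+1) /Cc /Ss /Cg /Sg.
    rewrite (thg_r _ _ _ _ _ _ _ 0) (thg_l _ _ _ _ _ _ _ N.+1) /cb /= -/h /dv /d /r.
    move: (ml _ _ _ _ (grid N s t 0)) (ml _ _ _ _ (grid N s t N.+1)) => m0 mN.
    move: (cosh (thr _ _ _ _ _)) (sinh (thr _ _ _ _ _)) => c1 s1'.
    move: (cosh (thl _ _ _ _ _)) (sinh (thl _ _ _ _ _)) => c2 s2'.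
    move: (v 0%N) (v 1%N) (v N) (v N.+1) => v0' v1' vN' vN1'.
    clearbody h.
    clear - T beta x0 C0 beta_gt0 beta_lt1 x0_lt0 psi_ge1 lam_gt0 sn0 hn0.
    by field; rewrite sn0 hn0.
  rewrite (_ : - (s * B) * _ = s / h * (- (B * d N ^+ 2))); last by field.
  rewrite ler_wpM2l ?divr_ge0 ?(ltW s0) ?(ltW h0)//.
  have H1 := mulr_ge0 cb0 (sqr_ge0 (d 0%N)).
  have := ler_wpM2r (sqr_ge0 (d N)) cbN; rewrite /= -/h => H2.
  by clear - T beta x0 C0 beta_gt0 beta_lt1 x0_lt0 psi_ge1 lam_gt0 H1 H2; lra.
have dN0 : 0 <= d N ^+ 2 / h by rewrite divr_ge0 ?sqr_ge0 ?(ltW h0).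
have SN2 : \sum_(0 <= i < N) (bnode' s r k K At A1t A2t A3t E Cc Ss v p q i
    + gnode s r k K At A1t A2t A3t E Cc Ss v p i)
  = \sum_(0 <= i < N) bnode' s r k K At A1t A2t A3t E Cc Ss v p q i
    + \sum_(0 <= i < N) gnode s r k K At A1t A2t A3t E Cc Ss v p i by exact: big_split.
have SE2 : \sum_(0 <= j < N.+1) (bedge' s r A1t A2t E Cc Ss v p j
    + gedge s r k K At A1t A2t E Cc Ss v p j)
  = \sum_(0 <= j < N.+1) bedge' s r A1t A2t E Cc Ss v p j
    + \sum_(0 <= j < N.+1) gedge s r k K At A1t A2t E Cc Ss v p j by exact: big_split.
move: id; rewrite SN2 SE2 SEE.
move: BD; set bd := r ^+ 2 * _ => BD.
set BN := \sum_(0 <= i < N) bnode' _ _ _ _ _ _ _ _ _ _ _ _ _ _ _.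
set BE := \sum_(0 <= j < N.+1) bedge' _ _ _ _ _ _ _ _ _ _.
move: SNE UP; set GN := \sum_(0 <= i < N) gnode _ _ _ _ _ _ _ _ _ _ _ _ _ _.
set PX := \sum_(0 <= i < N) _ * _ => SNE UP id.
have EE : energy N p y d = Y + Q + D by [].
rewrite EE in LB *.
rewrite -/DP.
have L3 : 0 <= c0 - 52 * w by rewrite subr_ge0.
have L9 : 0 <= SP by apply: sumr_ge0 => i _; exact: sqr_ge0.
move: dN0 BD; set dN := d N ^+ 2 / h => dN0 BD.
move: id UP SNE LB DDD BD; move: SP L9 => sp sp0.
clearbody BN BE GN PX bd dN SN SE Y Q D DP DD w.
clear - T beta x0 C0 beta_gt0 beta_lt1 x0_lt0 psi_ge1 lam_gt0 Y0 Q0 D0 DP0 DD0 sp0 dN0 L3 s0 w0 c0_0 k0 B0 => id UP SNE LB DDD BD.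
exact: (absorb_errors Y0 Q0 D0 DP0 DD0 sp0 dN0 s0 w0 L3 c0_0 k0 B0 id UP SNE LB DDD BD).
Qed.
End FixedTime.

Section Arith.
Context {R : realFieldType}.

Lemma slope_arith (B2 B4 a1 a2 a3 b4 b5 vj yj dj y' p' : R) :
  a1 <= B2 * b4 -> a2 <= B2 * dj -> a3 <= B2 * vj ->
  B2 * b4 <= B2 * (2 * p' + 2 * b5) -> B2 * b5 <= B4 * y' -> B2 * vj <= B2 * yj ->
  3 * a1 + 3 * a2 + 3 * a3 <= 6 * B2 * p' + 6 * B4 * y' + 3 * B2 * dj + 3 * B2 * yj.
Proof. lra. Qed.

Lemma slope_sum_arith (B Y Q D : R) : 0 <= Y -> 0 <= Q -> 0 <= D ->
  6 * B ^+ 2 * Q + 6 * B ^+ 4 * Y + 3 * B ^+ 2 * D + 3 * B ^+ 2 * Y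
  <= (9 * B ^+ 2 + 6 * B ^+ 4) * (Y + Q + D).
Proof.
move=> Y0 Q0 D0; have B2 := sqr_ge0 B.
have B4 : 0 <= B ^+ 4 by rewrite (exprM B 2 2) sqr_ge0.
have := mulr_ge0 B2 Y0; have := mulr_ge0 B2 Q0; have := mulr_ge0 B2 D0.
by have := mulr_ge0 B4 Q0; have := mulr_ge0 B4 D0; lra.
Qed.

(** Half of [c] absorbs the commutator contained in [DP]. The other half, times [m], must equal
    [3 + 4 B^2], the factor by which the energy of [v] controls the three weighted norms of [w];
    this determines [m]. *)
Lemma absorb_errors_conjugate (s h c M G S1 S2 DP dN S3 S4 SP bw BN BE Y Q D B : R) :
  0 < s -> 0 < h -> 0 < c -> 0 < M -> 0 <= G -> 0 <= Y -> 0 <= Q -> 0 <= D ->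
  0 <= SP -> 0 <= S4 -> 0 <= dN -> h * dN <= bw -> 4 * M * G * (s * h) <= c ->
  c * s * (Y + Q + D) + BN + BE <= SP + M * s * (DP + dN) ->
  S1 <= 2 * Q + 2 * B ^+ 2 * Y -> S2 <= 2 * B ^+ 2 * D + 2 * B ^+ 2 * Y ->
  s ^+ 2 * S3 = Y -> DP <= 2 * S4 + 2 * (s * h) * (G * (Y + Q + D)) ->
  let m := 2 * (3 + 4 * B ^+ 2) / c in
  is_true (s * (h * S1) + s * (h * S2) + s ^+ 3 * (h * S3) + m * h * (BN + BE)
  <= m * (1 + 2 * M) * (h * SP) + m * (1 + 2 * M) * s * bw + m * (1 + 2 * M) * s * (h * S4)).
Proof.
move=> s0 h0 c0 M0 G0 Y0 Q0 D0 SP0 S40 dN0 bwE zM HH S1b S2b S3b DPb m.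
have m0 : 0 < m.
  by rewrite divr_gt0// mulr_gt0// ltr_wpDr// mulr_ge0// sqr_ge0.
have Z0 : 0 <= Y + Q + D by rewrite !addr_ge0.
have cE : m * (c / 2) = 3 + 4 * B ^+ 2 by rewrite /m; field; rewrite gt_eqF.
have T1 : M * s * DP <= 2 * (M * s * S4) + c / 2 * s * (Y + Q + D).
  have H1 := ler_wpM2l (mulr_ge0 (ltW M0) (ltW s0)) DPb.
  have H2 := ler_wpM2r (mulr_ge0 (ltW s0) Z0) zM.
  by clear - H1 H2; lra.
have T2 : c / 2 * s * (Y + Q + D) + BN + BE <= SP + 2 * (M * s * S4) + M * s * dN.
  by clear - T1 HH; lra.
have T3 := ler_wpM2l (mulr_ge0 (ltW m0) (ltW h0)) T2.
have LB : s * S1 + s * S2 + s * (s ^+ 2 * S3) <= s * ((3 + 4 * B ^+ 2) * (Y + Q + D)).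
  rewrite -!mulrDr ler_wpM2l ?(ltW s0)// S3b.
  have := mulr_ge0 (sqr_ge0 B) Y0; have := mulr_ge0 (sqr_ge0 B) Q0.
  have := mulr_ge0 (sqr_ge0 B) D0.
  by clear - S1b S2b Y0 Q0 D0; lra.
have T4 := ler_wpM2l (ltW h0) LB.
rewrite -cE in T4.
have T5 := ler_wpM2l (mulr_ge0 (mulr_ge0 (ltW m0) (ltW M0)) (ltW s0)) bwE.
have T6 := mulr_ge0 (mulr_ge0 (mulr_ge0 (ltW m0) (ltW M0)) (ltW h0)) SP0.
have T7 := mulr_ge0 (mulr_ge0 (mulr_ge0 (ltW m0) (ltW s0)) (ltW h0)) S40.
have bw0 : 0 <= bw by apply: le_trans bwE; rewrite mulr_ge0// ltW.
have T8 := mulr_ge0 (mulr_ge0 (mulr_ge0 (ltW m0) (ltW M0)) (ltW s0)) bw0.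
have T9 := mulr_ge0 (mulr_ge0 (ltW m0) (ltW s0)) bw0.
rewrite (_ : s ^+ 3 = s * s ^+ 2); last by rewrite exprS.
move: T3 T4 T5 T6 T7 T8 T9; clearbody m; clear; lra.
Qed.

End Arith.

(** * Return to the original unknown *)

Section Original.
Context {R : realType}.
Variables (T beta x0 C0 : R).
Hypotheses (beta_gt0 : 0 < beta) (beta_lt1 : beta < 1) (x0_lt0 : x0 < 0).
Hypothesis psi_ge1 : forall t x : R, - T <= t <= T -> 0 <= x <= 1 -> 1 <= psi x0 C0 beta t x.

Notation lam := (lambda0 beta x0).
Notation K := (kappa0 beta x0).
Notation phi t x := (phi x0 C0 beta lam t x).

Let lam_gt0 : 0 < lam.
Proof.
rewrite /lambda0 invr_gt0; apply: mulr_gt0; first by rewrite subr_gt0.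
by rewrite exprn_even_gt0//= lt_eqF.
Qed.

Section Conjugation.
Variables (N : nat) (s t : R).
Hypothesis s_gt0 : 0 < s.
Let h : R := mesh N.
Let At := phit beta C0 lam t.
Let A1t := phit1 beta C0 lam t.
Let A2t := phit2 beta C0 lam t.
Let E := Eg x0 lam N.
Variables W U Z : nat -> R.

Definition om (j : nat) := expR (s * phi t (j%:R * h)).
(** These are [v], [v_t], [v_tt] when [U] and [Z] are the first two time derivatives of [W]. At a
    frozen time the three are independent data. *)
Definition cv (j : nat) := om j * W j.
Definition cp (j : nat) := om j * (U j + s * A1t * E j * W j).
Definition cq (j : nat) := om j * (Z j + 2 * s * A1t * E j * U j
  + (s ^+ 2 * (A1t * E j) ^+ 2 + s * A2t * E j) * W j).

Let E1 j : j.+1%:R * h - h = j%:R * h.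
Proof. by rewrite -natr1 mulrDl mul1r addrK. Qed.

Lemma omS j : om j = expR (- thg beta x0 C0 lam N s t j.+1) * om j.+1.
Proof.
rewrite /om -expRD !phiE; congr expR; rewrite /thg -/h E1; ring.
Qed.

Lemma omS' j : om j.+1 = expR (thg beta x0 C0 lam N s t j.+1) * om j.
Proof. by rewrite (omS j) mulrA -expRD subrr expR0 mul1r. Qed.

Lemma conjugate i :
  P1 s (h ^+ 2)^-1 A1t E (Cg beta x0 C0 lam N s t) cv cq i
  + P2 s (h ^+ 2)^-1 A1t A2t E (Sg beta x0 C0 lam N s t) cv cp i
  = om i.+1 * (Z i.+1 - Laph N W i.+1).
Proof.
have h0 : h != 0 by rewrite gt_eqF ?mesh_gt0.
(* [sinh - cosh] and [sinh + cosh] are [- e^(-theta)] and [e^theta], exactly the factors that carry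
   [om] from one node to its neighbour. *)
have c1 : (Sg beta x0 C0 lam N s t i.+2 - Cg beta x0 C0 lam N s t i.+2) * om i.+2 = - om i.+1.
  by rewrite (omS i.+1) /Sg /Cg /sinh /cosh; field.
have c2 : (Sg beta x0 C0 lam N s t i.+1 + Cg beta x0 C0 lam N s t i.+1) * om i = om i.+1.
  by rewrite (omS' i) /Sg /Cg /sinh /cosh; field.
rewrite /P1 /P2 /Sv /Av /Laph /= -/h.
transitivity (cq i.+1 + s ^+ 2 * (A1t * E i.+1) ^+ 2 * cv i.+1
  - 2 * s * A1t * E i.+1 * cp i.+1 - s * A2t * E i.+1 * cv i.+1
  + (h ^+ 2)^-1 * ((Sg beta x0 C0 lam N s t i.+2 - Cg beta x0 C0 lam N s t i.+2) * om i.+2 * W i.+2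
      + 2 * cv i.+1
      - (Sg beta x0 C0 lam N s t i.+1 + Cg beta x0 C0 lam N s t i.+1) * om i * W i)).
  by rewrite /cv; ring.
by rewrite c1 c2 /cq /cp /cv; field.
Qed.

Lemma cp_U j : om j * U j = cp j - A1t * E j * (s * cv j).
Proof. by rewrite /cp /cv; ring. Qed.

Lemma om_Dplus j : om j * Dplus N W j
  = expR (- thg beta x0 C0 lam N s t j.+1) * ((cv j.+1 - cv j) / h)
  + (expR (- thg beta x0 C0 lam N s t j.+1) - 1) / (s * h) * (s * cv j).
Proof.
have h0 : h != 0 by rewrite gt_eqF ?mesh_gt0.
have s0 : s != 0 by rewrite gt_eqF.
rewrite /Dplus -/h mulrA mulrBr [X in (X * W j.+1 - _)](omS j).
set e := expR _.
by rewrite -[X in (X - _) / h]mulrA -/(cv j.+1) -/(cv j); field; rewrite h0 s0.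
Qed.

(** The commutator is written with the factor [s h] in front of bounded multiples of [p], [s v], [d]
    and [v], so that it can be absorbed. *)
Lemma cpB j : cp j.+1 - cp j = om j * (U j.+1 - U j)
  + (s * h) * (- ((expR (- thg beta x0 C0 lam N s t j.+1) - 1) / (s * h))
        * (cp j.+1 - A1t * E j.+1 * (s * cv j.+1))
     + A1t * E j.+1 * ((cv j.+1 - cv j) / h) + A1t * ((E j.+1 - E j) / h) * cv j).
Proof.
have h0 : h != 0 by rewrite gt_eqF ?mesh_gt0.
have s0 : s != 0 by rewrite gt_eqF.
rewrite -cp_U.
have -> : om j * (U j.+1 - U j) = expR (- thg beta x0 C0 lam N s t j.+1) * om j.+1 * U j.+1 - om j * U j.
  by rewrite mulrBr {1}(omS j).
rewrite /cp /cv.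
by field; rewrite h0 s0.
Qed.

End Conjugation.

Lemma sqr_sum2 (a b : R) : (a + b) ^+ 2 <= 2 * a ^+ 2 + 2 * b ^+ 2.
Proof. by have := sqr_ge0 (a - b); lra. Qed.

Lemma sqr_sum3 (a b c : R) : (a + b + c) ^+ 2 <= 3 * a ^+ 2 + 3 * b ^+ 2 + 3 * c ^+ 2.
Proof.
by have := sqr_ge0 (a - b); have := sqr_ge0 (a - c); have := sqr_ge0 (b - c); lra.
Qed.

Lemma sqr_le_mul (x a B : R) : `|x| <= B -> (x * a) ^+ 2 <= B ^+ 2 * a ^+ 2.
Proof.
move=> xB; rewrite exprMn ler_wpM2r ?sqr_ge0// -real_normK ?num_real//.
by rewrite ler_pXn2r// nnegrE// (le_trans _ xB).
Qed.

Lemma carleman_fixed_time_original : exists k m M eta0 : R,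
  [/\ 0 <= k, 0 < m, 0 < M & 0 < eta0] /\
  forall (N : nat) (s t : R), let h : R := mesh N in let r := (h ^+ 2)^-1 in
  1 <= s -> s * h <= 1 -> s * h + s^-1 <= eta0 -> - T <= t <= T ->
  forall W U Z : nat -> R,
    W 0%N = 0 -> U 0%N = 0 -> W N.+1 = 0 -> U N.+1 = 0 ->
  let At := phit beta C0 lam t in let A1t := phit1 beta C0 lam t in
  let A2t := phit2 beta C0 lam t in let A3t := phit3 beta C0 lam t in
  let E := Eg x0 lam N in let C := Cg beta x0 C0 lam N s t in
  let S := Sg beta x0 C0 lam N s t in
  let v := cv N s t W in let p := cp N s t W U in let q := cq N s t W U Z in
  let weight (x : R) := expR (2 * s * phi t x) in
  is_true (s * dint_oo N (fun j => weight (j%:R * h) * U j ^+ 2)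
  + s * dint_co N (fun j => weight (j%:R * h) * Dplus N W j ^+ 2)
  + s ^+ 3 * dint_oo N (fun j => weight (j%:R * h) * W j ^+ 2)
  + m * h * (\sum_(0 <= i < N) bnode' s r k K At A1t A2t A3t E C S v p q i
  + \sum_(0 <= j < N.+1) bedge' s r A1t A2t E C S v p j)
  <= M * dint_oo N (fun j => weight (j%:R * h) * (Z j - Laph N W j) ^+ 2)
   + M * s * (weight 1 * Dminus N W N.+1 ^+ 2)
   + M * s * dint_co N (fun j => weight (j%:R * h) * (h * Dplus N U j) ^+ 2)).
Proof.
have [k [M [c [eta0 [[k0 M0 c0 e0] H]]]]] :=
  carleman_fixed_time beta_gt0 beta_lt1 x0_lt0 psi_ge1.
have [B B0 HB] := BO_list (Fs := [:: _; _; _; _; _])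
  (conj (BO_exp T beta x0 C0 lam).1 (conj (BO_exp T beta x0 C0 lam).2
  (conj (BO_conv T beta x0 C0 lam).1 (conj (BO_conv T beta x0 C0 lam).2.1
  (conj (BO_conv T beta x0 C0 lam).2.2 I))))).
pose L := 3 + 4 * B ^+ 2.
pose G := 9 * B ^+ 2 + 6 * B ^+ 4.
have L0 : 0 < L by rewrite ltr_wpDr// mulr_ge0// sqr_ge0.
have G0 : 0 <= G by rewrite addr_ge0 ?mulr_ge0 ?exprn_ge0.
pose m := 2 * L / c.
have m0 : 0 < m by rewrite divr_gt0 ?mulr_gt0.
(* Chosen so that [4 M G (s h) <= c]; the added 1 keeps the quotient defined when [G = 0]. *)
pose e1 := c / (4 * M * G + 1).
have MG : 0 < 4 * M * G + 1 by rewrite ltr_wpDl// mulr_ge0 ?mulr_ge0 ?(ltW M0).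
exists k, m, (m * (1 + 2 * M)), (Num.min eta0 e1); split.
  split=> //; first by rewrite mulr_gt0// addr_gt0// mulr_gt0.
  by rewrite lt_min e0 divr_gt0.
move=> N s t h r s1 sh; rewrite le_min => /andP[eta_s eta_e] tT W U Z W0 U0 WN UN.
move=> At A1t A2t A3t E Cc Ss v p q weight.
have s0 : 0 < s by exact: lt_le_trans s1.
have h0 : 0 < h := mesh_gt0 N.
have v0 : v 0%N = 0 by rewrite /v /cv W0 mulr0.
have vN : v N.+1 = 0 by rewrite /v /cv WN mulr0.
have p0 : p 0%N = 0 by rewrite /p /cp W0 U0 mulr0 addr0 mulr0.
have pN : p N.+1 = 0 by rewrite /p /cp WN UN mulr0 addr0 mulr0.
have := H N s t s1 sh eta_s tT v p q v0 p0 vN pN; cbv zeta.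
have zM : 4 * M * G * (s * h) <= c.
  have : (s * h) * (4 * M * G + 1) <= c.
    rewrite -ler_pdivlMr//; apply: le_trans eta_e.
    by rewrite lerDl invr_ge0 ltW.
  apply: le_trans; rewrite [leRHS](_ : _ = 4 * M * G * (s * h) + s * h); last by ring.
  rewrite lerDl.
  by rewrite mulr_ge0 ?(ltW s0) ?(ltW h0).
pose y j := s * v j; pose d j := (v j.+1 - v j) / h.
have -> : \sum_(0 <= i < N) (P1 s (mesh N ^+ 2)^-1 A1t E Cc v q i
    + P2 s (mesh N ^+ 2)^-1 A1t A2t E Ss v p i) ^+ 2
  = \sum_(0 <= i < N) (om N s t i.+1 * (Z i.+1 - Laph N W i.+1)) ^+ 2.
  by apply: eq_bigr => i _; rewrite conjugate.
set BN := \sum_(0 <= i < N) bnode' _ _ _ _ _ _ _ _ _ _ _ _ _ _ _.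
set BE := \sum_(0 <= j < N.+1) bedge' _ _ _ _ _ _ _ _ _ _.
set SP := \sum_(0 <= i < N) (_ * (_ - _)) ^+ 2.
set DP := \sum_(0 <= j < N.+1) _.
pose Y := \sum_(0 <= i < N) y i.+1 ^+ 2.
pose Q := \sum_(0 <= i < N) p i.+1 ^+ 2.
pose D := \sum_(0 <= j < N.+1) d j ^+ 2.
have -> : energy N p (fun j => s * v j) (fun j => (v j.+1 - v j) / h) = Y + Q + D by [].
rewrite -/(d N) => HH.
pose S1 := \sum_(0 <= i < N) (om N s t i.+1 * U i.+1) ^+ 2.
pose S2 := \sum_(0 <= j < N.+1) (om N s t j * Dplus N W j) ^+ 2.
pose S3 := \sum_(0 <= i < N) (om N s t i.+1 * W i.+1) ^+ 2.
pose S4 := \sum_(0 <= j < N.+1) (om N s t j * (U j.+1 - U j)) ^+ 2.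
have wE x : weight x = expR (s * phi t x) ^+ 2.
  by rewrite /weight expr2 -expRD; congr expR; ring.
have y00 : y 0%N ^+ 2 = 0 by rewrite /y v0 mulr0 expr0n.
have yN0 : y N.+1 ^+ 2 = 0 by rewrite /y vN mulr0 expr0n.
have pN0 : p N.+1 ^+ 2 = 0 by rewrite pN expr0n.
have Yl : \sum_(0 <= j < N.+1) y j ^+ 2 = Y by exact: (@sum_edge_left _ N (fun j => y j ^+ 2)).
have Yr : \sum_(0 <= j < N.+1) y j.+1 ^+ 2 = Y by exact: (@sum_edge_right _ N (fun j => y j ^+ 2)).
have Qr : \sum_(0 <= j < N.+1) p j.+1 ^+ 2 = Q by exact: (@sum_edge_right _ N (fun j => p j ^+ 2)).
have Y0 : 0 <= Y by apply: sumr_ge0 => i _; exact: sqr_ge0.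
have Q0 : 0 <= Q by apply: sumr_ge0 => i _; exact: sqr_ge0.
have D0 : 0 <= D by apply: sumr_ge0 => i _; exact: sqr_ge0.
have {}HB j (jN : (j <= N.+1)%N) := HB _ (grid_dom s1 sh tT jN).
have S1b : S1 <= 2 * Q + 2 * B ^+ 2 * Y.
  rewrite !mulr_sumr -big_split/=; apply: ler_sum_nat => i /andP[_ iN].
  rewrite (cp_U N s t W) -/(p i.+1).
  have H1 := sqr_sum2 (p i.+1) (- (A1t * E i.+1) * y i.+1).
  have H2 := @sqr_le_mul (- (A1t * E i.+1)) (y i.+1) B.
  rewrite normrN in H2; have {}H2 := H2 (HB i.+1 (leqW iN)).2.2.1.
  rewrite mulNr in H1 H2; apply: (le_trans H1).
  by rewrite lerD2l -mulrA ler_wpM2l.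
have S2b : S2 <= 2 * B ^+ 2 * D + 2 * B ^+ 2 * Y.
  rewrite -Yl !mulr_sumr -big_split/=; apply: ler_sum_nat => j /andP[_ jN].
  rewrite om_Dplus//; apply: (le_trans (sqr_sum2 _ _)); rewrite -!(mulrA 2).
  by apply: lerD; rewrite ler_wpM2l// sqr_le_mul// (thg_r _ _ _ _ _ _ _ j);
    [exact: (HB j (leqW jN)).1|exact: (HB j (leqW jN)).2.1].
have S3b : s ^+ 2 * S3 = Y.
  by rewrite mulr_sumr; apply: eq_bigr => i _; rewrite /y /v /cv -exprMn.
have DPb : DP <= 2 * S4 + 2 * (s * h) * (G * (Y + Q + D)).
  pose P j := - ((expR (- thg beta x0 C0 lam N s t j.+1) - 1) / (s * h))
        * (p j.+1 - A1t * E j.+1 * (s * v j.+1))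
     + A1t * E j.+1 * ((v j.+1 - v j) / h) + A1t * ((E j.+1 - E j) / h) * v j.
  have Pb j : (j <= N)%N -> P j ^+ 2 <= 6 * B ^+ 2 * p j.+1 ^+ 2 + 6 * B ^+ 4 * y j.+1 ^+ 2
      + 3 * B ^+ 2 * d j ^+ 2 + 3 * B ^+ 2 * y j ^+ 2.
    move=> jN; have [_ [b1 [_ [b2 [b3 _]]]]] := HB j (leqW jN).
    rewrite -(thg_r beta x0 C0 lam N s t j) in b1.
    rewrite /= -(EgS x0 lam N s t j) in b2.
    rewrite /ep /= -(EgS x0 lam N s t j) in b3.
    rewrite -normrN in b1.
    have H1 := sqr_le_mul (p j.+1 - A1t * E j.+1 * y j.+1) b1.
    have H2 := sqr_le_mul (d j) b2.
    have H3 := sqr_le_mul (v j) b3.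
    (* This uses [s >= 1]. *)
    have H4 : v j ^+ 2 <= y j ^+ 2.
      by rewrite /y [leRHS]exprMn ler_peMl ?sqr_ge0// expr_ge1// ltW.
    have H5 := sqr_sum2 (p j.+1) (- (A1t * E j.+1) * y j.+1).
    have H6 := @sqr_le_mul (- (A1t * E j.+1)) (y j.+1) B.
    rewrite normrN in H6; have {}H6 := H6 b2.
    rewrite mulNr in H5 H6.
    have B2 : 0 <= B ^+ 2 by exact: sqr_ge0.
    have H7 := ler_wpM2l B2 H5.
    have H8 := ler_wpM2l B2 H6.
    have H9 := ler_wpM2l B2 H4.
    apply: (le_trans (sqr_sum3 _ _ _)).
    have B4 : B ^+ 4 = B ^+ 2 * B ^+ 2 by rewrite -exprD.
    rewrite [leRHS]mulrA -B4 in H8.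
    exact: (slope_arith H1 H2 H3 H7 H8 H9).
  have E1 j : (p j.+1 - p j) ^+ 2 <= 2 * (om N s t j * (U j.+1 - U j)) ^+ 2
      + 2 * (s * h) ^+ 2 * P j ^+ 2.
    rewrite cpB//; apply: (le_trans (sqr_sum2 _ _)); rewrite lerD2l.
    by rewrite -[leRHS]mulrA ler_wpM2l// -exprMn.
  have z0 : 0 <= s * h by rewrite mulr_ge0 ?(ltW s0) ?(ltW h0).
  (* One power of [s h] is given up, since a single one is enough for the absorption. *)
  have zz : (s * h) ^+ 2 <= s * h by rewrite expr2 ler_piMl.
  apply: (@le_trans _ _ (\sum_(0 <= j < N.+1) (2 * (om N s t j * (U j.+1 - U j)) ^+ 2
     + 2 * (s * h) * (6 * B ^+ 2 * p j.+1 ^+ 2 + 6 * B ^+ 4 * y j.+1 ^+ 2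
      + 3 * B ^+ 2 * d j ^+ 2 + 3 * B ^+ 2 * y j ^+ 2)))).
    apply: ler_sum_nat => j /andP[_ jN]; apply: (le_trans (E1 j)); rewrite lerD2l.
    apply: ler_pM; [by rewrite mulr_ge0 ?sqr_ge0|exact: sqr_ge0|by rewrite ler_wpM2l|exact: Pb].
  rewrite big_split/= -!mulr_sumr !big_split/= -!mulr_sumr Yl Yr Qr -/D -/S4.
  rewrite lerD2l ler_wpM2l ?mulr_ge0 ?(ltW s0) ?(ltW h0)//.
  exact: slope_sum_arith.
have hE (F : nat -> R) : dint_oo N F = h * \sum_(0 <= i < N) F i.+1.
  by rewrite /dint_oo big_add1.
have omE j : weight (j%:R * h) = om N s t j ^+ 2 by rewrite wE.
have I1 : dint_oo N (fun j => weight (j%:R * h) * U j ^+ 2) = h * S1.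
  by rewrite hE; congr (_ * _); apply: eq_bigr => i _; rewrite omE [RHS]exprMn.
have I2 : dint_co N (fun j => weight (j%:R * h) * Dplus N W j ^+ 2) = h * S2.
  by congr (_ * _); apply: eq_bigr => i _; rewrite omE [RHS]exprMn.
have I3 : dint_oo N (fun j => weight (j%:R * h) * W j ^+ 2) = h * S3.
  by rewrite hE; congr (_ * _); apply: eq_bigr => i _; rewrite omE [RHS]exprMn.
have I4 : dint_co N (fun j => weight (j%:R * h) * (h * Dplus N U j) ^+ 2) = h * S4.
  congr (_ * _); apply: eq_bigr => i _; rewrite omE [RHS]exprMn; congr (_ * _ ^+ 2).
  by rewrite /Dplus -/h mulrC divfK ?gt_eqF.
have I5 : dint_oo N (fun j => weight (j%:R * h) * (Z j - Laph N W j) ^+ 2) = h * SP.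
  by rewrite hE; congr (_ * _); apply: eq_bigr => i _; rewrite omE [RHS]exprMn.
(* As [v] vanishes at node N+1, its last difference carries the weight of node N, whereas the
   observation term carries the weight at [x = 1]. The latter is larger because [phix] increases on
   [[0,1]]. *)
have I6 : h * (d N ^+ 2 / h) <= weight 1 * Dminus N W N.+1 ^+ 2.
  have dE : d N ^+ 2 = om N s t N ^+ 2 * (W N / h) ^+ 2.
    by rewrite /d vN sub0r mulNr sqrrN /v /cv -mulrA exprMn.
  have DE : Dminus N W N.+1 ^+ 2 = (W N / h) ^+ 2.
    by rewrite /Dminus /= WN sub0r mulNr sqrrN.
  rewrite [leLHS]mulrC divfK ?gt_eqF// dE DE ler_wpM2r ?sqr_ge0// wE /om.
  rewrite ler_pXn2r// ?nnegrE ?expR_ge0// ler_expR ler_wpM2l ?(ltW s0)// !phiE.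
  rewrite ler_wpM2l ?expR_ge0// /phix ler_expR ler_wpM2l ?(ltW lam_gt0)//.
  have N1 : N%:R * h <= 1 by rewrite /h /mesh ler_pdivrMr// mul1r ler_nat.
  have N0 : 0 <= N%:R * h by rewrite mulr_ge0// ltW.
  have x0' := ltW x0_lt0.
  by rewrite ler_pXn2r// ?nnegrE ?lerD2r// subr_ge0 ?(le_trans x0')// (le_trans x0').
rewrite I1 I2 I3 I4 I5.
have SP0 : 0 <= SP by apply: sumr_ge0 => i _; exact: sqr_ge0.
have S40 : 0 <= S4 by apply: sumr_ge0 => i _; exact: sqr_ge0.
have S30 : 0 <= S3 by apply: sumr_ge0 => i _; exact: sqr_ge0.
have dN0 : 0 <= d N ^+ 2 / h by rewrite divr_ge0 ?sqr_ge0 ?(ltW h0).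
exact: (@absorb_errors_conjugate R s h c M G S1 S2 DP (d N ^+ 2 / h) S3 S4 SP
  (weight 1 * Dminus N W N.+1 ^+ 2) BN BE Y Q D B).
Qed.
End Original.

(** * Integration in time *)

Section TimeInt.
Context {R : realType}.
Variable T : R.
Notation mf := (measurable_fun `](- T), T[).
Implicit Types g : R -> R.

Lemma time_intZ (c : R) g : 0 <= c -> mf g -> (forall t, 0 <= g t) ->
  time_int T (fun t => c * g t) = (c%:E * time_int T g)%E.
Proof.
move=> c0 mg g0; rewrite /time_int -ge0_integralZl//.
- by apply/measurable_EFinP.
- by move=> t _; rewrite lee_fin.
Qed.

Lemma time_intD g1 g2 : mf g1 -> mf g2 -> (forall t, 0 <= g1 t) -> (forall t, 0 <= g2 t) ->
  time_int T (fun t => g1 t + g2 t) = (time_int T g1 + time_int T g2)%E.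
Proof.
move=> m1 m2 p1 p2; rewrite /time_int -ge0_integralD//.
- by move=> t _; rewrite lee_fin.
- by apply/measurable_EFinP.
- by move=> t _; rewrite lee_fin.
- by apply/measurable_EFinP.
Qed.

Lemma measurable_fun_sum_nat m n (g : nat -> R -> R) : (forall j, (m <= j < n)%N -> mf (g j)) ->
  mf (fun t => \sum_(m <= j < n) g j t).
Proof.
have nil k : (k <= m)%N -> mf (fun t => \sum_(m <= j < k) g j t).
  move=> km; rewrite (_ : (fun t => _) = cst 0); last by apply/funext => t; rewrite big_geq.
  exact: measurable_cst.
elim: n => [_|n IH H]; first exact: nil.
have [mn|mn] := leqP m n; last exact: nil.
rewrite (_ : (fun t => _) = (fun t => \sum_(m <= j < n) g j t + g n t)).
  apply: measurable_funD; last by apply: H; rewrite mn ltnSn.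
  by apply: IH => j /andP[mj jn]; apply: H; rewrite mj ltnW.
by apply/funext => t; rewrite big_nat_recr.
Qed.

Lemma prim_open_integral (F f : R -> R) : 0 < T -> prim (- T) T F f ->
  F (- T) = 0 -> F T = 0 ->
  (@lebesgue_measure R).-integrable `](- T), T[ (EFin \o f) /\
  \int[lebesgue_measure]_(t in `](- T), T[) f t = 0.
Proof.
move=> T0 [fi FE] F0 F1.
have NT : - T <= T by rewrite ge0_cp// ltW.
have fo : (@lebesgue_measure R).-integrable `](- T), T[ (EFin \o f).
  by apply: integrableS fi => //; exact: subset_itv_oo_cc.
split=> //.
rewrite Rintegral_itv_bndo_bndc// Rintegral_itv_obnd_cbnd.
  by rewrite -FE// F0 F1 subrr.
by apply: integrableS fi => //; apply: subset_itvr; rewrite bnd_simp.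
Qed.

End TimeInt.

Section CoefPrim.
Context {R : realType}.
Variables (T beta x0 C0 lam : R).
Hypothesis T_gt0 : 0 < T.

Let NT : - T < T. Proof. by rewrite gtrN. Qed.

Lemma is_derive_A (t : R) : is_derive t 1 (phit beta C0 lam) (phit1 beta C0 lam t).
Proof.
rewrite /phit1 /phit; apply: is_derive_eq; rewrite /GRing.scale/=. ring.
Qed.

Lemma continuous_of_derive (F f : R -> R) : (forall t : R, is_derive t 1 F (f t)) -> continuous F.
Proof.
move=> dF t; apply: differentiable_continuous; apply/derivable1_diffP.
exact: (@ex_derive _ _ _ _ _ _ _ (dF t)).
Qed.

Lemma continuous_A1 : continuous (phit1 beta C0 lam).
Proof.
move=> t; apply: (@continuousM _ _ (fun t => - 2 * beta * lam * t) (phit beta C0 lam)).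
  by apply: continuousM; [exact: cst_continuous|exact: cvg_id].
exact: continuous_of_derive is_derive_A _.
Qed.

Lemma prim_A : prim (- T) T (phit beta C0 lam) (phit1 beta C0 lam).
Proof. exact: prim_C1 NT is_derive_A continuous_A1. Qed.

Lemma prim_id (a b : R) : a < b -> prim a b (fun t : R => t) (cst 1).
Proof.
move=> ab; apply: prim_C1 => //; last exact: cst_continuous.
Qed.

Lemma prim_expA c : prim (- T) T (fun t => expR (c * phit beta C0 lam t))
  (fun t => c * phit1 beta C0 lam t * expR (c * phit beta C0 lam t)).
Proof.
have D (t : R) : is_derive t 1 (fun t => expR (c * phit beta C0 lam t))
    (c * phit1 beta C0 lam t * expR (c * phit beta C0 lam t)).
  have dA := is_derive_A t.
  by apply: is_derive_eq; rewrite /GRing.scale/=; ring.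
apply: prim_C1 => // t.
apply: (@continuousM _ _ (fun t => c * phit1 beta C0 lam t)).
  by apply: continuousM; [exact: cst_continuous|exact: continuous_A1].
exact: continuous_of_derive D _.
Qed.

End CoefPrim.

(** * The terms that are exact time derivatives *)

Section Density.
Context {R : realType}.
Variables (T beta x0 C0 K k s : R) (N : nat).
Hypothesis T_gt0 : 0 < T.
Notation primT := (prim (- T) T).
Notation lam := (lambda0 beta x0).
Notation phit := (phit beta C0 lam).
Notation phit1 := (phit1 beta C0 lam).
Notation phit2 := (phit2 beta C0 lam).
Notation phit3 := (phit3 beta C0 lam).
Notation E := (Eg x0 lam N).
Notation C := (fun t j => Cg beta x0 C0 lam N s t j).
Notation S := (fun t j => Sg beta x0 C0 lam N s t j).
Let h : R := mesh N.
Let r := (h ^+ 2)^-1.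

Let NT : - T < T. Proof. by rewrite gtrN. Qed.
Let pid : primT (fun t : R => t) (cst 1). Proof. exact: prim_id. Qed.
Let pA : primT phit phit1. Proof. exact: prim_A. Qed.

Lemma prim_fD (F f G g : R -> R) : primT F f -> primT G g ->
  primT (fun t => F t + G t) (fun t => f t + g t).
Proof. exact: primD. Qed.
Lemma prim_fM (F f G g : R -> R) : primT F f -> primT G g ->
  primT (fun t => F t * G t) (fun t => f t * G t + F t * g t).
Proof. by apply: primM; exact: ltW. Qed.
Lemma prim_fN (F f : R -> R) : primT F f -> primT (fun t => - F t) (fun t => - f t).
Proof. exact: primN. Qed.
Lemma prim_fX (F f : R -> R) n : primT F f ->
  primT (fun t => F t ^+ n) (fun t => n%:R * F t ^+ n.-1 * f t).
Proof.
move=> pF; elim: n => [|n IH].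
  apply: prim_eq (prim_cst _ _ 1) => t _ /=; first by rewrite expr0.
  by rewrite mul0r mul0r.
apply: prim_eq (prim_fM pF IH) => t _; first by rewrite exprS.
rewrite /=; case: n {IH} => [|n] /=; first by rewrite !expr0 !mul0r mulr0 addr0 !mul1r mulr1.
by rewrite -[n.+2%:R]natr1 exprS; ring.
Qed.

(** The density of a product or sum is first assembled from its factors, in whatever form results;
    the claimed density is then compared with it by [ring]. *)
Lemma prim_conv (F f g : R -> R) : primT F f -> (forall t, f t = g t) -> primT F g.
Proof. by move=> pF fg; apply: prim_eq pF => t _. Qed.

Ltac prim_tac := repeat match goal with
  | H : prim _ _ ?F _ |- prim _ _ ?F _ => exact: H
  | |- prim _ _ (fun _ => ?c) _ => exact: (@prim_cst _ _ _ c)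
  | |- prim _ _ (fun t => @?F t + @?G t) _ => eapply (@prim_fD F _ G _)
  | |- prim _ _ (fun t => - @?F t) _ => eapply (@prim_fN F _)
  | |- prim _ _ (fun t => @?F t * @?G t) _ => eapply (@prim_fM F _ G _)
  | |- prim _ _ (fun t => @?F t ^+ ?n) _ => eapply (@prim_fX F _ n)
  end.

Let pA1 : primT phit1 phit2.
Proof.
eapply (@prim_conv (fun t => - 2 * beta * lam * t * phit t) _ phit2); first by prim_tac.
by move=> t /=; rewrite /phit2 /phit1; ring.
Qed.

Let pA2 : primT phit2 phit3.
Proof.
eapply (@prim_conv (fun t => (4 * beta ^+ 2 * lam ^+ 2 * t ^+ 2 - 2 * beta * lam) * phit t) _ phit3);
  first by prim_tac.
by move=> t /=; rewrite /phit3 /phit1; ring.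
Qed.

Let thE j t : thg beta x0 C0 lam N s t j.+1 = s * (E j.+1 - E j) * phit t.
Proof.
rewrite /thg (_ : j.+1%:R * mesh N - mesh N = j%:R * mesh N); last by rewrite -natr1; ring.
by rewrite /Eg; ring.
Qed.

Let pe j c : primT (fun t => expR (c * thg beta x0 C0 lam N s t j.+1))
  (fun t => c * (s * (E j.+1 - E j) * phit1 t) * expR (c * thg beta x0 C0 lam N s t j.+1)).
Proof.
have H := @prim_expA R T beta C0 lam T_gt0 (c * (s * (E j.+1 - E j))).
by apply: prim_eq H => t _; rewrite thE !mulrA.
Qed.

Let pC j : primT (fun t => C t j.+1) (fun t => S t j.+1 * (s * phit1 t * (E j.+1 - E j))).
Proof.
have H1 := pe j 1; have H2 := pe j (-1).
apply: prim_eq (prim_fM (prim_fD H1 H2) (@prim_cst R (- T) T 2^-1)) => t _ /=.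
  by rewrite /Cg /cosh mul1r mulN1r.
by rewrite /Sg /sinh !mul1r !mulN1r; field.
Qed.

Let pS j : primT (fun t => S t j.+1) (fun t => C t j.+1 * (s * phit1 t * (E j.+1 - E j))).
Proof.
have H1 := pe j 1; have H2 := pe j (-1).
apply: prim_eq (prim_fM (prim_fD H1 (prim_fN H2)) (@prim_cst R (- T) T 2^-1)) => t _ /=.
  by rewrite /Sg /sinh mul1r mulN1r.
by rewrite /Cg /cosh !mul1r !mulN1r; field.
Qed.

Notation omt := (fun t j => om beta x0 C0 N s t j).
Let pom j : primT (fun t => omt t j) (fun t => s * phit1 t * E j * omt t j).
Proof.
have H := @prim_expA R T beta C0 lam T_gt0 (s * E j).
apply: prim_eq H => t _; rewrite /om phiE -/(E j); first by congr expR; ring.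
by rewrite [s * (phit t * E j)](_ : _ = s * E j * phit t); ring.
Qed.

Variables w wtt : nat -> R -> R.
Let u j := zext T (derive1 (w j)).
Let u' j := zext T (wtt j).
Hypothesis pw : forall j, (j <= N.+1)%N -> primT (w j) (u j).
Hypothesis pu : forall j, (j <= N.+1)%N -> primT (u j) (u' j).
Hypothesis w_end : forall j, (j <= N.+1)%N -> w j (- T) = 0 /\ w j T = 0.

Definition vt t j := cv beta x0 C0 N s t (fun j => w j t) j.
Definition ppt t j := cp beta x0 C0 N s t (fun j => w j t) (fun j => u j t) j.
Definition qt t j := cq beta x0 C0 N s t (fun j => w j t) (fun j => u j t) (fun j => u' j t) j.

Let pv j : (j <= N.+1)%N -> primT (fun t => vt t j) (fun t => ppt t j).
Proof.
move=> jN; have H := prim_fM (pom j) (pw jN).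
by apply: (prim_conv H) => t; rewrite /ppt /cp; ring.
Qed.

Let pp j : (j <= N.+1)%N -> primT (fun t => ppt t j) (fun t => qt t j).
Proof.
move=> jN; have H1 := pom j; have H2 := pw jN; have H3 := pu jN.
eapply (@prim_conv (fun t => omt t j * (u j t + s * phit1 t * E j * w j t)) _ (fun t => qt t j));
  first by prim_tac.
by move=> t /=; rewrite /qt /cq; ring.
Qed.

Let v_end j : (j <= N.+1)%N -> (vt (- T) j = 0 /\ vt T j = 0) /\
   (ppt (- T) j = 0 /\ ppt T j = 0).
Proof.
move=> jN; have [H1 H2] := w_end jN.
by rewrite /vt /ppt /cv /cp /u /= zextN zextT H1 H2 !mulr0 addr0 !mulr0.
Qed.

Lemma prim_bnode i : (i < N)%N -> primT
  (fun t => bnode s r k K (phit t) (phit1 t) (phit2 t) E (S t) (vt t) (ppt t) i)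
  (fun t => bnode' s r k K (phit t) (phit1 t) (phit2 t) (phit3 t) E (C t) (S t) (vt t) (ppt t) (qt t) i).
Proof.
move=> iN.
have iN1 : (i.+1 <= N.+1)%N by rewrite ltnW.
have iN2 : (i.+2 <= N.+1)%N by [].
have iN0 : (i <= N.+1)%N by rewrite ltnW// ltnW.
have v0 := pv iN0; have v1 := pv iN1; have v2 := pv iN2.
have p0 := pp iN0; have p1 := pp iN1; have p2 := pp iN2.
have S1 := pS i; have S2 := pS i.+1.
rewrite /bnode /D2 /Av.
eapply prim_conv; first by prim_tac.
by move=> t /=; rewrite /bnode' /D2 /Av /St /dE; ring.
Qed.

Lemma prim_bedge j : (j <= N)%N -> primT
  (fun t => bedge s r (phit1 t) E (C t) (vt t) j)
  (fun t => bedge' s r (phit1 t) (phit2 t) E (C t) (S t) (vt t) (ppt t) j).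
Proof.
move=> jN.
have jN0 : (j <= N.+1)%N by rewrite ltnW.
have v0 := pv jN0; have v1 := pv (jN : (j.+1 <= N.+1)%N).
have C1 := pC j.
rewrite /bedge /dE /mE.
eapply prim_conv; first by prim_tac.
by move=> t /=; rewrite /bedge' /Ct /dE /mE; ring.
Qed.

Let density t := \sum_(0 <= i < N) bnode' s r k K (phit t) (phit1 t) (phit2 t) (phit3 t) E (C t) (S t) (vt t) (ppt t) (qt t) i
  + \sum_(0 <= j < N.+1) bedge' s r (phit1 t) (phit2 t) E (C t) (S t) (vt t) (ppt t) j.

Lemma density_integral c :
  (@lebesgue_measure R).-integrable `](- T), T[ (EFin \o (fun t => c * density t)) /\
  \int[lebesgue_measure]_(t in `](- T), T[) (c * density t) = 0.
Proof.
pose B t := c * (\sum_(0 <= i < N) bnode s r k K (phit t) (phit1 t) (phit2 t) E (S t) (vt t) (ppt t) i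
  + \sum_(0 <= j < N.+1) bedge s r (phit1 t) E (C t) (vt t) j).
have pB : primT B (fun t => c * density t).
  apply: primZ; apply: prim_fD.
    by apply: prim_sum => i /andP[_ iN]; exact: prim_bnode.
  by apply: prim_sum => j /andP[_ jN]; exact: prim_bedge.
(* Every term of [bnode] and [bedge] contains a factor [v] or [p], and these vanish at both end
   times. *)
have B_end t : (forall j, (j <= N.+1)%N -> vt t j = 0 /\ ppt t j = 0) -> B t = 0.
  move=> vp; rewrite /B big_nat big1 ?add0r; last first.
    move=> i /andP[_ iN]; have [v1 p1] := vp i.+1 (ltnW iN).
    have [v0 p0] := vp i (leqW (ltnW iN)); have [v2 p2] := vp i.+2 iN.
    by rewrite /bnode /D2 /Av v1 p1 v0 v2; ring.
  rewrite big_nat big1 ?mulr0// => j /andP[_ jN].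
  have [v0 p0] := vp j (ltnW jN); have [v1 p1] := vp j.+1 jN.
  by rewrite /bedge v0 v1; ring.
apply: (prim_open_integral T_gt0 pB); apply: B_end => j jN.
  by have [[? _] [? _]] := v_end jN.
by have [[_ ?] [_ ?]] := v_end jN.
Qed.

End Density.

Section Measurability.
Context {R : realType}.
Variable T : R.
Notation mf := (measurable_fun `](- T), T[).

Lemma measurable_fun_norm_sqr (f : R -> R) : mf f -> mf (fun t => `|f t| ^+ 2).
Proof.
move=> H; rewrite (_ : (fun t => _) = f \* f); first exact: measurable_funM.
by apply/funext => t /=; rewrite real_normK ?num_real// expr2.
Qed.

Lemma measurable_dint_oo N (f : nat -> R -> R) : (forall j, (1 <= j <= N)%N -> mf (f j)) ->
  mf (fun t => dint_oo N (fun j => f j t)).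
Proof. by move=> H; apply: measurable_funM => //; apply: measurable_fun_sum_nat => j; exact: H. Qed.

Lemma measurable_dint_co N (f : nat -> R -> R) : (forall j, (j <= N)%N -> mf (f j)) ->
  mf (fun t => dint_co N (fun j => f j t)).
Proof.
by move=> H; apply: measurable_funM => //; apply: measurable_fun_sum_nat => j /andP[_]; exact: H.
Qed.

Lemma dint_oo_ge0 N (f : nat -> R) : (forall j, 0 <= f j) -> 0 <= dint_oo N f.
Proof.
by move=> H; rewrite mulr_ge0 ?(ltW (mesh_gt0 N))// sumr_ge0.
Qed.

Lemma dint_co_ge0 N (f : nat -> R) : (forall j, 0 <= f j) -> 0 <= dint_co N f.
Proof.
by move=> H; rewrite mulr_ge0 ?(ltW (mesh_gt0 N))// sumr_ge0.
Qed.

Lemma prim_measurable (F f : R -> R) : 0 < T -> prim (- T) T F f -> mf F.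
Proof.
move=> T0 pF; have NT : - T <= T by rewrite ltW// gtrN.
apply: (@measurable_funS _ _ _ _ `[- T, T]) => //; first exact: subset_itv_oo_cc.
exact: within_continuous_measurable (prim_continuous NT pF).
Qed.

Lemma measurable_fun_eq_in (f g : R -> R) : (forall t, - T < t < T -> f t = g t) -> mf f -> mf g.
Proof.
move=> fg; apply: eq_measurable_fun => t; rewrite inE/= in_itv/=; exact: fg.
Qed.

Lemma derive1_zero (u : R -> R) (t : R) :
  (forall x, - T < x < T -> u x = 0) -> - T < t < T -> derive1 u t = 0.
Proof.
move=> u0 tT; rewrite derive1E (@near_eq_derive _ _ _ u (cst 0)) ?derive_cst//.
near=> x.
apply: u0; rewrite -[_ < _ < _]/(x \in `](- T), T[).
near: x; apply: near_in_itvoo; by rewrite in_itv.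
Unshelve. all: by end_near. Qed.

End Measurability.

(** * Choice of the constants and integration of the estimate *)

Unset Implicit Arguments.
Set Strict Implicit.

Theorem theorem2p3 (R : realType) (T beta x0 C0 : R)
  (T_gt0 : 0 < T) (beta_gt0 : 0 < beta) (beta_lt1 : beta < 1)
  (x0_lt0 : x0 < 0) (C0_gt0 : 0 < C0)
  (psi_ge1 : forall t x : R, - T <= t <= T -> 0 <= x <= 1 ->
     1 <= psi x0 C0 beta t x) :
  exists s0 lambda eps h0 M : R,
    [/\ 0 < s0, 0 < lambda, 0 < eps, 0 < h0 & 0 < M] /\
    forall N : nat, let h : R := mesh N in
    h < h0 ->
    forall s : R, s0 < s -> s < eps / h ->
    forall w wtt : nat -> R -> R,
      (forall j, (j <= N.+1)%N -> has_weak_dtt T (w j) (wtt j)) ->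
      in_L2L2h T N (Lh N w wtt) ->
      (forall t : R, - T < t < T -> w 0%N t = 0 /\ w N.+1 t = 0) ->
      (forall j, (j <= N.+1)%N -> vanishes_at_ends T (w j)) ->
      let weight (t x : R) : R :=
        expR (2 * s * phi x0 C0 beta lambda t x) in
      (s%:E * time_int T (fun t => dint_oo N (fun j =>
                weight t (j%:R * h) * `|dt w j t| ^+ 2))%R
       + s%:E * time_int T (fun t => dint_co N (fun j =>
                weight t (j%:R * h) * `|Dplus N (at_time w t) j| ^+ 2))%R
       + (s ^+ 3)%:E * time_int T (fun t => dint_oo N (fun j =>
                weight t (j%:R * h) * `|w j t| ^+ 2))%R
       <=
       M%:E * time_int T (fun t => dint_oo N (fun j =>
                weight t (j%:R * h) * `|Lh N w wtt j t| ^+ 2))%R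
       + (M * s)%:E * time_int T (fun t =>
                weight t 1 * `|Dminus N (at_time w t) N.+1| ^+ 2)%R
       + (M * s)%:E * time_int T (fun t => dint_co N (fun j =>
                weight t (j%:R * h)
                * `|h * Dplus N (at_time (dt w) t) j| ^+ 2))%R)%E.
Proof.
have [k [m [M [eta0 [[k0 m0 M0 e0] H]]]]] :=
  carleman_fixed_time_original beta_gt0 beta_lt1 x0_lt0 psi_ge1.
pose lam := lambda0 beta x0.
have lam0 : 0 < lam.
  rewrite /lam /lambda0 invr_gt0; apply: mulr_gt0; first by rewrite subr_gt0.
  by rewrite exprn_even_gt0//= lt_eqF.
(* [s0] and [eps] each secure half of [s h + 1/s <= eta0]; the values 1 in them give [s >= 1] and
   [s h <= 1]. *)
exists (Num.max 1 (2 / eta0)), lam, (Num.min 1 (eta0 / 2)), 1, M; split.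
  by split=> //; [rewrite lt_max ltr01|rewrite lt_min ltr01 divr_gt0].
move=> N h _ s; rewrite gt_max => /andP[s1 s2] se w wtt Hw [HL _] Hbc Hv.
cbv zeta; pose weight (t x : R) := expR (2 * s * phi x0 C0 beta lam t x).
have h0 : 0 < h := mesh_gt0 N.
have s0 : 0 < s by exact: lt_trans s1.
have [sh1 sh2] : s * h <= 1 /\ s * h <= eta0 / 2.
  move: se; rewrite ltr_pdivlMr// lt_min => /andP[/ltW ? /ltW ?]; by split.
have eta_s : s * h + s^-1 <= eta0.
  have : s^-1 <= eta0 / 2.
    rewrite -[eta0 / 2]invrK lef_pV2 ?posrE ?invr_gt0 ?divr_gt0// invf_div.
    exact: ltW.
  by move=> ?; rewrite [leRHS](splitr eta0) lerD.
have pw j (jN : (j <= N.+1)%N) := weak_dt_prim T_gt0 (Hw j jN) (Hv j jN).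
have pu j (jN : (j <= N.+1)%N) := weak_dtt_prim T_gt0 (Hw j jN) (Hv j jN).
have w_end j (jN : (j <= N.+1)%N) : w j (- T) = 0 /\ w j T = 0.
  by have [] := Hv j jN.
have [ib b0] := @density_integral R T beta x0 C0 (kappa0 beta x0) k s N T_gt0 w wtt pw pu w_end (m * h).
pose D := `](- T), T[%classic : set R.
have mw j : (j <= N.+1)%N -> measurable_fun D (w j).
  by move=> jN; exact: prim_measurable T_gt0 (pw j jN).
have mu j : (j <= N.+1)%N -> measurable_fun D (dt w j).
  move=> jN; apply: measurable_fun_eq_in (prim_measurable T_gt0 (pu j jN)) => t tT.
  by rewrite zext_in.
have mweight x : measurable_fun D (fun t => weight t x).
  have c : continuous (fun t => expR (2 * s * phix x0 lam x * phit beta C0 lam t)).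
    move=> t; apply: continuous_comp; last exact: continuous_expR.
    apply: continuousM; first exact: cst_continuous.
    exact: continuous_of_derive (is_derive_A beta C0 lam) _.
  apply: measurable_funTS; rewrite (_ : (fun t => _) =
    (fun t => expR (2 * s * phix x0 lam x * phit beta C0 lam t))).
    exact: continuous_measurable_fun.
  by apply/funext => t; rewrite /weight phiE; congr expR; ring.
have wt0 t x : 0 <= weight t x by exact: expR_ge0.
have mDp v j : measurable_fun D (v j) -> measurable_fun D (v j.+1) ->
    measurable_fun D (fun t => Dplus N (at_time v t) j).
  by move=> m1 m2; apply: measurable_funM => //; exact: measurable_funB.
pose G1 t := dint_oo N (fun j => weight t (j%:R * h) * `|dt w j t| ^+ 2).
pose G2 t := dint_co N (fun j => weight t (j%:R * h) * `|Dplus N (at_time w t) j| ^+ 2).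
pose G3 t := dint_oo N (fun j => weight t (j%:R * h) * `|w j t| ^+ 2).
pose R1 t := dint_oo N (fun j => weight t (j%:R * h) * `|Lh N w wtt j t| ^+ 2).
pose R2 t := weight t 1 * `|Dminus N (at_time w t) N.+1| ^+ 2.
pose R3 t := dint_co N (fun j => weight t (j%:R * h) * `|h * Dplus N (at_time (dt w) t) j| ^+ 2).
have mG1 : measurable_fun D G1.
  apply: measurable_dint_oo => j /andP[_ jN]; apply: measurable_funM => //.
  by apply: measurable_fun_norm_sqr; apply: mu; exact: leqW.
have mG2 : measurable_fun D G2.
  apply: measurable_dint_co => j jN; apply: measurable_funM => //.
  by apply: measurable_fun_norm_sqr; apply: mDp; apply: mw => //; exact: leqW.
have mG3 : measurable_fun D G3.
  apply: measurable_dint_oo => j /andP[_ jN]; apply: measurable_funM => //.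
  by apply: measurable_fun_norm_sqr; apply: mw; exact: leqW.
have mR1 : measurable_fun D R1.
  by apply: measurable_dint_oo => j jN; apply: measurable_funM => //; apply: measurable_fun_norm_sqr; exact: HL.
have mR2 : measurable_fun D R2.
  apply: measurable_funM => //; apply: measurable_fun_norm_sqr; apply: measurable_funM => //.
  by apply: measurable_funB; apply: mw.
have mR3 : measurable_fun D R3.
  apply: measurable_dint_co => j jN; apply: measurable_funM => //; apply: measurable_fun_norm_sqr.
  apply: measurable_funM => //; apply: mDp; apply: mu => //; exact: leqW.
have sq0 (x y : R) : 0 <= x -> 0 <= x * `|y| ^+ 2 by move=> x0'; rewrite mulr_ge0// exprn_ge0.
have G10 t : 0 <= G1 t by apply: dint_oo_ge0 => j; exact: sq0.
have G20 t : 0 <= G2 t by apply: dint_co_ge0 => j; exact: sq0.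
have G30 t : 0 <= G3 t by apply: dint_oo_ge0 => j; exact: sq0.
have R10 t : 0 <= R1 t by apply: dint_oo_ge0 => j; exact: sq0.
have R20 t : 0 <= R2 t by exact: sq0.
have R30 t : 0 <= R3 t by apply: dint_co_ge0 => j; exact: sq0.
have s3 : 0 <= s ^+ 3 by rewrite exprn_ge0 ?ltW.
have sge0 := ltW s0; have M0' := ltW M0.
have Ms : 0 <= M * s by rewrite mulr_ge0.
have mZ (c : R) (g : R -> R) : measurable_fun D g -> measurable_fun D (fun t => c * g t).
  by move=> mg; apply: measurable_funM.
(* Each side is gathered into one time integral, so that the estimate at fixed [t] can be integrated
   without splitting off the time derivative, which has no sign. *)
rewrite -(@time_intZ R T s G1)// -(@time_intZ R T s G2)// -(@time_intZ R T (s ^+ 3) G3)//.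
rewrite -(@time_intZ R T M R1)// -(@time_intZ R T (M * s) R2)// -(@time_intZ R T (M * s) R3)//.
have nn (c : R) (g : R -> R) : 0 <= c -> (forall t, 0 <= g t) -> forall t, 0 <= c * g t.
  by move=> c0 g0 t; rewrite mulr_ge0.
rewrite -(@time_intD R T (fun t => s * G1 t) (fun t => s * G2 t));
  [|exact: mZ|exact: mZ|exact: nn|exact: nn].
rewrite -(@time_intD R T (fun t => s * G1 t + s * G2 t) (fun t => s ^+ 3 * G3 t));
  [|by apply: measurable_funD; exact: mZ|exact: mZ|by move=> t; rewrite addr_ge0 ?nn|exact: nn].
rewrite -(@time_intD R T (fun t => M * R1 t) (fun t => M * s * R2 t));
  [|exact: mZ|exact: mZ|exact: nn|exact: nn].
rewrite -(@time_intD R T (fun t => M * R1 t + M * s * R2 t) (fun t => M * s * R3 t));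
  [|by apply: measurable_funD; exact: mZ|exact: mZ|by move=> t; rewrite addr_ge0 ?nn|exact: nn].
apply: (@time_int_le R T _ _ _ _ _ ib b0).
- by apply: measurable_funD; [apply: measurable_funD|]; exact: mZ.
- by apply: measurable_funD; [apply: measurable_funD|]; exact: mZ.
- by move=> t _; apply: addr_ge0; [apply: addr_ge0|]; rewrite mulr_ge0.
- by move=> t _; apply: addr_ge0; [apply: addr_ge0|]; rewrite mulr_ge0.
move=> t tT.
have tT' : - T <= t <= T by case/andP: tT => /ltW -> /ltW ->.
have zE (f : nat -> R -> R) : (fun j => zext T (f j) t) = (fun j => f j t).
  by apply/funext => j; rewrite zext_in.
have [W0 WN] := Hbc t tT.
(* The Dirichlet condition holds on an open time interval and can therefore be differentiated. *)
have U0 : derive1 (w 0%N) t = 0.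
  by apply: (@derive1_zero R T) => // x xT; have [] := Hbc x xT.
have UN : derive1 (w N.+1) t = 0.
  by apply: (@derive1_zero R T) => // x xT; have [] := Hbc x xT.
have := H N s t (ltW s1) sh1 eta_s tT' (fun j => w j t) (fun j => derive1 (w j) t)
  (fun j => wtt j t) W0 U0 WN UN.
cbv zeta.
rewrite /vt /ppt /qt !zE.
have sqE (x : R) : `|x| ^+ 2 = x ^+ 2 by rewrite real_normK ?num_real.
have E1 : G1 t = dint_oo N (fun j => weight t (j%:R * h) * derive1 (w j) t ^+ 2).
  by congr (_ * _); apply: eq_bigr => j _; rewrite sqE.
have E2 : G2 t = dint_co N (fun j => weight t (j%:R * h) * Dplus N (fun j => w j t) j ^+ 2).
  by congr (_ * _); apply: eq_bigr => j _; rewrite sqE.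
have E3 : G3 t = dint_oo N (fun j => weight t (j%:R * h) * w j t ^+ 2).
  by congr (_ * _); apply: eq_bigr => j _; rewrite sqE.
have E4 : R1 t = dint_oo N (fun j => weight t (j%:R * h) * (wtt j t - Laph N (fun j => w j t) j) ^+ 2).
  by congr (_ * _); apply: eq_bigr => j _; rewrite sqE.
have E5 : R2 t = weight t 1 * Dminus N (fun j => w j t) N.+1 ^+ 2 by rewrite /R2 sqE.
have E6 : R3 t = dint_co N (fun j => weight t (j%:R * h)
    * (h * Dplus N (fun j => derive1 (w j) t) j) ^+ 2).
  by congr (_ * _); apply: eq_bigr => j _; rewrite sqE.
by rewrite E1 E2 E3 E4 E5 E6.
Qed.
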